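(* There is a constant $C$ such that for every function $p=p(n)\in[0,1]$ with $p>Cn^{-1/2}\log^{1/2}n$, with high probability every maximum triangle-free subgraph of the random graph $G_{n,p}$ is bipartite. That is, the probability that every triangle-free subgraph of $G_{n,p}$ having the largest possible number of edges is bipartite tends to $1$ as $n\to\infty$.
   Context: $G_{n,p}$ is the Erdős–Rényi random graph on $n$ labelled vertices in which each pair of vertices is an edge independently with probability $p$. The size of a graph is its number of edges; a maximum triangle-free subgraph of $G$ is a triangle-free subgraph of $G$ of maximum size. An event holds with high probability if its probability tends to $1$ as $n\to\infty$. $\log$ denotes the natural logarithm. *)

(* Defs.v *)
From mathcomp Require Import all_boot all_order all_algebra.
From mathcomp Require Import all_classical all_reals all_analysis.

Set Implicit Arguments.
Unset Strict Implicit.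
Unset Printing Implicit Defensive.

Import Order.TTheory GRing.Theory Num.Theory.
Import numFieldNormedType.Exports.

Local Open Scope ring_scope.

(* A simple graph on the vertex set T is given by its edge set, a subset of
   [vpairs T]; its size is then the cardinality of this set. Subgraphs are also
   given by their edge sets: isolated vertices affect neither the size, nor
   triangle-freeness, nor bipartiteness. *)
Definition vpairs (T : finType) : {set {set T}} := [set e : {set T} | #|e| == 2%N].

(* Edges have two elements, so [[set x; y] \in G] forces x != y. *)
Definition triangle_free (T : finType) (G : {set {set T}}) : bool :=
  [forall x, forall y, forall z,
    ~~ [&& [set x; y] \in G, [set y; z] \in G & [set x; z] \in G]].

Definition bipartite (T : finType) (G : {set {set T}}) : bool :=
  [exists A : {set T}, forall x, forall y,
    ([set x; y] \in G) ==> ((x \in A) != (y \in A))].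

Definition max_triangle_free (T : finType) (G F : {set {set T}}) : bool :=
  [&& F \subset G, triangle_free F &
      [forall F' : {set {set T}},
        (F' \subset G) && triangle_free F' ==> (#|F'| <= #|F|)%N]].

Definition all_max_triangle_free_bipartite (T : finType) (G : {set {set T}}) :
    bool :=
  [forall F : {set {set T}}, max_triangle_free G F ==> bipartite F].

(* The law of G_{n,p}: the product, over the pairs of vertices, of Bernoulli(p)
   laws. *)
Definition gnp_weight (R : realType) (n : nat) (p : R) (G : {set {set 'I_n}}) :
    R :=
  \prod_(e in vpairs 'I_n) (if e \in G then p else 1 - p).

Definition gnp_prob (R : realType) (n : nat) (p : R)
    (A : pred {set {set 'I_n}}) : R :=
  \sum_(G in powerset (vpairs 'I_n) | A G) gnp_weight p G.

Lemma gnp_weight_ge0 (R : realType) (n : nat) (p : R) (G : {set {set 'I_n}}) :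
  0 <= p <= 1 -> 0 <= gnp_weight p G.
Proof.
by case/andP=> p0 p1; apply: prodr_ge0 => e _; case: ifP; rewrite ?subr_ge0.
Qed.

Lemma gnp_probT (R : realType) (n : nat) (p : R) :
  gnp_prob p (xpredT : pred {set {set 'I_n}}) = 1.
Proof.
pose V := vpairs 'I_n.
have <- : \prod_e ((if e \in V then p else 0) + (if e \in V then 1 - p else 1))
    = 1 :> R.
  by rewrite big1 // => e _; case: ifP => _; rewrite ?add0r // addrC subrK.
rewrite bigA_distr /gnp_prob.
rewrite [RHS](bigID (fun J : {set {set 'I_n}} => J \in powerset V)) /=.
rewrite [X in _ = _ + X]big1 ?addr0; last first.
  move=> J; rewrite powersetE => /subsetPn[e eJ eV].
  by rewrite (bigD1 e) //= eJ (negPf eV) mul0r.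
apply: eq_big => [J|J]; first by rewrite andbT.
rewrite powersetE andbT => /fintype.subsetP JV.
rewrite /gnp_weight -/V [LHS]big_mkcond /=; apply: eq_bigr => e _.
by case: ifPn => // eV; rewrite (contraNF (JV e) eV).
Qed.

(* Main.v *)
(* Write b(G) for the largest size of a cut of G; a maximum triangle-free F has
   |F| >= b(G), and the point is that a non-bipartite one would be smaller.

   Stability.  A triangle-free F inside G is contained in one of few
   "containers" W: starting from all pairs and as long as W has many triangles,
   either many pairs of W have a common neighbour along a small set of edges of
   F, or F has few cherries over W, and in both cases a short description
   deletes many pairs of W but few edges of F.  A graph W with few triangles has,
   by averaging over its neighbourhood cuts, a cut leaving few pairs inside when
   W has about n^2 / 4 pairs, and Chernoff bounds over the few containers
   transfer this to F: since b(G) is about p n^2 / 4, F has o(p n^2) edges inside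
   some cut.

   Rigidity.  Let A maximize 10 |F on cut A| + |G on cut A|.  Edges of F inside A
   or its complement are charged to edges of G across A missing from F: first
   those at a vertex of large inner degree, then those whose ends have at least
   n p^2 / 200 common G-neighbours across A (for each such neighbour one of the
   two edges is missing).  Let Q be the set of the remaining inner edges.  Given
   the pairs outside a suitable set of "slots" (pairs joining an end of an edge
   of Q to a neighbour of the other end), b is 1-Lipschitz in the slots, so it is
   not much smaller than its conditional mean.  Refreshing the slots would add
   about p times the number of crossing slots to the cut A, while almost no
   crossing slot is present in G; hence b(G) > |G on cut A| + |Q|, which
   contradicts |F| >= b(G) unless Q is empty. *)
Require Import Defs.
From mathcomp Require Import all_boot all_order all_algebra.
From mathcomp Require Import all_classical all_reals all_analysis.
From mathcomp Require Import ring lra zify.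
From mathcomp Require Import fintype finset.

Set Implicit Arguments.
Unset Strict Implicit.
Unset Printing Implicit Defensive.

Import Order.TTheory GRing.Theory Num.Theory.
Import numFieldNormedType.Exports.

Local Open Scope ring_scope.

(** Since [F] is chosen after [G], no concentration bound applies to [F] itself: all randomness
    enters through statements about [G] that hold uniformly over small structures. A structure of
    size m has at most n^(O(m)) choices and fails with probability at most exp(-Omega(m n p^2)), so
    n p^2 >= k log n with a large k pays for the union bound; this is where the threshold comes
    from. Similarly, exp(O(n log n / p)) containers stand against Chernoff bounds exp(-Omega(p
    n^2)). The exception is the cut A of the rigidity step: it has 2^n candidates, too many for
    exp(-Omega(n p^2)). Hence inner edges with few common neighbours across A are not excluded
    directly but played against b. As b is a maximum over all cuts, its conditional mean is at least
    that of the size of every cut, so the choice of A stays inside a single event and needs no union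
    bound. *)

(** * Elementary inequalities and counting *)

Lemma expR_quad (R : realType) (x : R) : `|x| <= 3^-1 -> expR x <= 1 + x + x ^+ 2.
Proof.
move=> hx; have [x0|x0] := leP 0 x.
  have x13 : x <= 3^-1 by rewrite ger0_norm in hx.
  (* For x >= 0 invert e^(-x) >= (1 - x/2)^2: the product of (1 - x/2)^2 and 1 + x + x^2 is 1 + x^2
     (1 - 3 x + x^2) / 4, which is at least 1 since x <= 1/3. *)
  have h : 1 - x / 2 <= expR (- (x / 2)) by apply: le_trans (expR_ge1Dx _); lra.
  have h0 : 0 < 1 - x / 2 by lra.
  have e2 : expR x = (expR (- (x / 2)) ^+ 2)^-1.
    rewrite -expRM_natl -expRN; congr expR; lra.
  rewrite e2 -[leRHS]invrK lef_pV2 ?posrE ?exprn_gt0 ?expR_gt0 ?invr_gt0 //; last by nra.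
  apply: le_trans (_ : (1 - x / 2) ^+ 2 <= _); last first.
    by rewrite ler_pXn2r // nnegrE ?expR_ge0 // ltW.
  rewrite -div1r ler_pdivrMr; last by nra.
  have : 0 <= x ^+ 2 * (1 - 3 * x + x ^+ 2) by apply: mulr_ge0; nra.
  nra.
(* For x < 0, e^(-x) >= 1 - x, and 1 - x times 1 + x + x^2 is 1 - x^3 >= 1. *)
have h : 1 - x <= expR (- x) by apply: le_trans (expR_ge1Dx _); lra.
have -> : expR x = (expR (- x))^-1 by rewrite -expRN opprK.
rewrite -[leRHS]invrK lef_pV2 ?posrE ?expR_gt0 ?invr_gt0 //; last by rewrite ltr0_norm // in hx; nra.
apply: le_trans h; rewrite -div1r ler_pdivrMr; last first.
  by rewrite ltr0_norm // in hx; nra.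
have : 0 <= - x * x ^+ 2 by apply: mulr_ge0; [lra|nra].
nra.
Qed.

(** Serves both to expand moment generating functions and to sum union bounds over all subsets of a
    set at once. *)
Lemma sum_powerset (R : realType) (I : finType) (A : {set I}) (x : R) :
  \sum_(J in powerset A) x ^+ #|J| = (1 + x) ^+ #|A|.
Proof.
pose F i : R := if i \in A then x else 0.
have := @bigA_distr R 0 1 *%R +%R I F (fun=> 1).
rewrite (bigID (mem A)) /= [X in _ * X]big1 ?mulr1; last first.
  by move=> i /negPf iA; rewrite /F iA add0r.
rewrite (eq_bigr (fun=> 1 + x)) => [|i iA]; last by rewrite /F iA addrC.
rewrite prodr_const => ->.
rewrite [RHS](bigID (fun J : {set I} => J \in powerset A)) /=.
rewrite [X in _ = _ + X]big1 ?addr0 => [|J]; last first.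
  rewrite powersetE => /subsetPn[i iJ iA].
  by rewrite (bigD1 i) //= iJ /F (negPf iA) mul0r.
apply: eq_big => // J; rewrite powersetE => /subsetP JA.
rewrite -big_mkcond /= (eq_bigr (fun=> x)) ?prodr_const // => i /JA iA.
by rewrite /F iA.
Qed.

Lemma card_bigcup_disjoint (I U : finType) (J : {set I}) (b : I -> {set U}) (j : nat) :
  {in J, forall i, #|b i| = j} ->
  {in J &, forall i i', i != i' -> [disjoint b i & b i']} ->
  #|\bigcup_(i in J) b i| = (#|J| * j)%N.
Proof.
move=> hb disj; rewrite -sum_nat_const -(eq_bigr _ hb).
transitivity (\sum_(u : U) \sum_(i in J) (u \in b i))%N.
  rewrite -sum1_card big_mkcond /=; apply: eq_bigr => u _.
  case: bigcupP => [[i iJ ui]|h].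
    rewrite (bigD1 i) //= ui big1 ?addn0 // => i' /andP[i'J i'i].
    have := disj _ _ i'J iJ i'i; rewrite disjoints_subset => /subsetP h.
    by apply/eqP; rewrite eqb0; apply/negP => /h; rewrite inE ui.
  by rewrite big1 // => i iJ; apply/eqP; rewrite eqb0; apply/negP => ui; apply: h; exists i.
rewrite exchange_big /=; apply: eq_bigr => i _.
by rewrite -sum1_card [RHS]big_mkcond; apply: eq_bigr => u _; case: (u \in b i).
Qed.

(** * Product Bernoulli measures on subsets *)

Section Bernoulli.
Variables (R : realType) (U : finType) (V : {set U}) (p : R).
Hypothesis p01 : 0 <= p <= 1.

Definition bern_weight (G : {set U}) : R :=
  \prod_(e in V) (if e \in G then p else 1 - p).

Definition expect (f : {set U} -> R) : R :=
  \sum_(G in powerset V) bern_weight G * f G.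

Definition prob (A : pred {set U}) : R := expect (fun G => (A G)%:R).

(* [resample e f] averages [f] over a fresh value of the bit [e]; iterating it
   over the bits of [S] gives the conditional expectation given the bits
   outside [S]. *)
Definition resample (e : U) (f : {set U} -> R) (G : {set U}) : R :=
  p * f (e |: G) + (1 - p) * f (G :\ e).

Definition resamples (s : seq U) (f : {set U} -> R) : {set U} -> R :=
  foldr resample f s.

Definition insensitive (T : Type) (e : U) (f : {set U} -> T) : Prop :=
  forall G, f (e |: G) = f (G :\ e).

Definition lipschitz_at (e : U) (f : {set U} -> R) : Prop :=
  forall G, `|f (e |: G) - f (G :\ e)| <= 1.

Lemma bern_weight_ge0 G : 0 <= bern_weight G.
Proof.
by case/andP: p01 => p0 p1; apply: prodr_ge0 => e _; case: ifP; rewrite ?subr_ge0.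
Qed.

Lemma eq_expect f g :
  (forall G : {set U}, G \subset V -> f G = g G) -> expect f = expect g.
Proof. by move=> h; apply: eq_bigr => G; rewrite powersetE => /h ->. Qed.

Lemma le_expect f g :
  (forall G : {set U}, G \subset V -> f G <= g G) -> expect f <= expect g.
Proof.
move=> h; apply: ler_sum => G; rewrite powersetE => /h fg.
by rewrite ler_wpM2l // bern_weight_ge0.
Qed.

Lemma expect_ge0 f : (forall G : {set U}, G \subset V -> 0 <= f G) -> 0 <= expect f.
Proof.
move=> h; apply: sumr_ge0 => G; rewrite powersetE => /h fg.
by rewrite mulr_ge0 // bern_weight_ge0.
Qed.

Lemma expect_mull c f : expect (fun G => c * f G) = c * expect f.
Proof. by rewrite /expect mulr_sumr; apply: eq_bigr => G _; rewrite mulrCA. Qed.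

Lemma expect_sum (I : Type) (r : seq I) (P : pred I) (F : I -> {set U} -> R) :
  expect (fun G => \sum_(i <- r | P i) F i G) = \sum_(i <- r | P i) expect (F i).
Proof.
rewrite /expect exchange_big /=; apply: eq_bigr => G _.
by rewrite mulr_sumr.
Qed.

Lemma expect_resample e f : e \in V -> expect (resample e f) = expect f.
Proof.
move=> eV.
pose w' (G : {set U}) := \prod_(d in V | d != e) (if d \in G then p else 1 - p).
(* Pair each [G] avoiding [e] with [e |: G]; their weights are (1 - p) w' and p w' for the same
   [w']. As [resample e f] agrees on the two sets, averaging it over the bit changes nothing. *)
have split_bit g : expect g = \sum_(G in powerset V | e \notin G)
    w' G * (p * g (e |: G) + (1 - p) * g G).
  rewrite /expect (bigID (fun G : {set U} => e \in G)) /=.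
  rewrite (reindex_onto (fun H => e |: H) (fun G => G :\ e)) /=; last first.
    by move=> G /andP[_ eG]; rewrite setD1K.
  rewrite (eq_bigl (fun G => (G \in powerset V) && (e \notin G))); last first.
    move=> G; rewrite !powersetE setU11 andbT subUset sub1set eV /=.
    have [eG|eG] := boolP (e \in G); last by rewrite setU1K // eqxx.
    rewrite andbF; apply/andP => -[_ /eqP h].
    by move: eG; rewrite -h !inE eqxx.
  rewrite -big_split /=; apply: eq_bigr => G /andP[_ eG].
  have -> : bern_weight (e |: G) = p * w' G.
    rewrite /bern_weight (bigD1 e) //= setU11; congr (_ * _).
    by apply: eq_bigr => d /andP[_ /negPf de]; rewrite !inE de.
  have -> : bern_weight G = (1 - p) * w' G.
    by rewrite /bern_weight (bigD1 e) //= (negPf eG).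
  ring.
rewrite !split_bit; apply: eq_bigr => G /andP[_ eG]; congr (_ * _).
have GD : G :\ e = G by apply/setDidPl; rewrite disjoint_sym disjoints1.
rewrite /resample setUA setUid setU1K // GD.
ring.
Qed.

Lemma expect1 : expect (fun=> 1) = 1.
Proof.
rewrite /expect.
have total : \prod_e ((if e \in V then p else 0) + (if e \in V then 1 - p else 1))
    = 1 :> R.
  by rewrite big1 // => e _; case: ifP => _; rewrite ?add0r // addrC subrK.
rewrite -[RHS]total bigA_distr [RHS](bigID (fun J : {set U} => J \in powerset V)) /=.
rewrite [X in _ = _ + X]big1 ?addr0; last first.
  move=> J; rewrite powersetE => /subsetPn[e eJ eV].
  by rewrite (bigD1 e) //= eJ (negPf eV) mul0r.
apply: eq_big => // J; rewrite powersetE mulr1 => /subsetP JV.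
rewrite /bern_weight [LHS]big_mkcond /=; apply: eq_bigr => e _.
by case: (boolP (e \in V)) => // eV; rewrite (contraNF (JV e) eV).
Qed.

Lemma le_prob (A B : pred {set U}) :
  (forall G : {set U}, G \subset V -> A G -> B G) -> prob A <= prob B.
Proof.
move=> h; rewrite /prob; apply: le_expect => G GV.
by rewrite ler_nat; case: (A G) (h G GV) => // ->.
Qed.

Lemma prob_union (I : finType) (P : pred I) (A : pred {set U})
    (B : I -> pred {set U}) :
  (forall G : {set U}, G \subset V -> A G -> exists2 i, P i & B i G) ->
  prob A <= \sum_(i | P i) prob (B i).
Proof.
move=> h; rewrite /prob -expect_sum; apply: le_expect => G GV.
case AG: (A G); last by apply: sumr_ge0.
have [i Pi Bi] := h G GV AG.
by rewrite (bigD1 i) //= Bi lerDl sumr_ge0.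
Qed.

Lemma prob_union2 (A B C : pred {set U}) :
  (forall G : {set U}, G \subset V -> A G -> B G || C G) -> prob A <= prob B + prob C.
Proof.
move=> h; rewrite (le_trans (prob_union (P := predT) (B := fun b : bool => if b then B else C) _)) //.
  by move=> G GV /(h G GV) /orP[]; [exists true|exists false].
by rewrite big_bool.
Qed.

Lemma probC (A : pred {set U}) : prob A = 1 - prob (fun G => ~~ A G).
Proof.
rewrite -expect1 /prob /expect -sumrB; apply: eq_bigr => G _.
by case: (A G) => /=; rewrite ?mulr0 ?mulr1 ?subr0 ?subrr.
Qed.

Lemma insensitive_val (T : Type) e (h : {set U} -> T) : insensitive e h ->
  forall G, h (e |: G) = h G /\ h (G :\ e) = h G.
Proof.
move=> he G; have [eG|eG] := boolP (e \in G).
  have -> : e |: G = G by apply/setUidPr; rewrite sub1set.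
  by split=> //; rewrite -he; congr h; apply/setUidPr; rewrite sub1set.
have Ge : G :\ e = G by apply/setDidPl; rewrite disjoint_sym disjoints1.
by rewrite he Ge.
Qed.

Lemma resample_insensitive e h f : insensitive e h ->
  resample e (fun G => h G * f G) =1 (fun G => h G * resample e f G).
Proof.
by move=> /insensitive_val he G; rewrite /resample; have [-> ->] := he G; ring.
Qed.

Lemma expect_subset (J : {set U}) : J \subset V ->
  expect (fun G => (J \subset G)%:R) = p ^+ #|J|.
Proof.
move: {2}#|J| (leqnn #|J|) => m; elim: m J => [|m IH] J.
  rewrite leqn0 cards_eq0 => /eqP -> _; rewrite cards0 expr0 -[RHS]expect1.
  by apply: eq_expect => G _; rewrite sub0set.
have [->|[e eJ]] := set_0Vmem J.
  by move=> _ _; rewrite cards0 expr0 -[RHS]expect1; apply: eq_expect => G _; rewrite sub0set.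
rewrite (cardsD1 e J) eJ ltnS => Jm JV.
have JD : J :\ e \subset V by rewrite (subset_trans (subsetDl _ _)).
rewrite exprS -IH // -(expect_resample _ (subsetP JV e eJ)) -expect_mull.
apply: eq_expect => G _; rewrite /resample.
have -> : (J \subset G :\ e) = false.
  by apply/negbTE/subsetPn; exists e => //; rewrite !inE eqxx.
by rewrite mulr0 addr0 subDset.
Qed.

Lemma prob_ge0 (A : pred {set U}) : 0 <= prob A.
Proof. by rewrite /prob; apply: expect_ge0 => G _; rewrite ler0n. Qed.

Lemma markov_exp (A : pred {set U}) (f : {set U} -> R) (c : R) :
  (forall G : {set U}, G \subset V -> A G -> c <= f G) ->
  prob A <= expect (fun G => expR (f G)) * expR (- c).
Proof.
move=> h; rewrite mulrC -expect_mull /prob; apply: le_expect => G GV.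
rewrite -expRD; case AG: (A G); last exact: expR_ge0.
by rewrite -expR0 ler_expR addrC subr_ge0 h.
Qed.

Lemma lipschitz_resample e e' f :
  lipschitz_at e f -> lipschitz_at e (resample e' f).
Proof.
move=> he G; rewrite /resample; have /andP[p0 p1] := p01.
have [<-|ee'] := eqVneq e e'.
  have -> : e |: (e |: G) = e |: (G :\ e) by apply/setP => x; rewrite !inE; case: eqP.
  have -> : (e |: G) :\ e = G :\ e :\ e by apply/setP => x; rewrite !inE; case: eqP.
  by rewrite subrr normr0.
have -> : e' |: (e |: G) = e |: (e' |: G) by rewrite setUCA.
have -> : (e |: G) :\ e' = e |: (G :\ e').
  apply/setP => x; rewrite !inE; case: (eqVneq x e) => [->|] //=.
  by rewrite ee'.
have -> : e' |: (G :\ e) = (e' |: G) :\ e.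
  apply/setP => x; rewrite !inE; case: (eqVneq x e') => [->|] //=.
  by rewrite eq_sym ee'.
have -> : G :\ e :\ e' = G :\ e' :\ e by apply/setP => x; rewrite !inE andbCA.
have := he (e' |: G); have := he (G :\ e').
set a := f _; set b := f _; set c := f _; set d := f _ => h1 h2.
have -> : p * c + (1 - p) * a - (p * d + (1 - p) * b) =
  p * (c - d) + (1 - p) * (a - b) by ring.
rewrite (le_trans (ler_normD _ _)) // !normrM (ger0_norm p0).
have q0 : 0 <= 1 - p by rewrite subr_ge0.
by rewrite (ger0_norm q0); nra.
Qed.

Lemma lipschitz_resamples e s f : lipschitz_at e f -> lipschitz_at e (resamples s f).
Proof. by move=> h; elim: s => //= e' s; exact: lipschitz_resample. Qed.

Lemma insensitive_resample e f : insensitive e (resample e f).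
Proof.
move=> G; rewrite /resample; congr (p * f _ + _ * f _);
by apply/setP => x; rewrite !inE; case: eqP.
Qed.

Lemma insensitive_resample2 e e' f :
  insensitive e f -> insensitive e (resample e' f).
Proof.
move=> he; have [<-|ee' G] := eqVneq e e'; first exact: insensitive_resample.
rewrite /resample.
have -> : e' |: (e |: G) = e |: (e' |: G) by rewrite setUCA.
have -> : (e |: G) :\ e' = e |: (G :\ e').
  apply/setP => x; rewrite !inE; case: (eqVneq x e) => [->|] //=.
  by rewrite ee'.
have -> : e' |: (G :\ e) = (e' |: G) :\ e.
  apply/setP => x; rewrite !inE; case: (eqVneq x e') => [->|] //=.
  by rewrite eq_sym ee'.
have -> : G :\ e :\ e' = G :\ e' :\ e by apply/setP => x; rewrite !inE andbCA.
by rewrite !he.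
Qed.

Lemma insensitive_resamples e s f : e \in s -> insensitive e (resamples s f).
Proof.
elim: s => //= e' s IH; rewrite inE => /predU1P[<-|es].
  exact: insensitive_resample.
exact/insensitive_resample2/IH.
Qed.

(** A Bernoulli(p) bit that moves [g] by at most 1 contributes variance at most p. Keeping this
    factor p, which a bound by the range alone would lose, gives deviations on the scale of p |S|
    below. *)
Lemma resample_mgf e g (lam : R) G : 0 <= lam <= 3^-1 -> lipschitz_at e g ->
  resample e (fun H => expR (- (lam * g H))) G <=
  expR (p * lam ^+ 2) * expR (- (lam * resample e g G)).
Proof.
move=> /andP[l0 l1] /(_ G); rewrite /resample; have /andP[p0 p1] := p01.
set a := g _; set b := g _ => ab.
pose u := lam * (a - b).
have uu : `|- u| <= 3^-1.
  by rewrite normrN normrM (ger0_norm l0); have := normr_ge0 (a - b); nra.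
have -> : expR (- (lam * a)) = expR (- (lam * b)) * expR (- u).
  by rewrite -expRD; congr expR; rewrite /u; ring.
have -> : - (lam * (p * a + (1 - p) * b)) = - (lam * b) - p * u.
  by rewrite /u; ring.
rewrite expRD; set B := expR (- (lam * b)).
have -> : p * (B * expR (- u)) + (1 - p) * B = B * (1 + p * (expR (- u) - 1)) by ring.
rewrite mulrCA ler_pM2l ?expR_gt0 // -expRD.
have := expR_quad uu; rewrite sqrrN => h.
apply: le_trans (_ : 1 + p * (- u + u ^+ 2) <= _); first by nra.
apply: le_trans (expR_ge1Dx _) _; rewrite ler_expR.
suff : u ^+ 2 <= lam ^+ 2 by nra.
rewrite /u exprMn -[leRHS]mulr1 ler_wpM2l ?exprn_ge0 //.
by rewrite -real_normK ?num_real // expr_le1.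
Qed.

Lemma expect_mgf s g (h : {set U} -> R) (lam : R) : 0 <= lam <= 3^-1 ->
  (forall e, e \in s -> [/\ e \in V, lipschitz_at e g & insensitive e h]) ->
  (forall G, 0 <= h G) ->
  expect (fun G => h G * expR (- (lam * g G))) <=
  expR (p * lam ^+ 2 * (size s)%:R) *
    expect (fun G => h G * expR (- (lam * resamples s g G))).
Proof.
move=> lam01; elim: s => [|e s IH] hs h0 /=.
  by rewrite mulr0 expR0 mul1r.
have [eV ge he] := hs e (mem_head _ _).
apply: le_trans (IH _ h0) _ => [e' e's|]; first by apply: hs; rewrite inE e's orbT.
rewrite -[(size s).+1]addn1 natrD mulrDr mulr1 expRD -[leRHS]mulrA.
rewrite ler_wpM2l ?expR_ge0 // -expect_mull -(expect_resample _ eV).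
apply: le_expect => G _; rewrite resample_insensitive // mulrCA ler_wpM2l //.
exact/resample_mgf/lipschitz_resamples.
Qed.

(** A Chernoff bound conditional on the bits outside [S]. The conditional mean of [g] ignores the
    bits of [S], so the indicator of [H] times exp(lam * mean) can be the [h] of [expect_mgf]; the
    two exponentials then cancel and leave [prob H]. Keeping that factor allows summation over
    disjoint events [H]. *)
Lemma lipschitz_tail (S : {set U}) g (H : pred {set U}) (lam dev : R) :
  0 <= lam <= 3^-1 ->
  (forall e, e \in S -> [/\ e \in V, lipschitz_at e g & insensitive e H]) ->
  prob (fun G => H G && (g G <= resamples (enum S) g G - dev)) <=
  expR (p * lam ^+ 2 * #|S|%:R - lam * dev) * prob H.
Proof.
move=> lam01 hS.
pose h G := (H G)%:R * expR (lam * resamples (enum S) g G).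
have key := @expect_mgf (enum S) g h lam lam01 _ _; rewrite -cardE in key.
have hh : expect (fun G => h G * expR (- (lam * resamples (enum S) g G))) = prob H.
  by apply: eq_expect => G _; rewrite /h -mulrA -expRD subrr expR0 mulr1.
rewrite hh in key; rewrite expRD -mulrA mulrCA mulrC.
apply: le_trans (ler_wpM2r (expR_ge0 _) (key _ _)) => [|e|G]; first last.
- by rewrite mulr_ge0 ?expR_ge0.
- move=> eS; have [|eV ge He] := hS e; first by rewrite -mem_enum.
  split=> // G.
  by rewrite /h He (insensitive_resamples (s := enum S)).
rewrite mulrC -expect_mull /prob; apply: le_expect => G _.
rewrite /h; case: (H G) => /=; last by rewrite !mul0r mulr0.
rewrite mul1r -!expRD; case: (leP (g G) _) => [hg|_] /=;
  last by rewrite mulr0n expR_ge0.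
rewrite -expR0 ler_expR; case/andP: lam01 => l0 _.
have : 0 <= lam * (resamples (enum S) g G - dev - g G).
  by rewrite mulr_ge0 // subr_ge0.
by rewrite !mulrBr; move: (lam * _) (lam * _) (lam * _) => a b d; clear; lra.
Qed.

Lemma card_setI_add (e : U) (P G : {set U}) :
  (#|(e |: G) :&: P| = #|(G :\ e) :&: P| + (e \in P))%N.
Proof.
rewrite (cardsD1 e) addnC !inE eqxx /=; congr (_ + _)%N.
by apply: eq_card => x; rewrite !inE; case: eqP.
Qed.

Lemma lipschitz_card (e : U) (P : {set U}) :
  lipschitz_at e (fun G => #|G :&: P|%:R).
Proof.
by move=> G; rewrite card_setI_add natrD addrAC subrr add0r normr_nat lern1 leq_b1.
Qed.

Lemma lipschitz_cardN (e : U) (P : {set U}) :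
  lipschitz_at e (fun G => - #|G :&: P|%:R).
Proof.
by move=> G; rewrite -opprD normrN; exact: lipschitz_card.
Qed.

Lemma le_resamples (s : seq U) f g :
  (forall G, f G <= g G) -> forall G, resamples s f G <= resamples s g G.
Proof.
move=> fg; have /andP[p0 p1] := p01; elim: s => //= e s IH G.
by rewrite /resample lerD // ler_wpM2l // subr_ge0.
Qed.

Lemma resamplesN (s : seq U) f G :
  resamples s (fun H => - f H) G = - resamples s f G.
Proof. by elim: s G => //= e s IH G; rewrite /resample !IH; ring. Qed.

Lemma resamples_card (S P G : {set U}) :
  resamples (enum S) (fun H => #|H :&: P|%:R) G =
  #|(G :\: S) :&: P|%:R + p * #|S :&: P|%:R.
Proof.
suff gen (s : seq U) : uniq s -> forall G : {set U},
    resamples s (fun H => #|H :&: P|%:R) G =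
    #|(G :\: [set x in s]) :&: P|%:R + p * #|[set x in s] :&: P|%:R.
  by rewrite gen ?enum_uniq // set_enum.
elim: s => [_ H|e s IH /= /andP[es us] H] /=.
  by rewrite set_nil setD0 set0I cards0 mulr0 addr0.
rewrite /resample !IH //.
have -> : (e |: H) :\: [set x in s] = e |: (H :\: [set x in s]).
  apply/setP => x; rewrite !inE; case: (eqVneq x e) => [->|//] /=.
  by rewrite es.
have -> : H :\ e :\: [set x in s] = (H :\: [set x in s]) :\ e.
  by apply/setP => x; rewrite !inE andbCA.
rewrite card_setI_add.
have -> : H :\: [set x in e :: s] = (H :\: [set x in s]) :\ e.
  by apply/setP => x; rewrite !inE negb_or andbA.
have -> : [set x in e :: s] = e |: [set x in s].
  by apply/setP => x; rewrite !inE.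
rewrite card_setI_add; have -> : [set x in s] :\ e = [set x in s].
  by apply/setDidPl; rewrite disjoint_sym disjoints1 inE.
rewrite !natrD; ring.
Qed.

(** Disjoint blocks are present independently, each with probability p^j. With exponent 2 the moment
    generating function is at most exp(8 mean) <= exp(8 t / 9), because e^2 <= 9, and 8 t / 9 - 2 t
    <= - t. *)
Lemma blocks_tail (I : finType) (A : {set I}) (b : I -> {set U}) (j : nat) (t : R) :
  {in A, forall i, b i \subset V /\ #|b i| = j} ->
  {in A &, forall i i', i != i' -> [disjoint b i & b i']} ->
  9 * #|A|%:R * p ^+ j <= t ->
  prob (fun G => t <= #|[set i in A | b i \subset G]|%:R) <= expR (- t).
Proof.
move=> hb disj ht; have /andP[p0 p1] := p01.
have e2 : expR 2 <= 9 :> R.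
  have -> : expR 2 = expR 4^-1 ^+ 8 :> R by rewrite -expRM_natr; congr expR; lra.
  have h4 : expR 4^-1 <= 21 / 16 :> R.
    by apply: le_trans (expR_quad _) _; [rewrite ger0_norm; lra|lra].
  apply: le_trans (_ : (21 / 16 : R) ^+ 8 <= _); last by rewrite !exprS expr0; lra.
  by rewrite ler_pXn2r // nnegrE ?expR_ge0.
apply: (le_trans (markov_exp (f := fun G => 2 * #|[set i in A | b i \subset G]|%:R) (c := 2 * t) _)).
  by move=> G _ h; rewrite ler_pM2l.
pose c : R := expR 2 - 1.
have c0 : 0 <= c by rewrite subr_ge0 -expR0 ler_expR.
have -> : expect (fun G => expR (2 * #|[set i in A | b i \subset G]|%:R)) =
    (1 + c * p ^+ j) ^+ #|A|.
  (* With X blocks present, e^(2 X) = (1 + c)^X is the sum of c^|J| over the sets J of present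
     blocks. *)
  transitivity (expect (fun G => \sum_(J in powerset A)
      c ^+ #|J| * (\bigcup_(i in J) b i \subset G)%:R)).
    apply: eq_expect => G _.
    rewrite expRM_natr -[expR 2](subrK 1) -/c addrC -sum_powerset.
    rewrite [LHS]big_mkcond [RHS]big_mkcond /=; apply: eq_bigr => J _.
    rewrite !powersetE; have [JA|JA] := boolP (J \subset A); last first.
      by case: ifP => // /subset_trans h; rewrite h // in JA; apply/subsetP => i; rewrite inE => /andP[].
    suff -> : (J \subset [set i in A | b i \subset G]) = (\bigcup_(i in J) b i \subset G).
      by case: ifP => _; rewrite ?mulr1 ?mulr0.
    apply/subsetP/bigcupsP => h i iJ; first by have := h i iJ; rewrite inE => /andP[].
    by rewrite inE h // (subsetP JA).
  rewrite expect_sum -sum_powerset; apply: eq_bigr => J.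
  rewrite powersetE => JA; rewrite expect_mull expect_subset; last first.
    by apply/bigcupsP => i iJ; have [] := hb i (subsetP JA i iJ).
  rewrite exprMn -exprM; congr (_ * p ^+ _).
  rewrite mulnC; apply: card_bigcup_disjoint => [i iJ|i i' iJ i'J].
    by have [] := hb i (subsetP JA i iJ).
  by apply: disj; apply: (subsetP JA).
apply: le_trans (_ : expR (8 * p ^+ j * #|A|%:R) * expR (- (2 * t)) <= _).
  rewrite ler_wpM2r ?expR_ge0 // expRM_natr.
  apply: lerXn2r; rewrite ?nnegrE ?expR_ge0 ?addr_ge0 ?mulr_ge0 ?exprn_ge0 //.
  apply: le_trans (expR_ge1Dx _); rewrite lerD2l ler_wpM2r ?exprn_ge0 //.
  by rewrite /c; lra.
rewrite -expRD ler_expR.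
have : 0 <= p ^+ j * #|A|%:R by rewrite mulr_ge0 ?exprn_ge0.
move: ht; rewrite -mulrA (mulrC #|A|%:R); lra.
Qed.

End Bernoulli.

(** A union bound over all nonempty sets thus costs at most twice the one over singletons. *)
Lemma sum_expr_card_nonempty (R : realType) (I : finType) (x : R) :
  0 <= x -> x * #|I|%:R <= 3^-1 ->
  \sum_(J : {set I} | J != set0) x ^+ #|J| <= 2 * (x * #|I|%:R).
Proof.
move=> x0 xI; have := sum_powerset [set: I] x.
rewrite (eq_bigl predT) => [|J]; last by rewrite powersetE subsetT.
rewrite cardsT (bigD1 set0) //= cards0 expr0 => h.
have y0 : 0 <= x * #|I|%:R by rewrite mulr_ge0.
have : (1 + x) ^+ #|I| <= 1 + x * #|I|%:R + (x * #|I|%:R) ^+ 2.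
  apply: le_trans (expR_quad _); last by rewrite ger0_norm.
  rewrite expRM_natr; apply: lerXn2r; rewrite ?nnegrE ?expR_ge0 ?addr_ge0 //.
  exact: expR_ge1Dx.
rewrite -h; nra.
Qed.

(** * Cuts and missing crossing edges *)

Section Graphs.
Variable T : finType.
Implicit Types (G H F J M W : {set {set T}}) (A S : {set T}) (x y : T).

Definition nb H x : {set T} := [set y | [set x; y] \in H].

Definition cut A : {set {set T}} := [set e in vpairs T | #|e :&: A| == 1%N].

Definition opposite A x : {set T} := [set v | (v \in A) != (x \in A)].

Lemma in_nb H x y : (y \in nb H x) = ([set x; y] \in H).
Proof. by rewrite inE. Qed.

Lemma nbC H x y : (y \in nb H x) = (x \in nb H y).
Proof. by rewrite !in_nb setUC. Qed.

Lemma in_vpairs x y : ([set x; y] \in vpairs T) = (x != y).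
Proof. by rewrite inE cards2; case: (x == y). Qed.

Lemma vpairsP e : reflect (exists x y, x != y /\ e = [set x; y]) (e \in vpairs T).
Proof.
by rewrite inE; exact: cards2P. Qed.

Lemma nb_neq H x y : H \subset vpairs T -> y \in nb H x -> x != y.
Proof. by move=> /subsetP HV; rewrite in_nb => /HV; rewrite in_vpairs. Qed.

Lemma nbS H G x : H \subset G -> nb H x \subset nb G x.
Proof. by move=> /subsetP HG; apply/subsetP => y; rewrite !in_nb => /HG. Qed.

Lemma in_cut A x y : ([set x; y] \in cut A) = ((x \in A) != (y \in A)).
Proof.
rewrite inE in_vpairs; have [->|xy] /= := eqVneq x y; first by rewrite eqxx.
have -> : [set x; y] :&: A = (if x \in A then [set x] else set0) :|:
   (if y \in A then [set y] else set0).
  apply/setP => z; rewrite !inE.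
  have inif (b : bool) u : (z \in (if b then [set u] else set0)) = b && (z == u).
    by case: b; rewrite inE.
  rewrite !inif; have [->|_] := eqVneq z x; first by rewrite (negPf xy) /= andbT andbF orbF.
  by have [->|_] := eqVneq z y; rewrite /= ?andbF ?andbT.
case: ifP => _; case: ifP => _; rewrite ?setU0 ?set0U ?cards0 ?cards1 //.
by rewrite cards2 xy.
Qed.

Lemma cut_vpairs A : cut A \subset vpairs T.
Proof. by apply/subsetP => e; rewrite inE => /andP[]. Qed.

Lemma card_sum_in (S : {set T}) : (#|S| = \sum_x (x \in S))%N.
Proof. by rewrite -sum1_card big_mkcond; apply: eq_bigr => x _; case: (x \in S). Qed.

Lemma handshake H : H \subset vpairs T -> (\sum_x #|nb H x| = 2 * #|H|)%N.
Proof.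
move=> /subsetP HV.
transitivity (\sum_(e in H) \sum_x (x \in e))%N; last first.
  rewrite mulnC -sum_nat_const; apply: eq_bigr => e eH.
  by rewrite -card_sum_in; apply/eqP; have := HV e eH; rewrite inE.
rewrite exchange_big /=; apply: eq_bigr => x _.
have -> : (\sum_(e in H) (x \in e) = #|[set e in H | x \in e]|)%N.
  rewrite -sum1_card [LHS]big_mkcond [RHS]big_mkcond /=.
  by apply: eq_bigr => e _; rewrite inE; case: (e \in H); case: (x \in e).
rewrite -(card_in_imset (f := fun y => [set x; y]) (D := nb H x)).
  apply: eq_card => e; apply/imsetP/idP => [[y]|].
    by rewrite in_nb => yH ->; rewrite !inE yH eqxx.
  rewrite inE => /andP[eH xe]; have /vpairsP[u [v [uv E]]] := HV e eH.
  move: xe; rewrite E !inE => /orP[]/eqP ->; [exists v|exists u] => //.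
    by rewrite in_nb -E.
    by rewrite in_nb setUC -E.
  by rewrite setUC.
move=> y z; rewrite !in_nb => yH zH E.
have := HV _ yH; have := HV _ zH; rewrite !in_vpairs => xz xy.
have : y \in [set x; z] by rewrite -E !inE eqxx orbT.
by rewrite !inE eq_sym (negPf xy) => /eqP.
Qed.

Lemma triangle_freeP F x y z : triangle_free F ->
  y \in nb F x -> z \in nb F y -> z \in nb F x -> False.
Proof.
move=> /forallP/(_ x)/forallP/(_ y)/forallP/(_ z)/negP h; rewrite !in_nb => a b c.
by apply: h; rewrite a b c.
Qed.

Lemma cut_triangle_free G A : G \subset cut A -> triangle_free G.
Proof.
move=> /subsetP GA; apply/forallP => x; apply/forallP => y; apply/forallP => z.
apply/negP => /and3P[/GA + /GA + /GA]; rewrite !in_cut.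
by case: (x \in A); case: (y \in A); case: (z \in A).
Qed.

Lemma bipartite_cut F A : F \subset cut A -> bipartite F.
Proof.
move=> /subsetP FA; apply/existsP; exists A; apply/forallP => x; apply/forallP => y.
by apply/implyP => /FA; rewrite in_cut.
Qed.

Section Real.
Variable R : realFieldType.

Lemma cardR_sum (S : {set T}) : #|S|%:R = \sum_x (x \in S)%:R :> R.
Proof. by rewrite card_sum_in natr_sum. Qed.

Lemma handshakeR H : H \subset vpairs T ->
  \sum_x \sum_y (y \in nb H x)%:R = 2 * #|H|%:R :> R.
Proof.
move=> HV; rewrite -natrM -handshake // natr_sum.
by apply: eq_bigr => x _; rewrite -cardR_sum.
Qed.

Lemma leR_cards (S S' : {set T}) : S \subset S' -> #|S|%:R <= #|S'|%:R :> R.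
Proof. by move=> h; rewrite ler_nat subset_leq_card. Qed.

(* Double counting of the triples (x, y, v) where v is a common neighbour of
   the ends of an edge xy of J: as F is triangle-free, xv or yv is missing
   from F. *)
Lemma light_edges G F J A (kc e1c cmax zeta : R) :
  G \subset vpairs T -> F \subset G -> J \subset F -> triangle_free F ->
  0 <= e1c -> 0 <= cmax ->
  (forall x y, y \in nb J x -> (y \in A) = (x \in A)) ->
  (forall x y, y \in nb J x ->
     kc <= #|nb G x :&: nb G y :&: opposite A x|%:R) ->
  (forall x y, x != y -> #|nb G x :&: nb G y|%:R <= cmax) ->
  (forall x, #|[set v in opposite A x | e1c <= #|nb G v :&: nb J x|%:R]|%:R
     <= zeta * #|nb J x|%:R) ->
  (kc - 2 * zeta * cmax) * #|J|%:R <= 2 * e1c * #|(G :&: cut A) :\: F|%:R.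
Proof.
move=> GV FG JF tF e0 c0 Jin Jk cod Tz; set M := _ :\: _.
have FV := subset_trans FG GV; have JV := subset_trans JF FV.
have MV : M \subset vpairs T by apply: subset_trans GV; rewrite subDset subsetU // subsetIl orbT.
(* [TT x] collects the v with unusually many G-neighbours in the J-neighbourhood of x. Triples with
   v in [TT x] or [TT y] fall under [B]: such v are few, and each leaves at most [cmax] choices of
   the other end. The rest falls under [C], where a missing edge xv serves fewer than [e1c] values
   of y. *)
pose TT x := [set v in opposite A x | e1c <= #|nb G v :&: nb J x|%:R].
pose P x y v := [&& y \in nb J x, v \in nb G x, v \in nb G y & v \in opposite A x].
pose B x y v := [&& y \in nb J x, v \in TT x & v \in nb G y].
pose C x y v := [&& v \in nb M x, v \in opposite A x, v \notin TT x,
   y \in nb J x & y \in nb G v].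
have lower : kc * (2 * #|J|%:R) <= \sum_x \sum_y \sum_v (P x y v)%:R.
  rewrite -handshakeR // mulr_sumr; apply: ler_sum => x _.
  rewrite mulr_sumr; apply: ler_sum => y _.
  have [yJ|yJ] := boolP (y \in nb J x); last by rewrite mulr0 sumr_ge0.
  rewrite mulr1 (le_trans (Jk _ _ yJ)) // cardR_sum; apply: ler_sum => v _.
  by rewrite /P yJ /= in_setI in_setI andbA.
have upper x y v : (P x y v)%:R <=
    (B x y v)%:R + (B y x v)%:R + ((C x y v)%:R + (C y x v)%:R) :> R.
  rewrite -!natrD ler_nat; case EP: (P x y v) => //.
  have /and4P[yJ vx vy vo] := EP.
  have vo' : v \in opposite A y by move: vo; rewrite !inE (Jin x y).
  case EB: (B x y v) => //; case EB': (B y x v) => //.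
  move: EB EB'; rewrite /B yJ vy vx andbT /= (nbC J) yJ andbT /= => nx ny.
  suff : C x y v || C y x v by case: (C x y v); case: (C y x v).
  have xJ : x \in nb J y by rewrite nbC.
  have yv : y \in nb G v by rewrite nbC.
  have xv : x \in nb G v by rewrite nbC.
  rewrite /C nx ny yJ vo vo' xJ yv xv /= !andbT.
  have inM z : v \in nb G z -> v \in opposite A z -> v \notin nb F z -> v \in nb M z.
    rewrite !in_nb => h1 h2 h3; rewrite inE h3 inE h1 in_cut.
    by move: h2; rewrite inE eq_sym.
  have [xF|xF] := boolP (v \in nb F x); last by rewrite inM.
  rewrite [X in _ || X]inM ?orbT //; apply/negP => yF.
  exact: (triangle_freeP tF (subsetP (nbS x JF) _ yJ) yF xF).
have sB : \sum_x \sum_y \sum_v (B x y v)%:R <= zeta * cmax * (2 * #|J|%:R).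
  rewrite -handshakeR // mulr_sumr; apply: ler_sum => x _.
  rewrite -cardR_sum exchange_big /=.
  apply: le_trans (_ : \sum_v (v \in TT x)%:R * cmax <= _).
    apply: ler_sum => v _; have [vT|vT] := boolP (v \in TT x); last first.
      by rewrite mul0r big1 // => y _; rewrite /B (negPf vT) andbF.
    have xv : v != x.
      by apply/eqP => E; move: vT; rewrite E !inE eqxx.
    rewrite mul1r (le_trans _ (cod _ _ xv)) // cardR_sum; apply: ler_sum => y _.
    rewrite ler_nat /B vT /= in_setI [v \in nb G y]nbC andbC.
    by case: (y \in nb G v) => //=; case: (boolP (y \in nb J x)) => // /(subsetP (nbS x (subset_trans JF FG))) ->.
  by rewrite -mulr_suml -cardR_sum -mulrA (mulrC cmax) mulrA ler_wpM2r // Tz.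
have sC : \sum_x \sum_y \sum_v (C x y v)%:R <= e1c * (2 * #|M|%:R).
  rewrite -handshakeR // mulr_sumr; apply: ler_sum => x _.
  rewrite exchange_big mulr_sumr /=; apply: ler_sum => v _.
  have [vM|vM] := boolP (v \in nb M x); last by rewrite big1 ?mulr0 // => y _; rewrite /C (negPf vM).
  have [vo|vo] := boolP (v \in opposite A x); last by rewrite big1 ?mulr1 // => y _; rewrite /C (negPf vo) andbF.
  have [vT|vT] := boolP (v \in TT x); first by rewrite big1 ?mulr1 // => y _; rewrite /C vT !andbF.
  rewrite mulr1; move: (vT); rewrite inE vo /= -ltNge => /ltW h.
  apply: le_trans h; rewrite cardR_sum; apply: ler_sum => y _.
  by rewrite /C in_setI ler_nat vM vo vT /= andbC.
have : kc * (2 * #|J|%:R) <= 2 * (zeta * cmax * (2 * #|J|%:R)) + 2 * (e1c * (2 * #|M|%:R)).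
  apply: le_trans lower _.
  apply: le_trans (_ : \sum_x \sum_y \sum_v ((B x y v)%:R + (B y x v)%:R + ((C x y v)%:R + (C y x v)%:R)) <= _).
    by apply: ler_sum => x _; apply: ler_sum => y _; apply: ler_sum.
  have split3 (f g : T -> T -> T -> R) : \sum_x \sum_y \sum_v (f x y v + g x y v) =
      \sum_x \sum_y \sum_v f x y v + \sum_x \sum_y \sum_v g x y v.
    rewrite -big_split; apply: eq_bigr => x _; rewrite -big_split; apply: eq_bigr => y _.
    by rewrite -big_split.
  rewrite !split3 [X in _ + X + _]exchange_big [X in _ + (_ + X)]exchange_big /=.
  by move: sB sC; set b := \sum_x _; set c := \sum_x _; clear; lra.
clear; lra.
Qed.

(** A vertex x of [L] has many F-neighbours on both sides of the cut. An edge of [G] between an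
    inner and a crossing F-neighbour of x crosses the cut, and it is missing from [F], as it would
    close a triangle at x. Density provides many such edges st, and each arises only from those x in
    [L] adjacent to both s and t: at most [tau] of them unless s or t is in the exceptional set
    [C]. *)
Lemma heavy_vertices G F A (L C : {set T}) (p q cmax dmax tau rho : R) :
  G \subset vpairs T -> F \subset G -> triangle_free F ->
  0 <= p -> 0 < q -> 0 <= cmax -> 0 <= dmax -> 0 <= tau ->
  (forall x, #|nb G x|%:R <= dmax) ->
  (forall x y, x != y -> #|nb G x :&: nb G y|%:R <= cmax) ->
  (forall S S' : {set T}, [disjoint S & S'] -> q <= #|S|%:R -> q <= #|S'|%:R ->
     p * #|S|%:R * #|S'|%:R / 2 <= \sum_(s in S) #|nb G s :&: S'|%:R) ->
  \sum_(x in L) #|nb G x :&: L|%:R <= #|L|%:R * (q / 2) ->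
  (forall x, x \in L -> 4 * q <= #|nb (F :\: cut A) x|%:R) ->
  (forall x, x \in L -> 2 * q <= #|nb F x :&: opposite A x|%:R) ->
  #|C|%:R <= rho ->
  (forall s t, s != t -> s \notin L -> t \notin L -> s \notin C -> t \notin C ->
     #|nb G s :&: nb G t :&: L|%:R <= tau) ->
  #|L|%:R / 2 * (p * (3 * q) * q / 2) <=
     2 * tau * #|(G :&: cut A) :\: F|%:R + 2 * rho * dmax * cmax.
Proof.
move=> GV FG tF p0 q0 c0 d0 t0 deg cod jum inL hI hO Crho typ; set M := _ :\: _.
have FV := subset_trans FG GV.
have MV : M \subset vpairs T by apply: subset_trans GV; rewrite subDset subsetU // subsetIl orbT.
(* At least half of [L] has at most [q] neighbours inside [L]. For these x both sets of F-neighbours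
   stay large after discarding [L], and the bound [tau] is available only for s and t outside
   [L]. *)
pose L' := [set x in L | #|nb G x :&: L|%:R <= q].
have L'h : #|L|%:R / 2 <= #|L'|%:R :> R.
  have : q * #|L :\: L'|%:R <= #|L|%:R * (q / 2).
    apply: le_trans inL; rewrite [leRHS](bigID (mem L')) /= -[leLHS]add0r.
    rewrite lerD ?sumr_ge0 // mulrC mulr_natl -sumr_const.
    rewrite [leRHS](eq_bigl (mem (L :\: L'))) => [|x]; last by rewrite !inE andbC.
    apply: ler_sum => x; rewrite !inE => /andP[+ xL].
    by rewrite xL /= -ltNge => /ltW.
  have : #|L|%:R = #|L'|%:R + #|L :\: L'|%:R :> R.
    have LL' : L :&: L' = L' by apply/setIidPr/subsetP => x; rewrite inE => /andP[].
    by rewrite -natrD -[in LHS](cardsID L' L) LL'.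
  set l := #|L|%:R; set l' := #|L'|%:R; set d := #|_ :\: _|%:R => ->.
  by rewrite mulrCA ler_pM2l //; clear; lra.
pose S x := nb (F :\: cut A) x :\: L.
pose S' x := (nb F x :&: opposite A x) :\: L.
pose Q x s t := [&& x \in L', s \in S x, t \in S' x & t \in nb G s].
have lower : #|L'|%:R * (p * (3 * q) * q / 2) <= \sum_x \sum_s \sum_t (Q x s t)%:R.
  rewrite mulr_natl -sumr_const big_mkcond; apply: ler_sum => x _.
  case: ifP => xL'; last by rewrite !sumr_ge0 // => s _; rewrite sumr_ge0.
  have /andP[xL xq] : (x \in L) && (#|nb G x :&: L|%:R <= q) by move: xL'; rewrite inE.
  have cardD (X : {set T}) : X \subset nb G x -> #|X|%:R - q <= #|X :\: L|%:R.
    move=> XG; rewrite -(cardsID L X) natrD lerBlDr addrC lerD2l (le_trans _ xq) //.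
    by rewrite leR_cards // setSI.
  have SG : nb (F :\: cut A) x \subset nb G x by rewrite nbS // (subset_trans (subsetDl _ _)).
  have S'G : nb F x :&: opposite A x \subset nb G x by rewrite subIset // nbS.
  have hS : 3 * q <= #|S x|%:R by have := cardD _ SG; have := hI x xL; lra.
  have hS' : q <= #|S' x|%:R by have := cardD _ S'G; have := hO x xL; lra.
  have dis : [disjoint S x & S' x].
    rewrite disjoints_subset; apply/subsetP => s.
    rewrite in_setD in_nb in_setD in_cut => /andP[_ /andP[sA _]].
    rewrite in_setC in_setD in_setI; apply/negP => /andP[_ /andP[_]].
    by rewrite inE; move: sA; case: (s \in A); case: (x \in A).
  have hqS : q <= #|S x|%:R by move: hS q0; clear; lra.
  apply: le_trans (_ : p * #|S x|%:R * #|S' x|%:R / 2 <= _).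
    rewrite ler_pM2r ?invr_gt0 ?ltr0n // ler_pM ?mulr_ge0 ?(ltW q0) //.
    by rewrite ler_wpM2l.
  apply: le_trans (jum _ _ dis hqS hS') _.
  rewrite [leLHS]big_mkcond; apply: ler_sum => s _.
  case: ifP => sS; last by rewrite sumr_ge0.
  rewrite cardR_sum; apply: ler_sum => t _.
  by rewrite /Q xL' sS in_setI andbC.
have upper : \sum_x \sum_s \sum_t (Q x s t)%:R <=
    \sum_s \sum_t (t \in nb M s)%:R * (tau + ((s \in C)%:R + (t \in C)%:R) * cmax).
  rewrite exchange_big; apply: ler_sum => s _; rewrite exchange_big; apply: ler_sum => t _ /=.
  have QM x : Q x s t -> [/\ t \in nb M s, s \notin L, t \notin L & x \in nb G s :&: nb G t :&: L].
    rewrite /Q /S /S' => /and4P[+ + + tG]; rewrite in_setD in_nb in_setD.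
    rewrite in_setD in_setI in_nb [x \in L']inE [t \in opposite A x]inE.
    move=> /andP[xL _] /andP[sL /andP[sA sFx]] /andP[tL /andP[tFx to]].
    have xsG : [set x; s] \in G by rewrite (subsetP FG).
    have xtG : [set x; t] \in G by rewrite (subsetP FG).
    split=> //; last by rewrite !in_setI xL andbT !in_nb ![_ :|: [set x]]setUC xsG xtG.
    have stG : [set s; t] \in G by rewrite -in_nb.
    rewrite in_nb in_setD in_setI stG in_cut /=; apply/andP; split.
      apply/negP => tFs; apply: (triangle_freeP tF (x := x) (y := s) (z := t));
      by rewrite in_nb.
    by move: sA to; rewrite in_cut; case: (s \in A); case: (t \in A); case: (x \in A).
  have [tM|tM] := boolP (t \in nb M s); last first.
    by rewrite mul0r big1 // => x _; case EQ: (Q x s t) => //; have [h] := QM x EQ; rewrite h in tM.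
  have st : s != t by apply: nb_neq tM.
  rewrite mul1r; have [/andP[sL tL]|stL] := boolP ((s \notin L) && (t \notin L)); last first.
    rewrite big1 ?addr_ge0 ?mulr_ge0 ?addr_ge0 // => x _.
    by case EQ: (Q x s t) => //; have [_ h1 h2] := QM x EQ; rewrite h1 h2 in stL.
  apply: le_trans (_ : #|nb G s :&: nb G t :&: L|%:R <= _).
    by rewrite cardR_sum; apply: ler_sum => x _; case EQ: (Q x s t) => //; have [_ _ _ ->] := QM x EQ.
  have [/andP[sC tC]|stC] := boolP ((s \notin C) && (t \notin C)).
    by rewrite (le_trans (typ _ _ st sL tL sC tC)) // lerDl mulr_ge0 // addr_ge0.
  apply: le_trans (_ : cmax <= _).
    by rewrite (le_trans _ (cod _ _ st)) // leR_cards // subsetIl.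
  rewrite -[leLHS]add0r lerD // -[leLHS]mul1r ler_wpM2r //.
  by move: stC; rewrite negb_and !negbK; case: (s \in C); case: (t \in C); rewrite //= ?addr0 ?add0r ?lerDl.
have sumC : \sum_s \sum_t (t \in nb M s)%:R * ((s \in C)%:R * cmax) <= rho * dmax * cmax.
  apply: le_trans (_ : \sum_s (s \in C)%:R * (dmax * cmax) <= _); last first.
    rewrite -mulr_suml -cardR_sum mulrA ler_wpM2r // ler_wpM2r //.
  apply: ler_sum => s _; rewrite -mulr_suml -cardR_sum mulrCA ler_wpM2l // ler_wpM2r //.
  rewrite (le_trans _ (deg s)) // leR_cards // nbS // (subset_trans (subsetDl _ _)) //.
  exact: subsetIl.
apply: le_trans (_ : #|L'|%:R * (p * (3 * q) * q / 2) <= _).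
  by rewrite ler_wpM2r // !mulr_ge0 // ltW.
apply: le_trans lower _; apply: le_trans upper _.
have -> : \sum_s \sum_t (t \in nb M s)%:R * (tau + ((s \in C)%:R + (t \in C)%:R) * cmax) =
   tau * (2 * #|M|%:R) + 2 * (\sum_s \sum_t (t \in nb M s)%:R * ((s \in C)%:R * cmax)).
  rewrite [X in _ = _ + X]mulr_natl mulr2n [X in _ = _ + (_ + X)]exchange_big -handshakeR // mulr_sumr -!big_split; apply: eq_bigr => s _ /=.
  rewrite mulr_sumr -!big_split; apply: eq_bigr => t _ /=.
  by rewrite [s \in nb M t]nbC; ring.
move: sumC; clear; lra.
Qed.

End Real.

End Graphs.

(** * Local moves of cuts, the maximum cut, and slots *)

Section Cuts.
Variable T : finType.
Implicit Types (G H F J M W Q : {set {set T}}) (A B S : {set T}) (x y : T).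

Definition maxcut G : nat := \max_(A : {set T}) #|G :&: cut A|.

Lemma card_star H x : H \subset vpairs T -> #|[set e in H | x \in e]| = #|nb H x|.
Proof.
move=> /subsetP HV; rewrite -(card_in_imset (f := fun y => [set x; y]) (D := nb H x)).
  apply: eq_card => e; apply/idP/imsetP => [|[y]].
    rewrite inE => /andP[eH xe]; have /vpairsP[u [v [uv E]]] := HV e eH.
    move: xe; rewrite E !inE => /orP[]/eqP ->; [exists v|exists u] => //.
      by rewrite in_nb -E.
      by rewrite in_nb setUC -E.
    by rewrite setUC.
  by rewrite in_nb => yH ->; rewrite !inE yH eqxx.
move=> y z; rewrite !in_nb => yH zH E.
have := HV _ yH; have := HV _ zH; rewrite !in_vpairs => xz xy.
have : y \in [set x; z] by rewrite -E !inE eqxx orbT.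
by rewrite !inE eq_sym (negPf xy) => /eqP.
Qed.

Lemma nb_cut H A x : nb (H :&: cut A) x = nb H x :&: opposite A x.
Proof.
by apply/setP => y; rewrite in_setI !in_nb in_setI in_cut inE eq_sym.
Qed.

Lemma nb_cutD H A x : nb (H :\: cut A) x = nb H x :\: opposite A x.
Proof.
by apply/setP => y; rewrite in_setD !in_nb in_setD in_cut inE eq_sym.
Qed.

Definition flip A x : {set T} := if x \in A then A :\ x else x |: A.

Lemma in_flip A x y : (y \in flip A x) = (y \in A) (+) (y == x).
Proof.
by rewrite /flip; case: ifP => xA; rewrite !inE; case: eqP => [->|]; rewrite ?xA ?addbF.
Qed.

(** Flipping x exchanges the crossing and the inner pairs at x and affects no other pair; the
    additive form avoids subtraction in [nat]. *)
Lemma cut_flip H A x : H \subset vpairs T ->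
  (#|H :&: cut (flip A x)| + #|nb H x :&: opposite A x| =
   #|H :&: cut A| + #|nb H x :\: opposite A x|)%N.
Proof.
move=> HV.
have split B : (#|H :&: cut B| = #|nb H x :&: opposite B x| +
    #|[set e in H :&: cut B | x \notin e]|)%N.
  rewrite -nb_cut -card_star; last by rewrite (subset_trans (subsetIl _ _)).
  rewrite -(cardsID [set e : {set T} | x \in e] (H :&: cut B)).
  by congr (_ + _)%N; apply: eq_card => e; rewrite !inE // andbC.
rewrite (split (flip A x)) (split A).
have -> : nb H x :&: opposite (flip A x) x = nb H x :\: opposite A x.
  apply/setP => y; rewrite in_setI in_setD andbC.
  case: (boolP (y \in nb H x)) => [yx|]; last by rewrite !andbF.
  rewrite !andbT !inE !in_flip eqxx [y == x]eq_sym (negPf (nb_neq HV yx)).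
  by case: (x \in A); case: (y \in A).
have -> : [set e in H :&: cut (flip A x) | x \notin e] = [set e in H :&: cut A | x \notin e].
  apply/setP => e; rewrite !inE; case: (boolP (x \in e)) => xe; rewrite ?andbF ?andbT //.
  congr (_ && (_ && (#|pred_of_set _| == _))).
  apply/setP => y; rewrite !inE in_flip; case: (eqVneq y x) => [->|]; last by rewrite addbF.
  by rewrite (negPf xe).
by rewrite addnAC (addnC #|_|) addnAC.
Qed.

(** A cut that is optimal for [Q] is stable under flips, so every vertex has at least half of its
    Q-neighbours across. *)
Lemma half_cut Q : Q \subset vpairs T -> exists B, (#|Q| <= 2 * #|Q :&: cut B|)%N.
Proof.
move=> QV; have [B _ hB] := arg_maxnP (fun B : {set T} => #|Q :&: cut B|) (isT : predT set0).
exists B; rewrite -(leq_pmul2l (ltn0Sn 1)) -(handshake QV).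
have QB : Q :&: cut B \subset vpairs T by rewrite (subset_trans (subsetIl _ _)).
rewrite -(handshake QB) big_distrr /=; apply: leq_sum => x _.
rewrite nb_cut -(cardsID (opposite B x) (nb Q x)) mul2n -addnn leq_add2l.
have := cut_flip B x QV; have := hB (flip B x) isT; lia.
Qed.

Lemma maxcut_ge G A : (#|G :&: cut A| <= maxcut G)%N.
Proof. exact: (leq_bigmax A). Qed.

Lemma max_triangle_free_ge_maxcut G F : max_triangle_free G F -> (maxcut G <= #|F|)%N.
Proof.
move=> /and3P[_ _ /forallP h]; apply/bigmax_leqP => A _.
by have /implyP := h (G :&: cut A); apply; rewrite subsetIl (cut_triangle_free (subsetIr _ _)).
Qed.

Lemma card_touching H (X : {set T}) : H \subset vpairs T ->
  (#|[set e in H | ~~ [disjoint e & X]]| <= \sum_(x in X) #|nb H x|)%N.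
Proof.
move=> HV; rewrite (eq_bigr (fun x => \sum_(e in H) (x \in e))%N); last first.
  move=> x _; rewrite -card_star // -sum1_card [LHS]big_mkcond [RHS]big_mkcond /=.
  by apply: eq_bigr => e _; rewrite inE; case: (e \in H); case: (x \in e).
rewrite exchange_big -sum1_card /= big_mkcond [leqRHS]big_mkcond /=.
apply: leq_sum => e _; rewrite inE; case: (e \in H) => //=.
case: ifP => // /pred0Pn[x /= /andP[xe xX]].
by rewrite (bigD1 x) //= xe.
Qed.

Lemma card_bigcup_le (I U : finType) (P : {set I}) (B : I -> {set U}) :
  (#|\bigcup_(i in P) B i| <= \sum_(i in P) #|B i|)%N.
Proof.
apply: (big_ind2 (fun (X : {set U}) (k : nat) => #|X| <= k)%N) => //.
  by rewrite cards0.
move=> X k Y l Xk Yl; rewrite (leq_trans (leq_card_setU _ _)) // leq_add //.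
Qed.

Lemma subset_of_card (X : {set T}) (k : nat) : exists2 Y : {set T}, Y \subset X & #|Y| = minn #|X| k.
Proof.
exists [set x in take k (enum X)].
  by apply/subsetP => x; rewrite inE => /mem_take; rewrite mem_enum.
rewrite cardsE (card_uniqP _) ?take_uniq ?enum_uniq // size_take -cardE minnC /minn.
by [].
Qed.

(* The slots of a family [P] of ordered pairs (y, x): the pairs yv such that v
   is a neighbour of some x paired with y, v outside the support of [P]. *)
Definition slots (P : {set T * T}) G : {set {set T}} :=
  [set e | [exists u : T * T, [exists v, [&& u \in P, v \in nb G u.2,
     [forall u' in P, (v != u'.1) && (v != u'.2)] & e == [set u.1; v]]]]].

(** Together with the support condition in [slots], this ensures that the pairs u.2 v deciding what
    is a slot are never slots themselves, so that refreshing the slots does not change the set of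
    slots. *)
Definition oriented (P : {set T * T}) : Prop :=
  forall u u' : T * T, u \in P -> u' \in P -> u.1 != u'.2.

Lemma card_pairs (N : T -> {set T}) :
  (#|[set u : T * T | u.2 \in N u.1]| = \sum_y #|N y|)%N.
Proof.
rewrite -sum1_card big_mkcond /= (eq_bigr (fun y => \sum_x (x \in N y))%N); last first.
  by move=> y _; rewrite card_sum_in.
rewrite pair_big /=; apply: eq_bigr => u _.
by rewrite inE; case: (u.2 \in N u.1).
Qed.

(** At each v of the union one x with v in [B x] is paid by the union, and the pairs of this x with
    the other x' pay for the remaining incidences. Ordered pairs double the usual error term. *)
Lemma bonferroni (X : {set T}) (B : T -> {set T}) :
  (\sum_(x in X) #|B x| <= #|\bigcup_(x in X) B x| +
     \sum_(x in X) \sum_(x' in X | x' != x) #|B x :&: B x'|)%N.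
Proof.
rewrite (eq_bigr (fun x => \sum_v (v \in B x))%N) => [|x _]; last by rewrite card_sum_in.
rewrite exchange_big card_sum_in /=.
have -> : (\sum_(x in X) \sum_(x' in X | x' != x) #|B x :&: B x'| =
    \sum_v \sum_(x in X) \sum_(x' in X | x' != x) (v \in B x :&: B x'))%N.
  rewrite exchange_big; apply: eq_bigr => x _; rewrite exchange_big.
  by apply: eq_bigr => x' _; rewrite card_sum_in.
rewrite -big_split; apply: leq_sum => v _ /=.
have [[x xX vx]|h] := bigcupP; last first.
  rewrite big1 // => x xX; apply/eqP; rewrite eqb0; apply/negP => vx.
  by apply: h; exists x.
rewrite (bigD1 x) //= vx leq_add2l.
rewrite [leqRHS](bigD1 x) //= (leq_trans _ (leq_addr _ _)) //.
rewrite leq_eqVlt; apply/orP; left; apply/eqP; apply: eq_bigr => x' _.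
by rewrite in_setI vx.
Qed.

End Cuts.

(** * Inner edges with few common neighbours force a larger cut *)

Section Deficient.
Variables (R : archiRealFieldType) (T : finType).
Implicit Types (G Q : {set {set T}}) (A : {set T}).

(** An improbable event, with a = n p and c = n p^2 in mind: many slots cross [A], hardly any of
    them is present, and yet no cut beats [A] by much. In units of |P| c the margin is 1/48 - 1/200
    - 1/200 > 1/100. *)
Definition deficient (a c : R) (P : {set T * T}) G A : bool :=
  [&& #|slots P G|%:R <= 10 * a * #|P|%:R,
      #|P|%:R * a / 48 <= #|slots P G :&: cut A|%:R,
      #|slots P G :&: G :&: cut A|%:R <= #|P|%:R * c / 200 &
      (maxcut G)%:R <= #|G :&: cut A|%:R + #|P|%:R * c / 200].

(** If no cut beat [A] by more than |Q|, some family [P] of ordered pairs drawn from [Q] would be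
    deficient. [P] must be large, |Q| <= |P| c / 200, and yet the neighbourhoods attached to one
    vertex must hardly overlap, so that slots are numerous. *)
Lemma low_codegree_gap G Q A (p a c q : R) :
  G \subset vpairs T -> Q \subset vpairs T -> Q != set0 ->
  0 < p -> p <= 1 -> c = p * a -> 0 < a -> 0 < q -> q <= a / (480 * 800) -> 1 <= c / 800 ->
  (forall x y, y \in nb Q x -> (y \in A) = (x \in A)) ->
  (forall x y, y \in nb Q x ->
     #|nb G x :&: nb G y :&: opposite A x|%:R < c / 200) ->
  (forall x y, y \in nb Q x -> a / 24 <= #|nb G x :&: opposite A x|%:R) ->
  (forall x, #|nb G x|%:R <= 10 * a) ->
  (forall x y, x != y -> #|nb G x :&: nb G y|%:R <= 10 * c) ->
  (forall S S' : {set T}, [disjoint S & S'] -> q <= #|S|%:R -> q <= #|S'|%:R ->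
     p * #|S|%:R * #|S'|%:R / 2 <= \sum_(s in S) #|nb G s :&: S'|%:R) ->
  (forall P, P != set0 -> oriented P -> ~~ deficient a c P G A) ->
  (#|G :&: cut A| + #|Q| < maxcut G)%N.
Proof.
move=> GV QV Q0 p0 p1 cE a0 q0 qa c800 Qin low opp deg cod jum nodef.
rewrite ltnNge; apply/negP => gap.
have c0 : 0 < c by move: c800; clear; lra.
(* By density a large Q-neighbourhood of y would send p (a / 24) / 2 = c / 48 edges per vertex to
   the crossing G-neighbourhood of y, but low codegree allows only c / 200. *)
have degQ y : #|nb Q y|%:R < q.
  rewrite ltNge; apply/negP => qS.
  have [x xS] : exists x, x \in nb Q y.
    by apply/card_gt0P; rewrite -(ltr0n R) (lt_le_trans q0).
  have := jum (nb Q y) (nb G y :&: opposite A y) _ qS _.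
  have dis : [disjoint nb Q y & nb G y :&: opposite A y].
    rewrite disjoints_subset; apply/subsetP => z zQ.
    by rewrite in_setC in_setI [z \in opposite _ _]inE (Qin _ _ zQ) eqxx andbF.
  move/(_ dis); have ya := opp _ _ xS.
  have qy : q <= #|nb G y :&: opposite A y|%:R by apply: le_trans ya; apply: le_trans qa _; rewrite ler_pM2l // -natrM lef_pV2 ?posrE ?ltr0n // ler_nat.
  move/(_ qy) => h.
  have {h} : p * #|nb Q y|%:R * (a / 24) / 2 <= #|nb Q y|%:R * (c / 200).
    apply: le_trans (_ : \sum_(s in nb Q y) c / 200 <= _); last by rewrite sumr_const mulr_natl.
    apply: le_trans (le_trans h _); first by rewrite ler_pM2r // ler_pM2l // mulr_gt0 // (lt_le_trans q0).
    by apply: ler_sum => z zQ; rewrite setIA (setIC (nb G z)) ltW // low.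
  rewrite cE; have : 0 < p * a * #|nb Q y|%:R by rewrite !mulr_gt0 // (lt_le_trans q0).
  by move: #|_|%:R => r; clear; lra.
(* Orient edges of [Q] out of [B], which makes the family oriented, and keep those on the more
   frequent side of [A], so that a crossing slot yv determines y and v. Each choice costs a factor
   2. *)
have [B hB] := half_cut QV.
pose P0 (s : bool) : {set T * T} :=
  [set u | [&& u.1 \in B, u.2 \notin B, (u.1 \in A) == s & u.2 \in nb Q u.1]].
have [s hs] : exists s, (#|Q| <= 4 * #|P0 s|)%N.
  have : (#|Q :&: cut B| <= #|P0 true| + #|P0 false|)%N.
    apply: leq_trans (leq_card_setU _ _).
    apply: leq_trans (leq_imset_card (fun u : T * T => [set u.1; u.2]) _).
    apply/subset_leq_card/subsetP => e; rewrite in_setI => /andP[eQ].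
    have /vpairsP[x [y [xy E]]] := subsetP QV e eQ; rewrite E in_cut => xyB.
    apply/imsetP; have [xB|xB] := boolP (x \in B).
      exists (x, y) => //=; rewrite in_setU !inE /= xB -E eQ.
      by move: xyB; rewrite xB; case: (y \in B) => //=; case: (x \in A).
    exists (y, x) => //=; last by rewrite setUC.
    rewrite in_setU !inE /= xB setUC -E eQ.
    by move: xyB; rewrite (negPf xB); case: (y \in B) => //=; case: (y \in A).
  move: hB; move: #|Q| #|Q :&: cut B| => k l h2 h3.
  suff : (k <= 4 * #|P0 true|)%N || (k <= 4 * #|P0 false|)%N.
    by case/orP; [exists true|exists false].
  by move: #|P0 true| #|P0 false| h2 h3 => i j; clear; lia.
(* Stars are truncated at [D] pairs: D - 1 <= 1 / (480 p) overlaps of size at most 10 c = 10 p a sum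
   to at most a / 48, half of the crossing degree a / 24. *)
have [D Dp Dp'] : exists2 D : nat, D%:R - 1 <= (480 * p)^-1 & (480 * p)^-1 <= D%:R.
  have p480 : 0 <= (480 * p)^-1 by rewrite invr_ge0 mulr_ge0 ?ler0n // ltW.
  have /andP[t1 /ltW t2] := truncn_itv p480; exists (Num.truncn (480 * p)^-1).+1 => //.
  by rewrite -natr1 addrK.
have /boolp.choice[N hN] : forall y, exists Y : {set T},
    Y \subset [set x | (y, x) \in P0 s] /\ #|Y| = minn #|[set x | (y, x) \in P0 s]| D.
  by move=> y; have [Y] := subset_of_card [set x | (y, x) \in P0 s] D; exists Y.
pose P := [set u : T * T | u.2 \in N u.1].
have PP0 : P \subset P0 s.
  by apply/subsetP => -[y x]; rewrite inE /= => /(subsetP (proj1 (hN y))); rewrite inE.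
have PQ u : u \in P -> [/\ u.1 \in B, u.2 \notin B, (u.1 \in A) = s & u.2 \in nb Q u.1].
  by move/(subsetP PP0); rewrite inE => /and4P[? ? /eqP].
have cardP : #|P| = (\sum_y #|N y|)%N by rewrite card_pairs.
have PX y : N y \subset nb Q y.
  apply/subsetP => x xN; have : (y, x) \in P by rewrite inE.
  by case/PQ.
(* A truncated star keeps D pairs out of fewer than q, and q <= (480 p)^-1 (c / 800) <= D c / 800. A
   star kept whole loses nothing since c / 800 >= 1. *)
have hm : #|Q|%:R <= #|P|%:R * c / 200.
  have hP0 : #|P0 s|%:R <= #|P|%:R * (c / 800).
    have -> : P0 s = [set u | u.2 \in [set x | (u.1, x) \in P0 s]].
      by apply/setP => -[y x]; rewrite [RHS]inE /= [RHS]inE.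
    rewrite (card_pairs (fun y => [set x | (y, x) \in P0 s])) cardP !natr_sum mulr_suml; apply: ler_sum => y _.
    have [_ ->] := hN y; rewrite /minn; case: ifP => hD.
      by rewrite ler_peMr.
    apply: le_trans (_ : q <= _).
      apply: le_trans (ltW (degQ y)); apply: leR_cards.
      by apply/subsetP => x; rewrite !inE /= => /and4P[].
    apply: le_trans (_ : (480 * p)^-1 * (c / 800) <= _); last first.
      by apply: ler_wpM2r Dp'; rewrite divr_ge0 ?ler0n // ltW.
    rewrite cE; have -> : (480 * p)^-1 * (p * a / 800) = a / (480 * 800).
      by rewrite !invfM -!mulrA mulKf ?lt0r_neq0 // mulrCA.
    by [].
  move: hs; rewrite -(ler_nat R) natrM; lra.
have P0' : P != set0.
  apply/eqP => P0'; move: hm; rewrite P0' cards0 !mul0r lern0 cards_eq0.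
  by rewrite (negPf Q0).
have Por : oriented P.
  move=> u u' /PQ[uB _ _ _] /PQ[_ uB' _ _]; apply/eqP => E.
  by rewrite -E uB in uB'.
have end_opp v y x : (y, x) \in P -> v \in opposite A y ->
    [forall u' in P, (v != u'.1) && (v != u'.2)].
  move=> /PQ[_ _ /= yA _]; rewrite inE => vA; apply/forall_inP => u' /PQ[_ _ uA /Qin uA'].
  by apply/andP; split; apply/eqP => E; move: vA; rewrite E ?uA' uA yA eqxx.
have slotsP e : e \in slots P G -> exists u v, [/\ u \in P, v \in nb G u.2 & e = [set u.1; v]].
  rewrite inE => /existsP[u /existsP[v /and4P[uP vu _ /eqP ->]]].
  by exists u, v.
have U_large y : #|N y|%:R * (a / 48) <= #|opposite A y :&: \bigcup_(x in N y) nb G x|%:R.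
  have := bonferroni (N y) (fun x => nb G x :&: opposite A y).
  rewrite -(ler_nat R) natrD !natr_sum => h.
  have -> : opposite A y :&: \bigcup_(x in N y) nb G x =
      \bigcup_(x in N y) (nb G x :&: opposite A y).
    apply/setP => v; rewrite in_setI; apply/andP/bigcupP => [[vo /bigcupP[x xN xv]]|[x xN]].
      by exists x => //; rewrite in_setI xv.
    by rewrite in_setI => /andP[xv ->]; split=> //; apply/bigcupP; exists x.
  have h1 : #|N y|%:R * (a / 24) <= \sum_(x in N y) #|nb G x :&: opposite A y|%:R.
    rewrite mulr_natl -sumr_const; apply: ler_sum => x /(subsetP (PX y)) xy.
    have -> : opposite A y = opposite A x by apply/setP => v; rewrite !inE (Qin _ _ xy).
    by apply: (opp x y); rewrite nbC.
  have h2 : \sum_(x in N y) (\sum_(x' in N y | x' != x)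
      #|(nb G x :&: opposite A y) :&: (nb G x' :&: opposite A y)|)%:R <= #|N y|%:R * (a / 48).
    rewrite mulr_natl -sumr_const; apply: ler_sum => x xN.
    rewrite natr_sum; apply: le_trans (_ : \sum_(x' in N y | x' != x) 10 * c <= _).
      apply: ler_sum => x' /andP[_ x'x]; rewrite eq_sym in x'x; apply: le_trans (cod _ _ x'x).
      by apply: leR_cards; apply: setISS; apply: subsetIl.
    rewrite sumr_const -[leLHS]mulr_natl.
    have -> : #|[pred x' in N y | x' != x]| = #|N y :\ x|.
      by apply: eq_card => x'; rewrite !inE andbC.
    have dD : #|N y :\ x|%:R <= (480 * p)^-1.
      apply: le_trans Dp; rewrite lerBrDr natr1 ler_nat.
      have := geq_minr #|[set x | (y, x) \in P0 s]| D; have [_ <-] := hN y.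
      by rewrite (cardsD1 x (N y)) xN.
    apply: le_trans (_ : (480 * p)^-1 * (10 * c) <= _).
      by apply: ler_wpM2r dD; rewrite mulr_ge0 // ltW.
    rewrite cE; have -> : (480 * p)^-1 * (10 * (p * a)) = a / 48 by move: p0 => /lt0r_neq0; clear => p0; field.
    by [].
  by move: h h1 h2; clear; lra.
have /negP := nodef P P0' Por; apply; apply/and4P; split.
- apply: le_trans (_ : (\sum_(u in P) #|nb G u.2|)%:R <= _); last first.
    rewrite natr_sum; apply: le_trans (_ : \sum_(u in P) 10 * a <= _); first exact: ler_sum.
    by rewrite sumr_const -[leLHS]mulr_natr.
  rewrite ler_nat; apply: leq_trans (_ : #|\bigcup_(u in P) ((fun v => [set u.1; v]) @: nb G u.2)| <= _)%N.
    apply/subset_leq_card/subsetP => e /slotsP[u [v [uP vu ->]]].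
    by apply/bigcupP; exists u => //; apply: imset_f.
  apply: leq_trans (card_bigcup_le _ _) _; apply: leq_sum => u _; exact: leq_imset_card.
- pose N' y := opposite A y :&: \bigcup_(x in N y) nb G x.
  apply: le_trans (_ : #|[set w : T * T | w.2 \in N' w.1]|%:R <= _).
    by rewrite (card_pairs N') cardP !natr_sum -mulrA mulr_suml; apply: ler_sum.
  rewrite ler_nat -(card_in_imset (f := fun w : T * T => [set w.1; w.2])).
    apply/subset_leq_card/subsetP => e /imsetP[[y v]]; rewrite inE /= in_setI => /andP[vo].
    move=> /bigcupP[x xN vx] ->; have yxP : (y, x) \in P by rewrite inE.
    rewrite in_setI in_cut; apply/andP; split; last by move: vo; rewrite inE eq_sym.
    rewrite inE; apply/existsP; exists (y, x); apply/existsP; exists v.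
    by rewrite yxP vx (end_opp _ _ _ yxP vo) /=.
  move=> [y v] [y' v']; rewrite !inE /= => /andP[vy /bigcupP[x xN _]] /andP[vy' /bigcupP[x' xN' _]].
  have yP : (y, x) \in P by rewrite inE.
  have [_ _ /= yA _] := PQ _ yP.
  have yP' : (y', x') \in P by rewrite inE.
  have [_ _ /= yA' _] := PQ _ yP'.
  move=> E; have : y \in [set y'; v'] by rewrite -E !inE eqxx.
  rewrite !inE => /orP[/eqP yy'|/eqP yv']; last first.
    by move: vy'; rewrite -yv' yA yA' eqxx.
  have : v \in [set y'; v'] by rewrite -E !inE eqxx orbT.
  rewrite !inE => /orP[/eqP vy1|/eqP vv']; last by rewrite yy' vv'.
  by move: vy; rewrite vy1 yA yA' eqxx.
- apply: le_trans (_ : (\sum_(u in P) #|nb G u.1 :&: nb G u.2 :&: opposite A u.1|)%:R <= _); last first.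
    rewrite natr_sum; apply: le_trans (_ : \sum_(u in P) c / 200 <= _).
      by apply: ler_sum => u /PQ[_ _ _ uQ]; rewrite ltW // low.
    by rewrite sumr_const -[leLHS]mulr_natl mulrA.
  rewrite ler_nat; apply: leq_trans (_ : #|\bigcup_(u in P) ((fun v => [set u.1; v]) @: (nb G u.1 :&: nb G u.2 :&: opposite A u.1))| <= _)%N.
    apply/subset_leq_card/subsetP => e; rewrite !in_setI => /andP[/andP[/slotsP[u [v [uP vu ->]]] eG] eA].
    apply/bigcupP; exists u => //; apply: imset_f; rewrite !in_setI vu in_nb eG /=.
    by move: eA; rewrite in_cut inE eq_sym.
  apply: leq_trans (card_bigcup_le _ _) _; apply: leq_sum => u _; exact: leq_imset_card.
- apply: le_trans (_ : #|G :&: cut A|%:R + #|Q|%:R <= _); last by rewrite lerD2l.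
  by rewrite -natrD ler_nat.
Qed.

End Deficient.

(** * The deterministic rigidity argument *)

Section Stable.
Variables (R : archiRealFieldType) (T : finType).
Implicit Types (G F H J M Q : {set {set T}}) (A C L : {set T}).

(** Weight 10 on [F] makes [A] nearly as good for [F] as any cut. Weight 1 on [G] leaves every
    vertex at least a twelfth of its G-degree across [A] when [F] is a subgraph of [G]: this is the
    second claim, stability under flips. *)
Lemma optimal_cut G F : G \subset vpairs T -> F \subset vpairs T ->
  exists A, (forall A', 10 * #|F :&: cut A'| + #|G :&: cut A'| <=
                        10 * #|F :&: cut A| + #|G :&: cut A|)%N /\
    forall x, (10 * #|nb F x :\: opposite A x| + #|nb G x :\: opposite A x| <=
               10 * #|nb F x :&: opposite A x| + #|nb G x :&: opposite A x|)%N.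
Proof.
move=> GV FV; pose phi A := (10 * #|F :&: cut A| + #|G :&: cut A|)%N.
have [A _ hA] := arg_maxnP phi (isT : predT (set0 : {set T})).
exists A; split=> [A'|x]; first exact: hA.
have := hA (flip A x) isT; rewrite /phi /=.
have := cut_flip A x FV; have := cut_flip A x GV.
move: #|_| #|_| #|_| #|_| #|_| #|_| #|_| #|_| => *; lia.
Qed.

Lemma card_missing G F A x : F \subset G ->
  (#|nb ((G :&: cut A) :\: F) x| + #|nb F x :&: opposite A x| =
   #|nb G x :&: opposite A x|)%N.
Proof.
move=> FG; rewrite -[RHS](cardsID (nb F x)) addnC; congr (_ + _)%N.
  apply: eq_card => v; rewrite !in_setI andbC andbAC.
  case: (boolP (v \in nb F x)) => vF; rewrite ?andbF //= andbT.
  by rewrite (subsetP (nbS x FG) _ vF) andbT.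
by apply: eq_card => v; rewrite in_nb !in_setD -nb_cut !in_nb.
Qed.

Theorem bipartite_of_regular G F (p a c q lam tau rho s : R) :
  G \subset vpairs T -> 0 < p -> p <= 1 -> c = p * a -> 0 < a ->
  0 < q -> q <= a / (480 * 800) -> 1 <= c / 800 ->
  0 < tau -> 400 * a * tau <= p * q ^+ 2 -> 0 <= rho ->
  800 * rho * a ^+ 2 <= q ^+ 2 -> s <= lam * q ->
  (forall x, a / 2 <= #|nb G x|%:R) -> (forall x, #|nb G x|%:R <= 10 * a) ->
  (forall x y, x != y -> #|nb G x :&: nb G y|%:R <= 10 * c) ->
  (forall D S : {set T}, [disjoint D & S] -> #|D|%:R <= 4 * q ->
     (forall v, v \in S -> c / (80 * 100) <= #|nb G v :&: D|%:R) ->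
     #|S|%:R <= (80 * 100)^-1 * #|D|%:R :> R) ->
  (forall S S' : {set T}, [disjoint S & S'] -> q <= #|S|%:R -> q <= #|S'|%:R ->
     p * #|S|%:R * #|S'|%:R / 2 <= \sum_(v in S) #|nb G v :&: S'|%:R) ->
  (forall L, #|L|%:R <= lam -> \sum_(x in L) #|nb G x :&: L|%:R <= #|L|%:R * (q / 2)) ->
  (forall L, #|L|%:R <= lam -> exists2 C : {set T}, #|C|%:R <= rho * #|L|%:R &
     forall u v, u != v -> u \notin L -> v \notin L -> u \notin C -> v \notin C ->
     #|nb G u :&: nb G v :&: L|%:R <= tau) ->
  (forall P A, P != set0 -> oriented P -> ~~ deficient a c P G A) ->
  max_triangle_free G F ->
  (exists A, #|F :\: cut A|%:R <= s) ->
  bipartite F.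
Proof.
move=> GV p0 p1 cE a0 q0 qa c800 t0 ht r0 hr hs degl degu cod h4 h5 h9 h6 h8 Fmax [A0 hA0].
have /and3P[FG tF _] := Fmax; have FV := subset_trans FG GV.
have c0 : 0 < c by rewrite cE mulr_gt0.
have [A [hA loc]] := optimal_cut GV FV.
pose I := F :\: cut A; pose M := (G :&: cut A) :\: F.
have IV : I \subset vpairs T by rewrite (subset_trans (subsetDl _ _)).
have MV : M \subset vpairs T by apply: subset_trans GV; rewrite subDset subsetU // subsetIl orbT.
have Fb : (maxcut G <= #|F|)%N by exact: max_triangle_free_ge_maxcut.
(* Comparing [A] with [A0], and using |G & cut A| <= b(G) <= |F| and |F & cut A0| <= |G & cut A0|,
   gives 10 |I| <= 11 |F \ cut A0|. *)
have I_small : #|I|%:R <= 2 * s.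
  have h := hA A0.
  have h1 : (#|F| = #|F :&: cut A| + #|I|)%N by rewrite cardsID.
  have h2 : (#|F| = #|F :&: cut A0| + #|F :\: cut A0|)%N by rewrite cardsID.
  have h3 : (#|F :&: cut A0| <= #|G :&: cut A0|)%N by rewrite subset_leq_card ?setSI.
  have h4' : (#|G :&: cut A| <= #|F|)%N by rewrite (leq_trans (maxcut_ge _ _)).
  have : (#|I| <= 2 * #|F :\: cut A0|)%N.
    by move: h h1 h2 h3 h4'; clear; move: #|_| #|_| #|_| #|_| #|_| #|_| #|_| => *; lia.
  rewrite -(ler_nat R) natrM => h5'; apply: le_trans h5' _; rewrite ler_wpM2l //.
pose f x := #|nb F x :&: opposite A x|; pose d x := #|nb I x|.
have dE x : d x = #|nb F x :\: opposite A x| by rewrite /d nb_cutD.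
(* Vertices of large inner degree come in two kinds: in [X1] inner F-edges dominate, and stability
   of [A] suffices; those of [L] have at least 2 q crossing F-edges, as [heavy_vertices]
   requires. *)
pose X1 := [set x | (2 * f x < d x)%N].
pose L := [set x | (x \notin X1) && (4 * q <= (d x)%:R)].
have miss x : (#|nb M x| + f x = #|nb G x :&: opposite A x|)%N by rewrite card_missing.
have dG x : (d x <= #|nb G x :\: opposite A x|)%N by rewrite dE subset_leq_card ?setSD ?nbS.
have cardM (X : {set T}) : (\sum_(x in X) #|nb M x| <= 2 * #|M|)%N.
  by rewrite -handshake // [leqRHS](bigID (mem X)) leq_addr.
(* Stability at x gives 11 d <= 11 f + m with m missing edges at x, and f < d / 2 turns this into 11
   d <= 2 m. *)
have hX1 : (11 * #|[set e in I | ~~ [disjoint e & X1]]| <= 4 * #|M|)%N.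
  apply: (@leq_trans (2 * \sum_(x in X1) #|nb M x|)%N); last first.
    by have := cardM X1; clear; move: (\sum_(x in _) _)%N #|_| => *; lia.
  apply: leq_trans (_ : 11 * \sum_(x in X1) d x <= _)%N; first by rewrite leq_mul2l card_touching.
  rewrite !big_distrr /=; apply: leq_sum => x; rewrite inE => xX1.
  have := loc x; have := miss x; have := dG x; rewrite -dE; move: xX1; rewrite /f; clear.
  by move: #|_| #|_| #|_| #|_| (d x) => *; lia.
have hL : #|[set e in I | ~~ [disjoint e & L]]|%:R * 10 <= #|M|%:R :> R.
  have L_small : #|L|%:R <= lam.
    rewrite -(ler_pM2r q0); apply: le_trans hs.
    have : #|L|%:R * (4 * q) <= 2 * #|I|%:R.
      rewrite -natrM -handshake // natr_sum; apply: le_trans (_ : \sum_(x in L) (d x)%:R <= _).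
        by rewrite mulr_natl -sumr_const; apply: ler_sum => x; rewrite inE => /andP[].
      by rewrite [leRHS](bigID (mem L)) lerDl sumr_ge0.
    by move: I_small; move: #|_|%:R #|_|%:R => u v; clear; lra.
  have [C hC typ] := h6 L L_small.
  have hI x : x \in L -> 4 * q <= #|nb (F :\: cut A) x|%:R by rewrite inE => /andP[].
  have hO x : x \in L -> 2 * q <= #|nb F x :&: opposite A x|%:R.
    rewrite !inE -leqNgt => /andP[]; rewrite -(ler_nat R) natrM => h1 h2.
    by move: (le_trans h2 h1); rewrite /f; move: #|_|%:R => u; clear; lra.
  have a10 : 0 <= 10 * a by rewrite mulr_ge0 // ltW.
  have c10 : 0 <= 10 * c by rewrite mulr_ge0 // ltW.
  have h := heavy_vertices GV FG tF (ltW p0) q0 c10 a10 (ltW t0) degu cod h5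
    (h9 L L_small) hI hO hC typ.
  apply: le_trans (_ : #|L|%:R * (10 * a) * 10 <= _).
    rewrite ler_pM2r //; apply: le_trans (_ : (\sum_(x in L) d x)%:R <= _).
      by rewrite ler_nat card_touching.
    rewrite natr_sum; apply: le_trans (_ : \sum_(x in L) 10 * a <= _).
      apply: ler_sum => x _; apply: le_trans (degu x); apply: leR_cards.
      by rewrite nbS // (subset_trans (subsetDl _ _)).
    by rewrite sumr_const -[leLHS]mulr_natl.
  (* Now 3/4 p q^2 |L| <= 2 tau |M| + 200 p rho a^2 |L|. The last term is at most p q^2 |L| / 4, and
     p q^2 >= 400 a tau, so 100 a |L| <= |M|. *)
  rewrite -(ler_pM2l t0); move: h; rewrite -/M cE.
  have : 0 <= #|L|%:R :> R by []; move: #|L|%:R #|M|%:R => l m l0.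
  have : 0 <= (q ^+ 2 - 800 * rho * a ^+ 2) * (p * l) by rewrite mulr_ge0 ?subr_ge0 // mulr_ge0 // ltW.
  have : 0 <= (p * q ^+ 2 - 400 * a * tau) * l by rewrite mulr_ge0 ?subr_ge0.
  by clear; lra.
pose common (e : {set T}) := [set v | [forall x in e, (v \in nb G x) && (v \in opposite A x)]].
pose light (e : {set T}) := [disjoint e & X1] && [disjoint e & L].
pose J := [set e in I | light e && (c / 200 <= #|common e|%:R)].
pose Q := [set e in I | light e && (#|common e|%:R < c / 200)].
have same H x y : H \subset I -> y \in nb H x -> (y \in A) = (x \in A).
  move=> HI /(subsetP (nbS x HI)); rewrite in_nb in_setD in_cut => /andP[+ _].
  by rewrite negbK eq_sym => /eqP.
have commonE H x y : H \subset I -> y \in nb H x ->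
    common [set x; y] = nb G x :&: nb G y :&: opposite A x.
  move=> HI /(same _ _ _ HI) yx; apply/setP => v; rewrite !in_setI inE.
  apply/forall_inP/idP => [h|/andP[/andP[vx vy] vo] z].
    have := h x; rewrite !inE eqxx => /(_ isT)/andP[-> ->].
    by have := h y; rewrite !inE eqxx orbT => /(_ isT)/andP[-> _].
  rewrite !inE => /orP[]/eqP ->; first by rewrite -in_nb vx; move: vo; rewrite inE.
  by rewrite -in_nb vy yx; move: vo; rewrite inE.
have JI : J \subset I by apply/subsetP => e; rewrite inE => /andP[].
have QI : Q \subset I by apply/subsetP => e; rewrite inE => /andP[].
have hJ : 10 * #|J|%:R <= #|M|%:R :> R.
  have c8 : 0 <= c / (80 * 100) by rewrite divr_ge0 ?mulr_ge0 ?ler0n // ltW.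
  have c10 : 0 <= 10 * c by rewrite mulr_ge0 // ltW.
  have := light_edges (A := A) (kc := c / 200) (zeta := (80 * 100)^-1)
    GV FG (subset_trans JI (subsetDl _ _)) tF c8 c10 _ _ cod _.
  rewrite -/M => h; have {h} : (c / 200 - 2 * (80 * 100)^-1 * (10 * c)) * #|J|%:R <= 2 * (c / (80 * 100)) * #|M|%:R.
    apply: h => [x y|x y yJ|x]; first exact: same.
      rewrite -(commonE J) //; have := yJ; rewrite in_nb inE => /andP[_ /andP[_]].
      by [].
    have [E|/set0Pn[y yJ]] := eqVneq (nb J x) set0.
      rewrite E cards0 mulr0 lern0 cards_eq0; apply/eqP/setP => v; rewrite !inE setI0 cards0.
      apply/negP => /andP[_]; rewrite leNgt => /negP; apply.
      by rewrite divr_gt0 ?mulr_gt0 ?ltr0n.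
    have xl : x \notin X1 /\ x \notin L.
      move: yJ; rewrite in_nb inE => /and3P[_ /andP[d1 d2] _].
      by rewrite !(disjointFr (A := [set x; y]) _ (set21 x y)).
    apply: h4 => [||v]; last by rewrite inE => /andP[].
      rewrite disjoints_subset; apply/subsetP => z zJ; rewrite !inE (same _ _ _ JI zJ) eqxx.
      by [].
    case: xl => xX1; rewrite inE xX1 /= -ltNge => /ltW; apply: le_trans.
    by rewrite ler_nat; apply: subset_leq_card; apply: nbS.
  move=> h; rewrite -(ler_pM2l c0); move: h; move: #|J|%:R #|M|%:R => j m; clear; lra.
have I_cover : (#|I| <= #|[set e in I | ~~ [disjoint e & X1]]| +
    #|[set e in I | ~~ [disjoint e & L]]| + #|J| + #|Q|)%N.
  apply: leq_trans (leq_add (leq_add (leq_card_setU _ _) (leqnn _)) (leqnn _)).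
  apply: leq_trans (leq_add (leq_card_setU _ _) (leqnn _)).
  apply: leq_trans (leq_card_setU _ _); apply/subset_leq_card/subsetP => e eI.
  rewrite !in_setU !(inE, eI) /= /light.
  by case: [disjoint e & X1]; case: [disjoint e & L]; rewrite ?orbT //= leNgt orNb.
have FI : (#|F| = #|F :&: cut A| + #|I|)%N by rewrite cardsID.
have GM : (#|G :&: cut A| = #|F :&: cut A| + #|M|)%N.
  rewrite -(cardsID F (G :&: cut A)) addnC addnC; congr (_ + _)%N.
  by congr #|pred_of_set _|; rewrite setIAC; congr (_ :&: _); apply/setIidPr.
have total : (#|F| * 10 + 4 * #|M| <= #|G :&: cut A| * 10 + 10 * #|Q|)%N.
  have hL' : (#|[set e in I | ~~ [disjoint e & L]]| * 10 <= #|M|)%N by rewrite -(ler_nat R) natrM.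
  have hJ' : (10 * #|J| <= #|M|)%N by rewrite -(ler_nat R) natrM.
  move: I_cover hX1 hL' hJ' FI GM; clear.
  by move: #|_| #|_| #|_| #|_| #|_| #|_| #|_| #|_| #|_| => *; lia.
have Q_empty : Q = set0.
  apply/eqP/negPn/negP => Q0.
  have Qx x y : y \in nb Q x -> x \notin X1 /\ x \notin L.
    rewrite in_nb inE => /and3P[_ /andP[d1 d2] _].
    by rewrite !(disjointFr (A := [set x; y]) _ (set21 x y)).
  have gap : (#|G :&: cut A| + #|Q| < maxcut G)%N.
    apply: (low_codegree_gap GV (subset_trans QI IV) Q0 p0 p1 cE a0 q0 qa c800) => //.
    - by move=> x y; exact: same.
    - move=> x y yQ; rewrite -(commonE Q) //; have := yQ; rewrite in_nb inE => /and3P[_ _].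
      by [].
    - move=> x y _.
      have : (#|nb G x :\: opposite A x| <= 11 * #|nb G x :&: opposite A x|)%N.
        have := loc x; have : (f x <= #|nb G x :&: opposite A x|)%N by rewrite subset_leq_card ?setSI ?nbS.
        by rewrite /f; clear; move: #|_| #|_| #|_| #|_| => *; lia.
      rewrite -(ler_nat R) natrM; have := degl x; rewrite -(cardsID (opposite A x)) natrD.
      by move: #|_|%:R #|_|%:R => u v; clear; lra.
    - by move=> P; apply: h8.
  move: gap total Fb; clear; move: #|_| #|_| #|_| #|_| (maxcut G) => *; lia.
have : (#|G :&: cut A| <= #|F|)%N by rewrite (leq_trans (maxcut_ge _ _)).
(* Without [Q] the inequality [total] forces [M] to be empty, and then no inner edge is left. *)
move: total FI GM; rewrite Q_empty cards0 => h1 h2 h3 h4'.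
have {h1 h2 h3 h4'} I0 : #|I| = 0%N.
  by move: h1 h2 h3 h4'; clear; move: #|_| #|_| #|_| #|_| #|_| => *; lia.
apply: (@bipartite_cut T F A); apply/subsetP => e eF; apply/negPn/negP => eA.
by have := cards0_eq I0 => /setP/(_ e); rewrite in_setD eA eF inE.
Qed.

End Stable.

(** * Containers and stability *)

Section Containers.
Variables (R : realFieldType) (T : finType).
Implicit Types (G F H W S : {set {set T}}) (A X : {set T}) (x u v w : T).
Notation n := (#|T|%:R : R).

(** Each triangle is counted six times, once per ordering of its vertices. *)
Definition triangles W : nat := \sum_x \sum_(v in nb W x) #|nb W v :&: nb W x|.

(** The two-edge paths of [F] whose ends form a pair of [W]. *)
Definition cherries F W : nat := \sum_x #|[set e in W | e \subset nb F x]|.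

Definition closed_by S : {set {set T}} := [set e : {set T} | [exists z, e \subset nb S z]].

(* A description [(S, f, b)] encodes one deletion step: the pairs with a common
   neighbour along [S] when [b] holds, and otherwise, at each vertex [x], the
   W-neighbours of [w] if [f x = Some w], or the W-neighbours of [x] of degree at
   least [bn] in the link of [x] if [f x = None]. *)
Definition removed (bn : R) (f : {ffun T -> option T}) W x v : bool :=
  if f x is Some w then v \in nb W w else bn <= #|nb W v :&: nb W x|%:R.

Definition refine (bn : R) W (d : {set {set T}} * {ffun T -> option T} * bool) :
    {set {set T}} :=
  if d.2 then W :\: closed_by d.1.1
  else W :\: [set e | [exists x, exists v, (e == [set x; v]) && removed bn d.1.2 W x v]].

Lemma exists_ge_average (f : T -> R) (s : R) :
  (0 < #|T|)%N -> s <= \sum_x f x -> exists x, s <= n * f x.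
Proof.
move=> /card_gt0P[x0 _] hs; have [x _ hx] := arg_maxP f (isT : xpredT x0).
exists x; apply: le_trans hs _; rewrite mulr_natl -sumr_const.
by apply: ler_sum => y _; exact: hx.
Qed.

Lemma closed_by_disjoint F S : F \subset vpairs T -> triangle_free F -> S \subset F ->
  [disjoint F & closed_by S].
Proof.
move=> FV tF SF; rewrite disjoints_subset; apply/subsetP => e eF; rewrite !inE.
apply/existsP => -[z /subsetP ez].
have /vpairsP[x [y [xy E]]] := subsetP FV e eF.
have xz : x \in nb F z by rewrite (subsetP (nbS z SF)) // ez // E set21.
have yz : y \in nb F z by rewrite (subsetP (nbS z SF)) // ez // E set22.
by apply: (triangle_freeP tF xz _ yz); rewrite in_nb -E.
Qed.

Lemma cherries_le F G H (cmax : R) : F \subset G -> H \subset vpairs T ->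
  (forall x y, x != y -> #|nb G x :&: nb G y|%:R <= cmax) ->
  (cherries F H)%:R <= #|H|%:R * cmax.
Proof.
move=> FG /subsetP HV cod.
have -> : (cherries F H = \sum_(e in H) \sum_x (e \subset nb F x))%N.
  rewrite exchange_big; apply: eq_bigr => x _.
  rewrite -sum1_card [LHS]big_mkcond [RHS]big_mkcond; apply: eq_bigr => e _.
  by rewrite inE; case: (e \in H); case: (e \subset _).
rewrite natr_sum mulr_natl -sumr_const; apply: ler_sum => e /HV /vpairsP[x [y [xy ->]]].
apply: le_trans (cod _ _ xy); rewrite ler_nat card_sum_in; apply: leq_sum => z _.
rewrite subUset !sub1set in_setI ![_ \in nb F z]nbC.
by case: (boolP (z \in nb F x)) => //= /(subsetP (nbS x FG)) ->;
  case: (boolP (z \in nb F y)) => //= /(subsetP (nbS y FG)) ->.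
Qed.

Definition star_edges F X : {set {set T}} := [set e in F | ~~ [disjoint e & X]].

Lemma nb_star_edges F X x : x \in X -> nb (star_edges F X) x = nb F x.
Proof.
move=> xX; apply/setP => y; rewrite !in_nb inE; case: (_ \in F) => //=.
by apply/pred0Pn; exists x; rewrite /= set21.
Qed.

(** Vertices are added one at a time, each closing at least the average number of new pairs of [W].
    While fewer than [dl] pairs are closed, these carry at most dl cmax <= kA / 2 cherries by the
    codegree bound. The other pairs carry kA / 2, so some vertex closes kA / (2 n) of them, and [k]
    rounds suffice. *)
Lemma greedy_closure G F W (dmax cmax dl kA : R) (k : nat) :
  (0 < #|T|)%N -> F \subset G -> F \subset vpairs T -> W \subset vpairs T ->
  (forall x y, x != y -> #|nb G x :&: nb G y|%:R <= cmax) -> 0 <= cmax ->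
  (forall x, #|nb G x|%:R <= dmax) ->
  kA <= (cherries F W)%:R -> 2 * dl * cmax <= kA -> 2 * dl * n <= k%:R * kA ->
  0 < kA ->
  exists S, [/\ S \subset F, #|S|%:R <= k%:R * dmax & dl <= #|W :&: closed_by S|%:R].
Proof.
move=> T0 FG FV WV cod c0 deg hk hdl hkg kA0.
have n0 : 0 < n by rewrite ltr0n.
suff [X kX dX] : exists2 X : {set T}, (#|X| <= k)%N & dl <= #|W :&: closed_by (star_edges F X)|%:R.
  exists (star_edges F X); split=> //; first by apply/subsetP => e; rewrite inE => /andP[].
  apply: le_trans (_ : (\sum_(x in X) #|nb F x|)%:R <= _); first by rewrite ler_nat card_touching.
  rewrite natr_sum; apply: le_trans (_ : \sum_(x in X) dmax <= _).
    by apply: ler_sum => x _; apply: le_trans (deg x); apply/leR_cards/nbS.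
  rewrite sumr_const -[leLHS]mulr_natl ler_wpM2r ?ler_nat //.
  have [x _] : exists x : T, true by move/card_gt0P: T0 => [x _]; exists x.
  by apply: le_trans (deg x).
have step j : exists2 X : {set T}, (#|X| <= j)%N & (dl <= #|W :&: closed_by (star_edges F X)|%:R) ||
    (j%:R * kA <= 2 * n * #|W :&: closed_by (star_edges F X)|%:R).
  elim: j => [|j [X jX]]; first by exists set0; rewrite ?cards0 // mul0r mulr_ge0 ?orbT // mulr_ge0.
  case/orP => [h|h]; first by exists X; [exact: leqW|rewrite h].
  have [h'|h'] := leP dl #|W :&: closed_by (star_edges F X)|%:R.
    by exists X; [exact: leqW|rewrite h'].
  set Z := closed_by _ in h h'.
  have split : (cherries F W = cherries F (W :&: Z) + cherries F (W :\: Z))%N.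
    rewrite /cherries -big_split; apply: eq_bigr => x _.
    rewrite -(cardsID Z); congr (_ + _)%N; apply: eq_card => e; rewrite !inE //.
      by rewrite andbAC.
    by rewrite andbA.
  have cZ : (cherries F (W :&: Z))%:R <= #|W :&: Z|%:R * cmax.
    by apply: cherries_le FG _ cod; rewrite (subset_trans (subsetIl _ _)).
  have cWZ : kA / 2 <= (cherries F (W :\: Z))%:R.
    have h2 : #|W :&: Z|%:R * cmax <= dl * cmax by rewrite ler_wpM2r // ltW.
    move: hk cZ h2 hdl; rewrite split natrD.
    by move: #|_|%:R _%:R _%:R => u v w; clear; lra.
  have [x hx] : exists x, kA / 2 <= n * #|[set e in W :\: Z | e \subset nb F x]|%:R.
    by apply: exists_ge_average => //; rewrite -natr_sum.
  exists (x |: X); first by rewrite (leq_trans (leq_card_setU _ _)) // cards1.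
  apply/orP; right; apply: le_trans (_ : 2 * n * (#|W :&: Z| + #|[set e in W :\: Z | e \subset nb F x]|)%:R <= _).
    rewrite natrD -natr1; move: h hx; move: #|_|%:R #|_|%:R => i l; clear; lra.
  rewrite ler_wpM2l ?mulr_ge0 // ler_nat.
  have -> : (#|W :&: Z| + #|[set e in W :\: Z | e \subset nb F x]| =
     #|(W :&: Z) :|: [set e in W :\: Z | e \subset nb F x]|)%N.
    have dis : (W :&: Z) :&: [set e in W :\: Z | e \subset nb F x] = set0.
      apply/eqP; rewrite setI_eq0 disjoints_subset; apply/subsetP => e; rewrite in_setI => /andP[_ eZ].
      by rewrite in_setC inE in_setD eZ.
    by rewrite cardsU dis cards0 subn0.
  apply/subset_leq_card/subsetP => e; rewrite in_setU => /orP[|].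
    rewrite !in_setI => /andP[-> /=]; rewrite !inE => /existsP[z ez].
    apply/existsP; exists z; apply: subset_trans ez (nbS z _).
    apply/subsetP => e'; rewrite !inE => /andP[-> /=]; apply: contra.
    by apply: disjointWr; exact: subsetUr.
  rewrite inE in_setD in_setI => /andP[/andP[_ ->] /= ex]; rewrite inE; apply/existsP; exists x.
  by rewrite nb_star_edges // setU11.
have [X kX /orP[|h]] := step k; first by exists X.
have n2 : 0 < 2 * n by rewrite mulr_gt0.
exists X => //; rewrite -(ler_pM2l n2); apply: le_trans h.
by rewrite mulrAC.
Qed.

(** If some [w] has many W-neighbours in the link of x but few F-neighbours of x among them,
    deleting these pairs at x is cheap. Otherwise every vertex of large degree in the link sees many
    F-neighbours of x; with few cherries, few such vertices are themselves F-neighbours of x, and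
    all of them can be deleted. *)
Lemma sparse_refinement F W (bn rr kT : R) :
  (0 < #|T|)%N -> F \subset vpairs T -> W \subset vpairs T -> 0 < rr -> 0 <= bn ->
  kT <= (triangles W)%:R ->
  exists f : {ffun T -> option T}, let W' := refine bn W (set0, f, false) in
    rr * #|F :&: (W :\: W')|%:R <= n * rr ^+ 2 + 2 * (cherries F W)%:R /\
    (kT - 2 * bn * n ^+ 2) * bn <= 2 * n ^+ 2 * #|W :\: W'|%:R.
Proof.
move=> T0 FV WV rr0 bn0 hT.
have n0 : 0 < n by rewrite ltr0n.
pose good x w := (bn <= #|nb W w :&: nb W x|%:R) && (#|nb W w :&: nb F x|%:R <= rr).
pose f := [ffun x => [pick w | good x w]].
exists f => /=; set W' := refine _ _ _.
pose rem x := [set v in nb W x | removed bn f W x v].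
have remW x v : v \in rem x -> [set x; v] \in W :\: W'.
  rewrite inE => /andP[vx rv]; rewrite /W' /refine setDDr setDv set0U in_setI -in_nb vx inE.
  by apply/existsP; exists x; apply/existsP; exists v; rewrite eqxx.
split.
  (* When [f x = None], every removed [v] has more than [rr] F-neighbours of [x] in
     its W-neighbourhood, and these pairs are cherries at [x]. *)
  have cov x : rr * #|rem x :&: nb F x|%:R <= rr ^+ 2 + 2 * #|[set e in W | e \subset nb F x]|%:R.
    have EW : 2 * #|[set e in W | e \subset nb F x]|%:R = \sum_(v in nb F x) #|nb W v :&: nb F x|%:R :> R.
      rewrite -natrM -handshake; last by apply: subset_trans WV; apply/subsetP => e; rewrite inE => /andP[].
      rewrite natr_sum [RHS]big_mkcond; apply: eq_bigr => v _.
      have -> : nb [set e in W | e \subset nb F x] v = if v \in nb F x then nb W v :&: nb F x else set0.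
        apply/setP => u; rewrite in_nb inE subUset !sub1set -in_nb.
        by case: ifP => _; rewrite ?in_setI ?inE ?andbF.
      by case: ifP => // _; rewrite cards0.
    rewrite EW; case Ef: (f x) => [w|].
      move: (Ef); rewrite ffunE; case: pickP => // w' /andP[_ gw] [E]; rewrite E in gw.
      rewrite -[leLHS]addr0 lerD ?sumr_ge0 // expr2 ler_pM2l //; apply: le_trans gw.
      by apply/leR_cards/setSI; apply/subsetP => v; rewrite inE /removed Ef => /andP[].
    move: (Ef); rewrite ffunE; case: pickP => // nog _.
    rewrite -[leLHS]add0r lerD ?exprn_ge0 ?(ltW rr0) // [leLHS]mulr_natr -sumr_const.
    rewrite [leLHS]big_mkcond [leRHS]big_mkcond; apply: ler_sum => v _ /=.
    case: ifP => [|_]; last by case: ifP.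
    rewrite in_setI inE /removed Ef => /andP[/andP[_ hv] ->].
    by have := nog v; rewrite /good hv /= => /negbT; rewrite -ltNge => /ltW.
  have : (#|F :&: (W :\: W')| <= \sum_x #|rem x :&: nb F x|)%N.
    apply: leq_trans (_ : #|\bigcup_(x in setT) ((fun v => [set x; v]) @: (rem x :&: nb F x))| <= _)%N.
      apply/subset_leq_card/subsetP => e; rewrite in_setI /W' /refine /= setDDr setDv set0U.
      rewrite in_setI inE => /andP[eF /andP[eW /existsP[x /existsP[v /andP[/eqP E rv]]]]].
      apply/bigcupP; exists x; rewrite ?in_setT // E; apply: imset_f.
      by rewrite in_setI inE !in_nb -E eW eF rv.
    apply: leq_trans (card_bigcup_le _ _) _.
    rewrite [leqLHS](eq_bigl xpredT) => [|x]; last by rewrite in_setT.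
    by apply: leq_sum => x _; exact: leq_imset_card.
  rewrite -(ler_nat R) natr_sum -(ler_pM2l rr0) => h; apply: le_trans h _.
  rewrite mulr_sumr natr_sum mulr_sumr mulr_natl -sumr_const -big_split.
  by apply: ler_sum => x _; exact: cov.
have rem_sum : (\sum_x #|rem x|)%:R <= 2 * #|W :\: W'|%:R :> R.
  rewrite -natrM -handshake; last by rewrite (subset_trans (subsetDl _ _)).
  rewrite ler_nat; apply: leq_sum => x _; apply/subset_leq_card/subsetP => v.
  by move=> /remW; rewrite in_nb.
pose t x := (\sum_(v in nb W x) #|nb W v :&: nb W x|)%N.
(* If [t x] exceeds 2 bn n, at least [bn] vertices are removed at x in either case, while [t x] is
   at most n^2. The remaining x go into the error term. *)
have tx x : (t x)%:R * bn <= n ^+ 2 * #|rem x|%:R + 2 * bn * n * bn.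
  have [tb|tb] := leP (t x)%:R (2 * bn * n).
    by rewrite -[leLHS]add0r lerD ?mulr_ge0 ?exprn_ge0 // ler_wpM2r.
  rewrite -[leLHS]addr0 lerD ?mulr_ge0 //.
  have remb : bn <= #|rem x|%:R.
    case Ef: (f x) => [w|].
      move: (Ef); rewrite ffunE; case: pickP => // w' /andP[gw _] [E]; rewrite E in gw.
      apply: le_trans gw _; apply/leR_cards/subsetP => v; rewrite in_setI => /andP[vw vx].
      by rewrite inE vx /removed Ef.
    have : (t x)%:R <= n * #|rem x|%:R + n * bn.
      rewrite natr_sum.
      apply: le_trans (_ : \sum_v (n * (v \in rem x)%:R + bn) <= _); last first.
        by rewrite big_split /= -mulr_sumr -cardR_sum sumr_const -[X in _ + X]mulr_natl.
      rewrite [leLHS]big_mkcond; apply: ler_sum => v _ /=.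
      case: ifP => vx; last by rewrite addr_ge0 ?mulr_ge0.
      have [hv|hv] := leP bn #|nb W v :&: nb W x|%:R; last first.
        by rewrite -[leLHS]add0r lerD ?mulr_ge0 // ltW.
      by rewrite inE vx /removed Ef hv mulr1 -[leLHS]addr0 lerD // ler_nat max_card.
    move=> /(lt_le_trans tb) h; rewrite -(ler_pM2l n0); apply: ltW; move: h.
    by move: #|rem x|%:R => i; clear; lra.
  apply: ler_pM => //; rewrite -natrX ler_nat /t.
  apply: leq_trans (_ : \sum_(v in nb W x) #|T| <= _)%N; first by apply: leq_sum => v _; exact: max_card.
  by rewrite sum_nat_const -mulnn leq_mul2r max_card orbT.
have : (triangles W)%:R * bn <= n ^+ 2 * (\sum_x #|rem x|)%:R + 2 * bn * n * bn * n.
  rewrite /triangles !natr_sum mulr_suml mulr_sumr [X in _ + X]mulr_natr -[X in _ + X]sumr_const -big_split.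
  by apply: ler_sum => x _; exact: tx.
have := ler_wpM2r bn0 hT; have := ler_wpM2l (exprn_ge0 2 (ltW n0)) rem_sum.
move: #|_|%:R (_)%:R (triangles W)%:R => i j l; clear; lra.
Qed.

(** The function is unrestricted: its (n + 1)^n values add only about n log n to the logarithm of
    the count, next to the s log n due to [S]. *)
Definition descriptions (s : R) : {set ({set {set T}} * {ffun T -> option T} * bool)} :=
  [set d : {set {set T}} * {ffun T -> option T} * bool | (d.1.1 \subset vpairs T) && (#|d.1.1|%:R <= s)].

Fixpoint containers (bn s : R) (r : nat) : {set {set {set T}}} :=
  if r is r'.+1 then containers bn s r' :|:
    [set refine bn W d | W in containers bn s r', d in descriptions s]
  else [set vpairs T].

Lemma card_containers bn s r :
  (#|containers bn s r| <= (#|descriptions s|.+1) ^ r)%N.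
Proof.
elim: r => [|r IH] /=; first by rewrite cards1.
apply: leq_trans (leq_card_setU _ _) _; rewrite expnSr mulnS leq_add //.
pose g (u : {set {set T}} * ({set {set T}} * {ffun T -> option T} * bool)) :=
  refine bn u.1 u.2.
apply: (@leq_trans #|g @: setX (containers bn s r) (descriptions s)|).
  apply/subset_leq_card/subsetP => W /imset2P[W' d W'r ds ->].
  by apply/imsetP; exists (W', d) => //; rewrite in_setX W'r.
by apply: leq_trans (leq_imset_card _ _) _; rewrite cardsX leq_mul2r IH orbT.
Qed.

Lemma containers_subset bn s r W : W \in containers bn s r -> W \subset vpairs T.
Proof.
elim: r W => [|r IH] W /=; first by rewrite inE => /eqP ->.
rewrite in_setU => /orP[/IH //|/imset2P[W' d W'r _ ->]].
apply: subset_trans (IH _ W'r); rewrite /refine; case: ifP => _; exact: subsetDl.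
Qed.

(** The quantity |F \ W| + e0 |W| never increases: a closure step loses no edge of [F], and a
    refinement loses at most [e0] edges per deleted pair. Every step deletes at least [dl] pairs, so
    [r] steps would exhaust all pairs, and a container with few triangles must occur earlier. *)
Lemma container_of_triangle_free G F (dmax cmax dl dlB kA kT rr bn s e0 lossB : R) (k r : nat) :
  (0 < #|T|)%N -> G \subset vpairs T -> F \subset G -> triangle_free F ->
  (forall x y, x != y -> #|nb G x :&: nb G y|%:R <= cmax) -> 0 <= cmax ->
  (forall x, #|nb G x|%:R <= dmax) ->
  0 < kA -> 2 * dl * cmax <= kA -> 2 * dl * n <= k%:R * kA -> k%:R * dmax <= s ->
  0 < rr -> 0 <= bn -> dl <= dlB -> 2 * n ^+ 2 * dlB <= (kT - 2 * bn * n ^+ 2) * bn ->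
  n * rr ^+ 2 + 2 * kA <= rr * lossB -> lossB <= e0 * dlB -> 0 <= s -> 0 <= e0 ->
  #|vpairs T|%:R < r%:R * dl ->
  exists2 W, W \in containers bn s r &
    (triangles W)%:R < kT /\ #|F :\: W|%:R <= e0 * #|vpairs T|%:R.
Proof.
move=> T0 GV FG tF cod c0 deg kA0 h1 h2 hs rr0 bn0 hd hB hl he s0 e00 hr.
have FV := subset_trans FG GV; have n0 : 0 < n by rewrite ltr0n.
suff [W Wr [[ht hl']|[]]] : exists2 W, W \in containers bn s r &
    (triangles W)%:R < kT /\ #|F :\: W|%:R + e0 * #|W|%:R <= e0 * #|vpairs T|%:R \/
    #|F :\: W|%:R + e0 * #|W|%:R <= e0 * #|vpairs T|%:R /\
    r%:R * dl + #|W|%:R <= #|vpairs T|%:R.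
- exists W => //; split=> //; apply: le_trans hl'; rewrite lerDl mulr_ge0 //.
- move=> _ h; have : r%:R * dl <= #|vpairs T|%:R by apply: le_trans h; rewrite lerDl.
  by rewrite leNgt hr.
elim: (r) => [|j [W Wj IH]].
  exists (vpairs T); first by rewrite inE.
  by right; rewrite mul0r add0r (eqP (_ : F :\: _ == set0)) ?setD_eq0 // cards0 add0r.
case: IH => [IH|[IH1 IH2]]; first by exists W; [rewrite /= in_setU Wj|left].
have [ht|ht] := ltP (triangles W)%:R kT; first by exists W; [rewrite /= in_setU Wj|left].
have WV := containers_subset Wj.
have [hk|hk] := leP kA (cherries F W)%:R.
  have [S [SF hS hd']] := greedy_closure T0 FG FV WV cod c0 deg hk h1 h2 kA0.
  exists (refine bn W (S, [ffun=> None], true)).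
    rewrite /= in_setU; apply/orP; right; apply: imset2_f => //.
    by rewrite inE /= (subset_trans SF) //= (le_trans hS).
  right; rewrite /refine /=.
  have -> : F :\: (W :\: closed_by S) = F :\: W.
    rewrite setDDr; have := closed_by_disjoint FV tF SF; rewrite -setI_eq0 => /eqP ->.
    by rewrite setU0.
  have E : #|W|%:R = #|W :&: closed_by S|%:R + #|W :\: closed_by S|%:R :> R.
    by rewrite -natrD cardsID.
  split.
    apply: le_trans IH1; rewrite lerD2l ler_wpM2l // ler_nat subset_leq_card // subsetDl.
    done.
  rewrite -natr1; move: IH2 hd'; rewrite E; clear; move: #|_|%:R #|_|%:R #|_|%:R j%:R => *; lra.
have [f [hf1 hf2]] := sparse_refinement T0 FV WV rr0 bn0 ht.
set W' := refine _ _ _ in hf1 hf2; exists W'.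
  rewrite /= in_setU; apply/orP; right; apply: imset2_f => //.
  by rewrite inE /= sub0set cards0.
have W'W : W' \subset W by rewrite /W' /refine subsetDl.
have E : #|W|%:R = #|W'|%:R + #|W :\: W'|%:R :> R.
  by rewrite -natrD -[in LHS](cardsID W' W) (setIidPr W'W).
have dW : dlB <= #|W :\: W'|%:R.
  rewrite -(ler_pM2l (_ : 0 < 2 * n ^+ 2)) ?mulr_gt0 ?exprn_gt0 //.
  exact: le_trans hB hf2.
have lF : #|F :\: W'|%:R <= #|F :\: W|%:R + #|F :&: (W :\: W')|%:R :> R.
  move: (W') => X; rewrite -natrD ler_nat; apply: leq_trans (leq_card_setU _ _).
  apply/subset_leq_card/subsetP => e; rewrite !(in_setU, in_setI, in_setD).
  by case: (e \in W); case: (e \in F); case: (e \in X).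
have lF' : #|F :&: (W :\: W')|%:R <= lossB.
  rewrite -(ler_pM2l rr0); apply: le_trans hf1 (le_trans _ hl).
  by rewrite lerD2l ler_pM2l // ltW.
right; split.
  apply: le_trans IH1; rewrite E.
  have h3 : lossB <= e0 * #|W :\: W'|%:R by apply: le_trans he _; rewrite ler_wpM2l.
  move: lF lF' h3; clear; move: #|_|%:R #|_|%:R #|_|%:R #|_|%:R #|_|%:R => *; lra.
rewrite -natr1; move: IH2 dW hd; rewrite E; clear; move: #|_|%:R #|_|%:R #|_|%:R j%:R => *; lra.
Qed.

(** The degrees over N(x) sum to the pairs of [W] crossing N(x) plus twice those inside it, and the
    sum of codegrees with x is also twice the number inside. *)
Lemma noncut_card W x : W \subset vpairs T ->
  (#|W :\: cut (nb W x)| + \sum_(u in nb W x) #|nb W u| =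
   \sum_(v in nb W x) #|nb W v :&: nb W x| + #|W|)%N.
Proof.
move=> WV; set A := nb W x; set t := (\sum_(v in A) #|nb W v :&: A|)%N.
have WDV : W :\: cut A \subset vpairs T by rewrite (subset_trans (subsetDl _ _)).
have H1 := handshake WDV; have H2 := handshake WV.
have E1 : (\sum_u #|nb (W :\: cut A) u| = t + \sum_(u | u \notin A) #|nb W u :\: A|)%N.
  rewrite (bigID (mem A)) /=; congr (_ + _)%N; apply: eq_bigr => u uA; rewrite nb_cutD.
    by apply: eq_card => v; rewrite in_setD in_setI inE uA andbC; case: (v \in A).
  by apply: eq_card => v; rewrite !in_setD inE (negPf uA); case: (v \in A).
have E2 : (\sum_u #|nb W u| = \sum_(u in A) #|nb W u| +
     (\sum_(u | u \notin A) #|nb W u :&: A| + \sum_(u | u \notin A) #|nb W u :\: A|))%N.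
  rewrite (bigID (mem A)) /=; congr (_ + _)%N; rewrite -big_split.
  by apply: eq_bigr => u _; rewrite /= cardsID.
have E3 : (\sum_(u in A) #|nb W u| = t + \sum_(u | u \notin A) #|nb W u :&: A|)%N.
  rewrite -[RHS](bigID (mem A) xpredT (fun u => #|nb W u :&: A|)) /=.
  rewrite (eq_bigr (fun u => \sum_v (v \in nb W u))%N) => [|u _]; last by rewrite card_sum_in.
  rewrite exchange_big; apply: eq_bigr => v _; rewrite -sum1_card [LHS]big_mkcond [RHS]big_mkcond /=.
  by apply: eq_bigr => u _; rewrite in_setI nbC; case: (u \in nb W v); case: (u \in A).
move: H1 H2 E1 E2 E3; move: (\sum_(u | _) _)%N (\sum_(u | _) _)%N (\sum_(u | _) _)%N (\sum_(u | _) _)%N (\sum_(u | _) _)%N #|_| #|_| t.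
clear; lia.
Qed.

(** Average [noncut_card] over x: the degree sums become the sum of squared degrees, at least 4
    |W|^2 / n by Cauchy-Schwarz. Some neighbourhood cut is as good as the average. *)
Lemma dense_stability W : (0 < #|T|)%N -> W \subset vpairs T ->
  exists A, n ^+ 2 * #|W :\: cut A|%:R <=
    n * (triangles W)%:R + (n ^+ 2 - 4 * #|W|%:R) * #|W|%:R.
Proof.
move=> T0 WV; have n0 : 0 < n by rewrite ltr0n.
have [x hx] := exists_ge_average (f := fun x => \sum_(u in nb W x) #|nb W u|%:R -
    (\sum_(v in nb W x) #|nb W v :&: nb W x|)%:R) T0 (lexx _).
exists (nb W x).
have /(congr1 (fun i => i%:R : R)) := noncut_card x WV; rewrite !natrD natr_sum => E.
have E' : #|W :\: cut (nb W x)|%:R = #|W|%:R - (\sum_(u in nb W x) #|nb W u|%:R -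
    (\sum_(v in nb W x) #|nb W v :&: nb W x|)%:R) :> R.
  by move: E; clear; lra.
rewrite E'; move: hx; set g := _ - _; rewrite sumrB -natr_sum -/(triangles W).
have -> : \sum_x0 \sum_(u in nb W x0) #|nb W u|%:R = \sum_u #|nb W u|%:R ^+ 2 :> R.
  rewrite (eq_bigr (fun x => \sum_u (u \in nb W x)%:R * #|nb W u|%:R)); last first.
    move=> y _; rewrite big_mkcond; apply: eq_bigr => u _.
    by case: (u \in _); rewrite ?mul1r ?mul0r.
  rewrite exchange_big; apply: eq_bigr => u _; rewrite -mulr_suml.
  rewrite (eq_bigr (fun y => (y \in nb W u)%:R)) => [|y _]; last by rewrite nbC.
  by rewrite -cardR_sum expr2.
have cs : 4 * #|W|%:R ^+ 2 <= n * \sum_u #|nb W u|%:R ^+ 2.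
  have S : \sum_u #|nb W u|%:R = 2 * #|W|%:R :> R by rewrite -natr_sum handshake // natrM.
  have : 0 <= \sum_u (n * #|nb W u|%:R - 2 * #|W|%:R) ^+ 2.
    by apply: sumr_ge0 => u _; exact: sqr_ge0.
  rewrite (eq_bigr (fun u => n ^+ 2 * #|nb W u|%:R ^+ 2 + (- (4 * n * #|W|%:R)) * #|nb W u|%:R + 4 * #|W|%:R ^+ 2)); last first.
    by move=> u _; ring.
  have Sc : \sum_(i : T) #|W|%:R = n * #|W|%:R :> R by rewrite sumr_const -[LHS]mulr_natl.
  rewrite !big_split /= -!mulr_sumr S Sc => h.
  rewrite -(ler_pM2l n0); move: h; move: (\sum_u _) #|W|%:R => i w; clear; lra.
rewrite -(ler_pM2l n0) => h.
have := ler_wpM2l (ltW n0) h.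
move: h cs; move: (\sum_u _) #|W|%:R (triangles W)%:R g => i w t g; clear; lra.
Qed.

End Containers.

(** * Typical properties of the random graph *)

Section Events.
Variables (R : realType) (T : finType) (p : R).
Hypothesis p01 : 0 <= p <= 1.
Implicit Types (G F H W : {set {set T}}) (A D L S : {set T}) (x y u v : T).
Notation n := (#|T|%:R : R).
Notation pr := (prob (vpairs T) p).
Notation l := (ln n).

Lemma card_lower_tail (S : {set {set T}}) (lam dev : R) :
  S \subset vpairs T -> 0 <= lam <= 3^-1 ->
  pr (fun G => #|G :&: S|%:R <= p * #|S|%:R - dev) <=
  expR (p * lam ^+ 2 * #|S|%:R - lam * dev).
Proof.
move=> /subsetP SV hl.
have := @lipschitz_tail R _ (vpairs T) p p01 S (fun G => #|G :&: S|%:R) xpredT lam dev hl.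
rewrite [X in _ -> _ <= _ * X](_ : _ = 1); last by rewrite -(expect1 (vpairs T) p); apply: eq_expect.
rewrite mulr1 => h; apply: le_trans (h _) => [|e eS]; last first.
  by split; [exact: SV|exact: lipschitz_card|].
apply: (le_prob p01) => G _ /=; rewrite resamples_card setIid.
by rewrite (_ : (G :\: S) :&: S = set0) ?cards0 ?add0r // setIC setIDA setIC setDIl setDv setI0.
Qed.

Lemma card_upper_tail (S : {set {set T}}) (lam dev : R) :
  S \subset vpairs T -> 0 <= lam <= 3^-1 ->
  pr (fun G => p * #|S|%:R + dev <= #|G :&: S|%:R) <=
  expR (p * lam ^+ 2 * #|S|%:R - lam * dev).
Proof.
move=> /subsetP SV hl.
have := @lipschitz_tail R _ (vpairs T) p p01 S (fun G => - #|G :&: S|%:R) xpredT lam dev hl.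
rewrite [X in _ -> _ <= _ * X](_ : _ = 1); last by rewrite -(expect1 (vpairs T) p); apply: eq_expect.
rewrite mulr1 => h; apply: le_trans (h _) => [|e eS]; last first.
  by split; [exact: SV|exact: lipschitz_cardN|].
apply: (le_prob p01) => G _ /=; rewrite resamplesN resamples_card setIid.
rewrite (_ : (G :\: S) :&: S = set0) ?cards0 ?add0r; last first.
  by rewrite setIC setIDA setIC setDIl setDv setI0.
by rewrite -opprD lerN2.
Qed.

Lemma edge_inj x u v : x != u -> [set x; u] = [set x; v] -> u = v.
Proof.
move=> xu E; have : u \in [set x; v] by rewrite -E set22.
by rewrite !inE eq_sym (negPf xu) => /eqP.
Qed.

Lemma edge_eq2 u v u' v' : [set u; v] = [set u'; v'] -> u != v' -> u = u' /\ v = v'.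
Proof.
move=> E uv'; have : u \in [set u'; v'] by rewrite -E set21.
rewrite !inE (negPf uv') orbF => /eqP uu'; subst u'.
split=> //; have : v' \in [set u; v] by rewrite E set22.
by rewrite !inE eq_sym (negPf uv') => /eqP.
Qed.

Lemma degree_upper x : pr (fun G => 10 * (n * p) < #|nb G x|%:R) <= expR (- (10 * (n * p))).
Proof.
have h := @blocks_tail R _ (vpairs T) p p01 T [set~ x] (fun v => [set [set x; v]]) 1 (10 * (n * p)).
apply: le_trans (h _ _ _).
- apply: (le_prob p01) => G GV /ltW h'; apply: le_trans h' _; apply: leR_cards.
  apply/subsetP => v vx; rewrite !inE sub1set -in_nb vx andbT eq_sym.
  exact: nb_neq vx.
- by move=> v; rewrite !inE sub1set in_vpairs cards1 eq_sym.
- move=> v v'; rewrite !inE => vx v'x; rewrite disjoints1 inE; apply: contra => /eqP E.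
  by apply/eqP; apply: (edge_inj (x := x)) E; rewrite eq_sym.
case/andP: p01 => p0 _; rewrite expr1 -mulrA.
have : #|[set~ x]|%:R * p <= n * p by rewrite ler_wpM2r // ler_nat max_card.
have : 0 <= n * p by rewrite mulr_ge0.
lra.
Qed.

Lemma codegree_upper x y : x != y ->
  pr (fun G => 10 * (n * p ^+ 2) < #|nb G x :&: nb G y|%:R) <= expR (- (10 * (n * p ^+ 2))).
Proof.
move=> xy.
have h := @blocks_tail R _ (vpairs T) p p01 T (~: [set x; y])
  (fun v => [set [set x; v]; [set y; v]]) 2 (10 * (n * p ^+ 2)).
apply: le_trans (h _ _ _).
- apply: (le_prob p01) => G GV /ltW h'; apply: le_trans h' _; apply: leR_cards.
  apply/subsetP => v; rewrite in_setI => /andP[vx vy].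
  rewrite !inE subUset !sub1set -!in_nb vx vy ![v == _]eq_sym.
  by rewrite (negPf (nb_neq GV vx)) (negPf (nb_neq GV vy)).
- move=> v; rewrite !inE negb_or => /andP[vx vy]; rewrite subUset !sub1set !in_vpairs ![_ == v]eq_sym vx vy.
  split=> //; rewrite cards2; case: eqP => // E.
  have : x \in [set y; v] by rewrite -E set21.
  by rewrite !inE (negPf xy) eq_sym (negPf vx).
- move=> v v'; rewrite !inE !negb_or => /andP[vx vy] /andP[v'x v'y] vv'.
  rewrite disjoints_subset; apply/subsetP => e eb; rewrite inE; apply/negP => eb'.
  have : v \in e by move: eb; rewrite !inE => /orP[]/eqP ->; rewrite set22.
  by move: eb'; rewrite !inE => /orP[]/eqP ->; rewrite !inE ?(negPf vx) ?(negPf vy) (negPf vv').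
case/andP: p01 => p0 _; rewrite -mulrA.
have : #|~: [set x; y]|%:R * p ^+ 2 <= n * p ^+ 2 by rewrite ler_wpM2r ?exprn_ge0 // ler_nat max_card.
have : 0 <= n * p ^+ 2 by rewrite mulr_ge0 // exprn_ge0.
lra.
Qed.

Definition star x : {set {set T}} := [set [set x; v] | v in [set~ x]].

Lemma star_vpairs x : star x \subset vpairs T.
Proof. by apply/subsetP => e /imsetP[v]; rewrite inE => vx ->; rewrite in_vpairs eq_sym -in_set1. Qed.

Lemma card_star_full x : #|star x| = #|T|.-1.
Proof.
rewrite card_in_imset ?cardsC1 // => u v; rewrite !inE => ux vx E.
by apply: edge_inj E; rewrite eq_sym.
Qed.

Lemma nb_star G x : G \subset vpairs T -> #|G :&: star x| = #|nb G x|.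
Proof.
move=> GV; rewrite -card_star //; apply: eq_card => e; rewrite !inE.
apply: andb_id2l => eG; apply/imsetP/idP => [[v _ ->]|xe]; first by rewrite set21.
have /vpairsP[u [v [uv E]]] := subsetP GV e eG.
move: xe; rewrite E !inE => /orP[]/eqP ->; [exists v|exists u] => //.
  by rewrite !inE eq_sym.
  by rewrite !inE.
by rewrite setUC.
Qed.

Lemma degree_lower x : 4 <= n ->
  pr (fun G => #|nb G x|%:R < n * p / 2) <= expR (- (n * p / 64)).
Proof.
move=> n4; case/andP: (p01) => p0 p1.
have l8 : 0 <= (8^-1 : R) <= 3^-1 by apply/andP; split; lra.
apply: le_trans (le_trans (card_lower_tail (n * p / 4) (star_vpairs x) l8) _).
  apply: (le_prob p01) => G GV /ltW; rewrite nb_star // card_star_full => h; apply: le_trans h _.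
  have -> : #|T|.-1%:R = n - 1 :> R.
    rewrite -[#|T| in RHS](prednK (_ : (0 < #|T|)%N)) -?natr1 ?addrK //.
    by rewrite -(ltr_nat R); apply: lt_le_trans n4.
  have : 4 * p <= n * p by rewrite ler_wpM2r.
  lra.
rewrite ler_expR card_star_full.
have : #|T|.-1%:R * p <= n * p by rewrite ler_wpM2r // ler_nat leq_pred.
lra.
Qed.

Lemma card_rel (I J : finType) (Q : I -> J -> bool) :
  (#|[set z : I * J | Q z.1 z.2]| = \sum_i \sum_j Q i j)%N.
Proof.
rewrite pair_big /= -sum1_card big_mkcond; apply: eq_bigr => z _.
by rewrite inE; case: (Q _ _).
Qed.

Lemma sum_star_blocks G D S : (#|[set w in setX D S | [set [set w.1; w.2]] \subset G]| =
  \sum_(v in S) #|nb G v :&: D|)%N.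
Proof.
have -> : [set w in setX D S | [set [set w.1; w.2]] \subset G] =
   [set w : T * T | [&& w.1 \in D, w.2 \in S & w.1 \in nb G w.2]].
  apply/setP => -[u v]; rewrite in_set [RHS]in_set in_setX sub1set /= in_nb setUC.
  by rewrite andbA.
rewrite (card_rel (fun u v => [&& u \in D, v \in S & u \in nb G v])) exchange_big.
rewrite [RHS]big_mkcond; apply: eq_bigr => v _ /=; case: (v \in S); last first.
  by rewrite big1 // => u _; rewrite andbF.
by rewrite card_sum_in; apply: eq_bigr => u _; rewrite in_setI andbC.
Qed.

Lemma bipartite_upper D S (t : R) : [disjoint D & S] ->
  9 * (#|D|%:R * #|S|%:R) * p <= t ->
  pr (fun G => t <= \sum_(v in S) #|nb G v :&: D|%:R) <= expR (- t).
Proof.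
rewrite disjoints_subset => /subsetP DS ht.
have disj u v : u \in D -> v \in S -> u != v.
  by move=> /DS; rewrite inE => uS vS; apply: contraNneq uS => ->.
have h := @blocks_tail R _ (vpairs T) p p01 _ (setX D S) (fun w => [set [set w.1; w.2]]) 1 t.
apply: le_trans (h _ _ _).
- by apply: (le_prob p01) => G GV; rewrite sum_star_blocks natr_sum.
- by move=> [u v]; rewrite in_setX /= => /andP[uD vS]; rewrite sub1set in_vpairs cards1 disj.
- move=> [u v] [u' v']; rewrite !in_setX /= => /andP[uD vS] /andP[u'D v'S] ne.
  rewrite disjoints1 inE; apply: contra ne => /eqP E.
  by have [-> ->] := edge_eq2 E (disj _ _ uD v'S).
by rewrite cardsX natrM expr1.
Qed.

Lemma bipartite_lower S S' : [disjoint S & S'] ->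
  pr (fun G => \sum_(v in S) #|nb G v :&: S'|%:R < p * #|S|%:R * #|S'|%:R / 2) <=
  expR (- (p * #|S|%:R * #|S'|%:R / 16)).
Proof.
rewrite disjoints_subset => /subsetP SS.
have disj u v : u \in S -> v \in S' -> u != v.
  by move=> /SS; rewrite inE => uS vS; apply: contraNneq uS => ->.
pose E := (fun w : T * T => [set w.1; w.2]) @: setX S S'.
have injE : {in setX S S' &, injective (fun w : T * T => [set w.1; w.2])}.
  move=> [u v] [u' v']; rewrite !in_setX /= => /andP[uD vS] /andP[u'D v'S] EE.
  by have [-> ->] := edge_eq2 EE (disj _ _ uD v'S).
have EV : E \subset vpairs T.
  apply/subsetP => e /imsetP[[u v]]; rewrite in_setX /= => /andP[uS vS] ->.
  by rewrite in_vpairs disj.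
have cE : #|E| = (#|S| * #|S'|)%N by rewrite card_in_imset // cardsX.
have l4 : 0 <= (4^-1 : R) <= 3^-1 by apply/andP; split; lra.
apply: le_trans (le_trans (card_lower_tail (p * #|E|%:R / 2) EV l4) _); last first.
  by rewrite ler_expR cE natrM; lra.
apply: (le_prob p01) => G GV /ltW h.
have -> : #|G :&: E|%:R = \sum_(v in S) #|nb G v :&: S'|%:R :> R.
  rewrite -natr_sum; congr (_%:R).
  have := sum_star_blocks G S' S => <-.
  have -> : G :&: E = (fun w : T * T => [set w.1; w.2]) @: [set w in setX S S' | [set w.1; w.2] \in G].
    apply/setP => e; apply/idP/imsetP => [|[w]].
      rewrite in_setI => /andP[eG /imsetP[w wS Ew]]; exists w => //.
      by rewrite inE wS -Ew.
    by rewrite inE => /andP[wS wG] ->; rewrite in_setI wG; apply: imset_f.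
  rewrite card_in_imset; last first.
    move=> w w'; rewrite in_set => /andP[wS _]; rewrite in_set => /andP[wS' _]; exact: injE.
  rewrite -(card_imset _ (f := fun w : T * T => (w.2, w.1))); last by case=> [u v] [u' v'] [-> ->].
  apply: eq_card => -[u v]; apply/imsetP/idP => [[[u' v']]|].
    by rewrite !inE /= => /andP[/andP[h1 h2] h3] [-> ->]; rewrite h1 h2 sub1set setUC.
  rewrite inE in_setX sub1set /= => /andP[/andP[h1 h2] h3]; exists (v, u) => //.
  by rewrite inE in_setX h1 h2 setUC.
by apply: le_trans h _; rewrite cE natrM; lra.
Qed.

(** The factor 2 appears because the sum sees each edge inside [L] from both ends. *)
Lemma inside_upper L (t : R) : 9 * (#|L|%:R ^+ 2 / 2) * p <= t ->
  pr (fun G => 2 * t <= \sum_(x in L) #|nb G x :&: L|%:R) <= expR (- t).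
Proof.
move=> ht.
pose B := [set e in vpairs T | e \subset L].
have HB H : H \subset vpairs T -> (\sum_(x in L) #|nb H x :&: L| = 2 * #|H :&: B|)%N.
  move=> HV; have HBV : H :&: B \subset vpairs T by rewrite (subset_trans (subsetIl _ _)).
  rewrite -(handshake HBV) [LHS]big_mkcond; apply: eq_bigr => x _.
  have E y : (y \in nb (H :&: B) x) = [&& x \in L, y \in nb H x & y \in L].
    rewrite !in_nb in_setI inE subUset !sub1set.
    case: (boolP (_ \in H)) => [/(subsetP HV) ->|] //=; last by rewrite andbF.
  case: ifP => xL; first by apply: eq_card => y; rewrite E xL in_setI.
  by apply/esym/eq_card0 => y; rewrite E xL.
have cB : #|B|%:R <= #|L|%:R ^+ 2 / 2 :> R.
  have := HB (vpairs T) (subxx _).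
  have -> : vpairs T :&: B = B by apply/setIidPr/subsetP => e; rewrite inE => /andP[].
  move=> h; rewrite ler_pdivlMr // mulrC -natrM -h -natrX ler_nat -mulnn -sum_nat_const.
  by apply: leq_sum => x _; rewrite subset_leq_card ?subsetIr.
have h := @blocks_tail R _ (vpairs T) p p01 _ B (fun e => [set e]) 1 t.
apply: le_trans (h _ _ _).
- apply: (le_prob p01) => G GV; rewrite -natr_sum HB // natrM ler_pM2l //.
  move=> h'; apply: le_trans h' _; rewrite ler_nat subset_leq_card //.
  by apply/subsetP => e; rewrite in_setI => /andP[eG eB]; rewrite inE eB sub1set.
- by move=> e; rewrite inE sub1set cards1 => /andP[].
- by move=> e e' _ _; rewrite disjoints1 inE.
rewrite expr1; apply: le_trans ht; case/andP: p01 => p0 _.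
by rewrite ler_wpM2r // ler_wpM2l.
Qed.

Definition matching (P : {set T * T}) : bool :=
  [forall w in P, (w.1 != w.2) && [forall w' in P, (w != w') ==> [disjoint [set w.1; w.2] & [set w'.1; w'.2]]]].

(** The blocks formed by w.1 u and w.2 u are disjoint over all w in [P] and u in [L], since [P] is a
    matching avoiding [L]; so the exponent grows with |P|. *)
Lemma matching_upper (P : {set T * T}) L (t : R) : matching P ->
  (forall w, w \in P -> (w.1 \notin L) && (w.2 \notin L)) ->
  9 * #|L|%:R * p ^+ 2 <= t ->
  pr (fun G => [forall w in P, t <= #|nb G w.1 :&: nb G w.2 :&: L|%:R]) <=
  expR (- (#|P|%:R * t)).
Proof.
move=> /forall_inP mP PL ht.
have h := @blocks_tail R _ (vpairs T) p p01 _ (setX P L)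
  (fun z => [set [set z.1.1; z.2]; [set z.1.2; z.2]]) 2 (#|P|%:R * t).
apply: le_trans (h _ _ _).
- apply: (le_prob p01) => G GV /forall_inP hG.
  rewrite mulr_natl -sumr_const.
  apply: le_trans (_ : (\sum_(w in P) #|nb G w.1 :&: nb G w.2 :&: L|)%:R <= _).
    by rewrite natr_sum; apply: ler_sum => w /hG.
  have -> : [set z in setX P L | [set [set z.1.1; z.2]; [set z.1.2; z.2]] \subset G] =
     [set z : T * T * T | (z.1 \in P) && (z.2 \in nb G z.1.1 :&: nb G z.1.2 :&: L)].
    apply/setP => -[w u]; rewrite in_set [RHS]in_set in_setX subUset !sub1set /= !in_setI !in_nb.
    by rewrite -andbA; congr andb; rewrite andbC.
  rewrite (card_rel (fun w u => (w \in P) && (u \in nb G w.1 :&: nb G w.2 :&: L))).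
  rewrite ler_nat [leqLHS]big_mkcond; apply: leq_sum => w _.
  by case: ifP => //= _; rewrite card_sum_in.
- move=> [w u]; rewrite in_setX /= => /andP[wP uL].
  have /andP[w1 w2] := PL w wP; have /andP[w12 _] := mP w wP.
  have nu v : v \notin L -> v != u by apply: contraNneq => ->.
  rewrite subUset !sub1set !in_vpairs !nu //; split=> //.
  rewrite cards2; case: eqP => // E; have : w.1 \in [set w.2; u] by rewrite -E set21.
  by rewrite !inE (negPf w12) (negPf (nu _ w1)).
- move=> [w u] [w' u']; rewrite !in_setX /= => /andP[wP uL] /andP[w'P u'L] ne.
  have /andP[w1 w2] := PL w wP; have /andP[w1' w2'] := PL w' w'P.
  rewrite disjoints_subset; apply/subsetP => e eb; rewrite inE; apply/negP => eb'.
  have [y yw Ey] : exists2 y, y \in [set w.1; w.2] & e = [set y; u].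
    by move: eb; rewrite !inE => /orP[]/eqP ->; [exists w.1; rewrite ?set21|exists w.2; rewrite ?set22].
  have [y' yw' Ey'] : exists2 y, y \in [set w'.1; w'.2] & e = [set y; u'].
    by move: eb'; rewrite !inE => /orP[]/eqP ->; [exists w'.1; rewrite ?set21|exists w'.2; rewrite ?set22].
  have yL : y \notin L by move: yw; rewrite !inE => /orP[]/eqP ->.
  have yu' : y != u' by apply: contraNneq yL => ->.
  have [yy uu] := edge_eq2 (etrans (esym Ey) Ey') yu'.
  have ww' : w != w' by apply: contraNneq ne => ->; rewrite uu.
  have /andP[_ /forall_inP/(_ w' w'P)/implyP/(_ ww')] := mP w wP.
  by rewrite disjoints_subset => /subsetP/(_ y yw); rewrite inE yy yw'.
rewrite cardsX natrM; case/andP: p01 => p0 _.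
have -> : 9 * (#|P|%:R * #|L|%:R) * p ^+ 2 = #|P|%:R * (9 * #|L|%:R * p ^+ 2) by ring.
by rewrite ler_wpM2l.
Qed.

Lemma maxcut_lipschitz (e : {set T}) :
  lipschitz_at e (fun G : {set {set T}} => (maxcut G)%:R : R).
Proof.
move=> G; have h1 : (maxcut (G :\ e) <= maxcut (e |: G))%N.
  apply/bigmax_leqP => A _; apply: leq_trans (maxcut_ge (e |: G) A).
  by rewrite card_setI_add leq_addr.
have h2 : (maxcut (e |: G) <= (maxcut (G :\ e)).+1)%N.
  apply/bigmax_leqP => A _; rewrite card_setI_add -addn1 leq_add ?leq_b1 //.
  exact: maxcut_ge.
by rewrite ger0_norm ?subr_ge0 ?ler_nat // lerBlDr addrC natr1 ler_nat.
Qed.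

(** A set containing every possible slot and not depending on [G]. *)
Definition slot_range (P : {set T * T}) : {set {set T}} :=
  [set e | [exists u : T * T, [exists v, [&& u \in P,
     [forall u' in P, (v != u'.1) && (v != u'.2)] & e == [set u.1; v]]]]].

Lemma slots_range P G : slots P G \subset slot_range P.
Proof.
apply/subsetP => e; rewrite !inE => /existsP[u /existsP[v /and4P[uP _ vP eE]]].
by apply/existsP; exists u; apply/existsP; exists v; rewrite uP vP.
Qed.

(** A slot w.1 z is none of the deciding pairs u.2 v: u.2 = w.1 contradicts the orientation, and u.2
    = z the choice of z outside the support. *)
Lemma slots_insensitive P e : oriented P -> e \in slot_range P ->
  insensitive e (slots P).
Proof.
move=> oP; rewrite inE => /existsP[w /existsP[z /and3P[wP /forall_inP zP /eqP ->]]] G.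
apply/setP => e'; rewrite !inE; apply: eq_existsb => u; apply: eq_existsb => v.
apply: andb_id2l => uP; congr (_ && _); rewrite !inE.
case: eqP => //= E; have : u.2 \in [set w.1; z] by rewrite -E set21.
rewrite !inE => /orP[/eqP uw|/eqP uz].
  by have := oP w u wP uP; rewrite uw eqxx.
by have := zP u uP; rewrite -uz eqxx andbF.
Qed.

Lemma slot_range_vpairs P : slot_range P \subset vpairs T.
Proof.
apply/subsetP => e; rewrite inE => /existsP[u /existsP[v /and3P[uP /forall_inP/(_ u uP)/andP[vu _] /eqP ->]]].
by rewrite in_vpairs eq_sym.
Qed.

(* If [A] witnesses the deficiency of the slots [S], then [maxcut G] is far below
   its conditional expectation given the pairs outside [S], because the edges of
   [S] across [A] are much fewer than expected. *)
Lemma deficient_prob (P : {set T * T}) : oriented P ->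
  pr (fun G => [exists A, deficient (n * p) (n * p ^+ 2) P G A]) <=
  expR (- (10 * (20 * 100)^-1 ^+ 2 * (n * p ^+ 2) * #|P|%:R)).
Proof.
(* The deviation m c / 100 is 20 lam m c, and there are at most 10 n p m slots, so the exponent is
   10 lam^2 c m - 20 lam^2 c m. *)
move=> oP; set m := #|P|%:R : R; set c := n * p ^+ 2; set lam : R := (20 * 100)^-1.
case/andP: (p01) => p0 p1.
have lam01 : 0 <= lam <= 3^-1 by rewrite /lam; apply/andP; split; lra.
have lam100 : 100^-1 = 20 * lam by rewrite /lam; field.
pose g (G : {set {set T}}) : R := (maxcut G)%:R.
pose few (S : {set {set T}}) := #|S|%:R <= 10 * (n * p) * m.
pose H (S G : {set {set T}}) := slots P G == S.
apply: le_trans (_ : \sum_(S : {set {set T}} | (S \subset slot_range P) && few S)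
    pr (fun G => H S G && (g G <= resamples p (enum S) g G - m * c / 100)) <= _).
  apply: (prob_union p01) => G GV /existsP[A /and4P[d1 d2 d3 d4]].
  exists (slots P G); first by rewrite slots_range.
  rewrite /H eqxx /=; set S := slots P G in d1 d2 d3 *.
  (* [A] bounds [maxcut] from below in every refreshed graph, so any witness [A] serves, without a
     union over cuts. *)
  have h : resamples p (enum S) (fun K => #|K :&: cut A|%:R) G <= resamples p (enum S) g G.
    by apply: le_resamples => // K; rewrite ler_nat maxcut_ge.
  rewrite resamples_card in h.
  have E : #|G :&: cut A|%:R = #|(G :\: S) :&: cut A|%:R + #|S :&: G :&: cut A|%:R :> R.
    rewrite -natrD -(cardsID S (G :&: cut A)) addnC; congr (_ + _)%:R.
      by apply: eq_card => e; rewrite !(in_setD, in_setI) andbA andbAC.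
    by apply: eq_card => e; rewrite !in_setI andbC andbA.
  have : p * (m * (n * p) / 48) <= p * #|S :&: cut A|%:R by rewrite ler_wpM2l.
  have -> : p * (m * (n * p) / 48) = m * c / 48 by rewrite /c; ring.
  have : 0 <= m * c by rewrite /m /c mulr_ge0 // mulr_ge0 // exprn_ge0.
  move: h d3 d4; rewrite E -/m -/c -/(g G).
  clear; lra.
apply: le_trans (_ : \sum_(S : {set {set T}} | (S \subset slot_range P) && few S)
   expR (- (10 * lam ^+ 2 * c * m)) * pr (H S) <= _).
  apply: ler_sum => S /andP[SP fS].
  apply: le_trans (lipschitz_tail (g := g) (H := H S) p01 (m * c / 100) lam01 _) _.
    move=> e eS; have er := subsetP SP e eS; split.
    - exact: (subsetP (slot_range_vpairs P)).
    - exact: maxcut_lipschitz.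
    - by move=> G; rewrite /H slots_insensitive.
  rewrite ler_wpM2r ?prob_ge0 // ler_expR.
  have h : p * lam ^+ 2 * #|S|%:R <= p * lam ^+ 2 * (10 * (n * p) * m).
    by rewrite ler_wpM2l // mulr_ge0 // exprn_ge0; case/andP: lam01.
  apply: le_trans (lerB h (lexx _)) _; rewrite lam100 /c.
  by rewrite le_eqVlt; apply/orP; left; apply/eqP; ring.
(* The events [H S] are disjoint, so the union over [S] costs nothing. *)
rewrite -mulr_sumr -[leRHS]mulr1 ler_wpM2l ?expR_ge0 //.
rewrite /prob -expect_sum -[leRHS](expect1 (vpairs T) p); apply: (le_expect p01) => G GV.
apply: le_trans (_ : \sum_(S : {set {set T}}) (H S G)%:R <= _).
  by rewrite [leRHS](bigID (fun S : {set {set T}} => (S \subset slot_range P) && few S)) lerDl sumr_ge0.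
rewrite (bigD1 (slots P G)) //= /H eqxx big1 ?addr0 // => S.
by rewrite eq_sym => /negPf ->.
Qed.

(** Weight [y] per element makes the sum over X at most 2 and the sum over nonempty Y at most 2 y
    |J|. *)
Lemma prob_pairs_of_sets (I J : finType) (y : R) (A : pred {set {set T}})
    (c : {set I} -> {set J} -> bool) (B : {set I} -> {set J} -> pred {set {set T}}) :
  0 <= y -> y * #|I|%:R <= 3^-1 -> y * #|J|%:R <= 3^-1 ->
  (forall G, G \subset vpairs T -> A G ->
     exists X Y, [/\ Y != set0, c X Y & B X Y G]) ->
  (forall X Y, Y != set0 -> c X Y -> pr (B X Y) <= y ^+ #|X| * y ^+ #|Y|) ->
  pr A <= 4 * (y * #|J|%:R).
Proof.
move=> y0 yI yJ hA hB.
apply: le_trans (prob_union (P := fun z : {set I} * {set J} => (z.2 != set0) && c z.1 z.2)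
   (B := fun z => B z.1 z.2) p01 _) _.
  by move=> G GV /(hA G GV)[X [Y [Y0 cY BY]]]; exists (X, Y); rewrite ?Y0.
apply: le_trans (_ : \sum_(z : {set I} * {set J} | z.2 != set0) y ^+ #|z.1| * y ^+ #|z.2| <= _).
  rewrite big_mkcondr /=; apply: ler_sum => z z0; case: ifP => [cz|_]; first exact: hB.
  by rewrite mulr_ge0 // exprn_ge0.
rewrite -(pair_big xpredT (fun Y : {set J} => Y != set0) (fun (X : {set I}) (Y : {set J}) => y ^+ #|X| * y ^+ #|Y|)) /=.
rewrite (eq_bigr (fun X : {set I} => y ^+ #|X| * \sum_(Y : {set J} | Y != set0) y ^+ #|Y|)); last first.
  by move=> X _; rewrite mulr_sumr.
rewrite -mulr_suml (bigD1 set0) //= cards0 expr0.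
have h1 := sum_expr_card_nonempty y0 yI; have h2 := sum_expr_card_nonempty y0 yJ.
have s1 : 0 <= \sum_(X : {set I} | X != set0) y ^+ #|X| by rewrite sumr_ge0 // => X _; rewrite exprn_ge0.
have s2 : 0 <= \sum_(X : {set J} | X != set0) y ^+ #|X| by rewrite sumr_ge0 // => X _; rewrite exprn_ge0.
move: h1 h2 s1 s2 yI yJ; set a := \sum_(_ | _) _; set b := \sum_(_ | _) _.
move: (y * _) (y * _) a b; clear => i j a b h1 h2 s1 s2 yI yJ.
apply: le_trans (_ : 2 * b <= _); last by lra.
by rewrite ler_wpM2r //; lra.
Qed.

End Events.

(** * Union bounds for the typical properties *)

Section UnionBounds.
Variables (R : realType) (T : finType) (p k : R).
Implicit Types (G F H W : {set {set T}}) (A C D L S : {set T}) (x y u v : T).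
Notation n := (#|T|%:R : R).
Notation pr := (prob (vpairs T) p).
Notation l := (ln n).
Notation h := (expR (- l)).
Hypotheses (p0 : 0 < p) (p1 : p <= 1) (n4 : 4 <= n) (l1 : 1 <= l) (kl : k * l <= n * p ^+ 2).

Let p01 : 0 <= p <= 1. Proof. by rewrite ltW. Qed.
Let n0 : 0 < n. Proof. by apply: lt_le_trans n4. Qed.
Let l0 : 0 <= l. Proof. by apply: le_trans l1. Qed.
Let c0 : 0 < n * p ^+ 2. Proof. by rewrite mulr_gt0 ?exprn_gt0. Qed.
Let a0 : 0 < n * p. Proof. by rewrite mulr_gt0. Qed.
Let ca : n * p ^+ 2 <= n * p.
Proof. by rewrite ler_pM2l // expr2 ler_piMr // ltW. Qed.
Let expl : expR l = n. Proof. by rewrite lnK. Qed.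
Let hE : h = n^-1. Proof. by rewrite expRN expl. Qed.

(** This is n^(-3): even for sets of ordered pairs the union bound then leaves y n^2 = 1 / n. *)
Notation y := (expR (- (3 * l))).
Let yn2 : y * (#|T| * #|T|)%:R = h.
Proof.
rewrite natrM -[in X in _ * (X * _)]expl -[in X in _ * (_ * X)]expl -!expRD.
by congr expR; ring.
Qed.
Let yn : y * n <= h.
Proof.
rewrite -yn2 natrM ler_pM2l ?expR_gt0 //.
by apply: ler_peMr; [exact: ltW|apply: le_trans n4; lra].
Qed.
Let h13 : h <= 3^-1.
Proof. by rewrite hE lef_pV2 ?posrE //; apply: le_trans n4; lra. Qed.

Lemma le_y_pow (i j : nat) (t : R) : 3 * l * (i%:R + j%:R) <= t ->
  expR (- t) <= y ^+ i * y ^+ j.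
Proof.
move=> ht; rewrite -exprD -expRM_natr ler_expR natrD mulNr lerN2.
exact: ht.
Qed.

Lemma prob_forall_vertices (B : T -> pred {set {set T}}) (t : R) :
  (forall x, pr (B x) <= expR (- t)) -> 2 * l <= t ->
  pr (fun G => `[< exists x, B x G >]) <= h.
Proof.
move=> hB ht; apply: le_trans (prob_union (P := xpredT) (B := B) p01 _) _.
  by move=> G _ /asboolP[x Bx]; exists x.
apply: le_trans (_ : \sum_(x : T) expR (- (2 * l)) <= _).
  by apply: ler_sum => x _; apply: le_trans (hB x) _; rewrite ler_expR lerN2.
rewrite sumr_const -[leLHS]mulr_natl -[X in X%:R * _]/#|T| -{1}expl -expRD ler_expR.
lra.
Qed.

Lemma max_degree_failure : 1 <= k ->
  pr (fun G => `[< exists x, 10 * (n * p) < #|nb G x|%:R >]) <= h.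
Proof.
move=> k1; apply: (prob_forall_vertices (fun x => degree_upper p01 x)).
have : 1 * l <= k * l by rewrite ler_wpM2r.
by move: kl ca l0; lra.
Qed.

Lemma min_degree_failure : 128 <= k ->
  pr (fun G => `[< exists x, #|nb G x|%:R < n * p / 2 >]) <= h.
Proof.
move=> k1; apply: (prob_forall_vertices (fun x => degree_lower p01 x n4)).
have : 128 * l <= k * l by rewrite ler_wpM2r.
by move: kl ca l0; lra.
Qed.

Lemma max_codegree_failure : 1 <= k ->
  pr (fun G => `[< exists x y, x != y /\ 10 * (n * p ^+ 2) < #|nb G x :&: nb G y|%:R >]) <= h.
Proof.
move=> k1; apply: le_trans (prob_union (P := fun z : T * T => z.1 != z.2)
   (B := fun z G => 10 * (n * p ^+ 2) < #|nb G z.1 :&: nb G z.2|%:R) p01 _) _.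
  by move=> G _ /asboolP[x [y [xy Bx]]]; exists (x, y).
apply: le_trans (_ : \sum_(z : T * T) y <= _).
  rewrite big_mkcond; apply: ler_sum => z _ /=; case: ifP => [zz|_]; last exact: expR_ge0.
  apply: le_trans (codegree_upper p01 zz) _; rewrite ler_expR lerN2.
  have : 1 * l <= k * l by rewrite ler_wpM2r.
  by move: kl l0; lra.
by rewrite sumr_const -[leLHS]mulr_natr -yn2 card_prod.
Qed.

(** A violating pair has at least |S| c b edges between its sets, with c = n p^2, nine times the
    mean or more. As |D| < |S| / b, the exponent |S| c b pays for both sets once k b^2 >= 6. *)
Lemma dominated_set_failure (q b : R) : 0 < b -> b <= 1 -> 6 <= k * b ^+ 2 -> 9 * (4 * q) * p <= n * p ^+ 2 * b ->
  pr (fun G => `[< exists D S, [/\ [disjoint D & S], #|D|%:R <= 4 * q,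
     (forall v, v \in S -> n * p ^+ 2 * b <= #|nb G v :&: D|%:R) & b * #|D|%:R < #|S|%:R] >]) <=
  4 * h.
Proof.
move=> b0 b1 kb hq.
apply: le_trans (prob_pairs_of_sets (I := T) (J := T) (y := y) p01
   (c := fun D S => [&& [disjoint D & S], #|D|%:R <= 4 * q & b * #|D|%:R < #|S|%:R])
   (B := fun D S G => #|S|%:R * (n * p ^+ 2 * b) <= \sum_(v in S) #|nb G v :&: D|%:R) _ _ _ _ _) _.
- exact: expR_ge0.
- exact: le_trans yn h13.
- exact: le_trans yn h13.
- move=> G GV /asboolP[D [S [h1 h2 h3 h4]]]; exists D, S; split; last first.
  + rewrite mulr_natl -sumr_const; exact: ler_sum.
  + by rewrite h1 h2 h4.
  + rewrite -card_gt0 -(ltr_nat R); apply: le_lt_trans h4; by rewrite mulr_ge0 // ltW.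
- move=> D S S0 /and3P[h1 h2 h3].
  apply: le_trans (bipartite_upper p01 h1 _) _.
    have : 9 * (#|D|%:R * #|S|%:R) * p <= #|S|%:R * (9 * (4 * q) * p).
      have : #|D|%:R * (#|S|%:R * p) <= 4 * q * (#|S|%:R * p).
        by rewrite ler_wpM2r // mulr_ge0 // ltW.
      by lra.
    by move/le_trans; apply; rewrite ler_wpM2l.
  apply: le_y_pow.
  have E : b * (3 * l * (#|D|%:R + #|S|%:R)) <= 6 * l * #|S|%:R.
    have : l * (b * #|D|%:R) <= l * #|S|%:R by rewrite ler_wpM2l // ltW.
    have : b * (l * #|S|%:R) <= 1 * (l * #|S|%:R) by rewrite ler_wpM2r // mulr_ge0.
    by lra.
  rewrite -(ler_pM2l b0); apply: le_trans E _.
  have : 6 * (l * #|S|%:R) <= k * b ^+ 2 * (l * #|S|%:R) by rewrite ler_wpM2r // mulr_ge0.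
  have : k * l * (b ^+ 2 * #|S|%:R) <= n * p ^+ 2 * (b ^+ 2 * #|S|%:R).
    by rewrite ler_wpM2r // mulr_ge0 // exprn_ge0 // ltW.
  by lra.
by rewrite ler_pM2l.
Qed.

(** The exponent p |S| |S'| / 16 is at least p q (|S| + |S'|) / 32, hence the constant 96, three
    times 32. *)
Lemma bipartite_density_failure (q : R) : 0 <= q -> 96 * l <= p * q ->
  pr (fun G => `[< exists S S', [/\ [disjoint S & S'], q <= #|S|%:R, q <= #|S'|%:R &
     \sum_(v in S) #|nb G v :&: S'|%:R < p * #|S|%:R * #|S'|%:R / 2] >]) <= 4 * h.
Proof.
move=> q0 hq.
apply: le_trans (prob_pairs_of_sets (I := T) (J := T) (y := y) p01
   (c := fun S S' => [&& [disjoint S & S'], q <= #|S|%:R & q <= #|S'|%:R])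
   (B := fun S S' G => \sum_(v in S) #|nb G v :&: S'|%:R < p * #|S|%:R * #|S'|%:R / 2) _ _ _ _ _) _.
- exact: expR_ge0.
- exact: le_trans yn h13.
- exact: le_trans yn h13.
- move=> G GV /asboolP[S [S' [h1 h2 h3 h4]]]; exists S, S'; split=> //; last by rewrite h1 h2 h3.
  apply: contraTneq h4 => ->; rewrite cards0 mulr0 mul0r -leNgt sumr_ge0 //.
- move=> S S' _ /and3P[h1 h2 h3].
  apply: le_trans (bipartite_lower p01 h1) _; apply: le_y_pow.
  have e1 : p * q * #|S'|%:R <= p * #|S|%:R * #|S'|%:R by rewrite ler_wpM2r // ler_pM2l.
  have e2 : p * q * #|S|%:R <= p * #|S|%:R * #|S'|%:R.
    by rewrite -[leRHS]mulrA [X in _ <= p * X]mulrC mulrA ler_wpM2r // ler_pM2l.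
  have : 96 * l * (#|S|%:R + #|S'|%:R) <= p * q * (#|S|%:R + #|S'|%:R) by rewrite ler_wpM2r // addr_ge0.
  by lra.
by rewrite ler_pM2l.
Qed.

Lemma small_set_density_failure (q lam : R) : 12 * l <= q -> 18 * lam * p <= q ->
  pr (fun G => `[< exists L, #|L|%:R <= lam /\
     #|L|%:R * (q / 2) < \sum_(x in L) #|nb G x :&: L|%:R >]) <= 4 * h.
Proof.
move=> ql hq.
(* Only one set varies, so the first one is fixed to be empty. *)
apply: le_trans (prob_pairs_of_sets (I := T) (J := T) (y := y) p01
   (c := fun D L => (D == set0) && (#|L|%:R <= lam))
   (B := fun D L G => 2 * (#|L|%:R * (q / 4)) <= \sum_(x in L) #|nb G x :&: L|%:R) _ _ _ _ _) _.
- exact: expR_ge0.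
- exact: le_trans yn h13.
- exact: le_trans yn h13.
- move=> G GV /asboolP[L [h1 h2]]; exists set0, L; split; last first.
  + by apply: le_trans (ltW h2); lra.
  + by rewrite eqxx.
  + by apply: contraTneq h2 => ->; rewrite cards0 mul0r big_set0 ltxx.
- move=> D L _ /andP[/eqP -> hL].
  apply: le_trans (inside_upper p01 _) _.
    have : #|L|%:R * p <= lam * p by rewrite ler_pM2r.
    move=> e; have : #|L|%:R * (18 * (#|L|%:R * p)) <= #|L|%:R * q.
      by rewrite ler_wpM2l //; lra.
    by lra.
  apply: le_y_pow; rewrite cards0 add0r.
  have : #|L|%:R * (12 * l) <= #|L|%:R * q by rewrite ler_wpM2l.
  by lra.
by rewrite ler_pM2l.
Qed.

(** As |L| < 2 |P| / rho, the exponent |P| tau also pays for the choice of [L]. *)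
Lemma codegree_matching_failure (lam tau rho : R) : 0 < rho -> rho <= 1 -> 9 * l <= rho * tau ->
  9 * lam * p ^+ 2 <= tau ->
  pr (fun G => `[< exists L (P : {set T * T}), [/\ #|L|%:R <= lam, matching P,
     (forall w, w \in P -> (w.1 \notin L) && (w.2 \notin L)),
     rho * #|L|%:R < 2 * #|P|%:R &
     (forall w, w \in P -> tau <= #|nb G w.1 :&: nb G w.2 :&: L|%:R)] >]) <= 4 * h.
Proof.
move=> r0 r1 ht hl.
apply: le_trans (prob_pairs_of_sets (I := T) (J := (T * T)%type) (y := y) p01
   (c := fun L P => [&& #|L|%:R <= lam, matching P,
      [forall w in P, (w.1 \notin L) && (w.2 \notin L)] & rho * #|L|%:R < 2 * #|P|%:R])
   (B := fun L P G => [forall w in P, tau <= #|nb G w.1 :&: nb G w.2 :&: L|%:R]) _ _ _ _ _) _.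
- exact: expR_ge0.
- exact: le_trans yn h13.
- by rewrite card_prod yn2.
- move=> G GV /asboolP[L [P [h1 h2 h3 h4 h5]]]; exists L, P; split; last first.
  + by apply/forall_inP.
  + by rewrite h1 h2 h4 andbT /=; apply/forall_inP.
  + by apply: contraTneq h4 => ->; rewrite cards0 mulr0 -leNgt mulr_ge0 // ltW.
- move=> L P _ /and4P[h1 h2 /forall_inP h3 h4].
  apply: le_trans (matching_upper p01 h2 h3 (t := tau) _) _.
    apply: le_trans hl; rewrite ler_wpM2r ?exprn_ge0 ?(ltW p0) // ler_wpM2l //.
  apply: le_y_pow; rewrite -(ler_pM2l r0).
  have e1 : l * (rho * #|L|%:R) <= l * (2 * #|P|%:R) by rewrite ler_wpM2l // ltW.
  have e2 : rho * (l * #|P|%:R) <= 1 * (l * #|P|%:R) by rewrite ler_wpM2r // mulr_ge0.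
  have e3 : #|P|%:R * (9 * l) <= #|P|%:R * (rho * tau) by rewrite ler_wpM2l.
  by lra.
by rewrite card_prod yn2.
Qed.

Lemma deficient_failure : 3 <= k * (10 * (20 * 100)^-1 ^+ 2) ->
  pr (fun G => `[< exists P A, [/\ P != set0, oriented P &
     deficient (n * p) (n * p ^+ 2) P G A] >]) <= 4 * h.
Proof.
move=> hk.
apply: le_trans (prob_pairs_of_sets (I := T) (J := (T * T)%type) (y := y) p01
   (c := fun D P => (D == set0) && `[< oriented P >])
   (B := fun D P G => [exists A, deficient (n * p) (n * p ^+ 2) P G A]) _ _ _ _ _) _.
- exact: expR_ge0.
- exact: le_trans yn h13.
- by rewrite card_prod yn2.
- move=> G GV /asboolP[P [A [h1 h2 h3]]]; exists set0, P; split=> //.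
    by rewrite eqxx; apply/asboolP.
  by apply/existsP; exists A.
- move=> D P _ /andP[/eqP -> /asboolP oP].
  apply: le_trans (deficient_prob p01 oP) _; apply: le_y_pow; rewrite cards0 add0r.
  rewrite ler_wpM2r //; have e0 : 0 <= 10 * (20 * 100)^-1 ^+ 2 :> R.
    by rewrite mulr_ge0 // exprn_ge0 // invr_ge0 mulr_ge0 ?ler0n.
  move: e0 hk; move: (10 * _) => e e0 hk.
  apply: le_trans (_ : k * e * l <= _); first by rewrite ler_wpM2r.
  by rewrite mulrAC mulrC ler_wpM2l.
by rewrite card_prod yn2.
Qed.

End UnionBounds.

(** * Concentration over containers and a lower bound on the maximum cut *)

Section StabilityEvents.
Variables (R : realType) (T : finType) (p : R).
Implicit Types (G F H W : {set {set T}}) (A C D L S : {set T}) (x y u v : T).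
Notation n := (#|T|%:R : R).
Notation pr := (prob (vpairs T) p).
Notation l := (ln n).
Notation h := (expR (- l)).

Lemma card_vpairs_le : 2 * #|vpairs T|%:R <= n ^+ 2.
Proof.
rewrite -natrM -handshake // -natrX ler_nat -mulnn -sum_nat_const.
by apply: leq_sum => x _; exact: max_card.
Qed.

(** With weight z = n^(-2) per pair, all sets together weigh at most exp(z n^2 / 2), and each small
    set weighs at least exp(-2 s l). *)
Lemma card_small_sets (s : R) : 4 <= n -> 0 <= s ->
  #|[set S in powerset (vpairs T) | #|S|%:R <= s]|%:R <= expR (2 * s * l + 1).
Proof.
move=> n4 s0; have n0 : 0 < n by apply: lt_le_trans n4.
have expl : expR l = n by rewrite lnK.
have l0 : 0 <= l by rewrite ln_ge0 //; apply: le_trans n4; lra.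
pose z := expR (- (2 * l)).
have zn : z * n ^+ 2 = 1.
  by rewrite expr2 -expl -!expRD -[RHS]expR0; congr expR; ring.
apply: le_trans (_ : \sum_(S in powerset (vpairs T)) z ^+ #|S| * expR (2 * s * l) <= _).
  rewrite -sum1_card natr_sum [leLHS]big_mkcond [leRHS]big_mkcond /=.
  apply: ler_sum => S _; rewrite inE; case: (S \in _) => //=.
  case: ifP => hS; last by rewrite mulr_ge0 ?expR_ge0 // exprn_ge0 // expR_ge0.
  rewrite -expRM_natr -expRD -[leLHS]expR0 ler_expR.
  have : #|S|%:R * l <= s * l by rewrite ler_wpM2r.
  by lra.
rewrite -mulr_suml sum_powerset [2 * s * l + 1]addrC expRD ler_wpM2r ?expR_ge0 //.
apply: le_trans (_ : expR z ^+ #|vpairs T| <= _).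
  apply: lerXn2r; rewrite ?nnegrE ?expR_ge0 ?addr_ge0 ?expR_ge0 //.
  exact: expR_ge1Dx.
rewrite -expRM_natr ler_expR.
have : z * (2 * #|vpairs T|%:R) <= z * n ^+ 2 by rewrite ler_pM2l ?expR_gt0 // card_vpairs_le.
have : 0 <= z * #|vpairs T|%:R by rewrite mulr_ge0 // expR_ge0.
by rewrite zn; lra.
Qed.

Lemma two_le_expR1 : 2 <= expR 1 :> R.
Proof. by apply: le_trans (expR_ge1Dx 1); lra. Qed.

Lemma card_containers_le (bn s : R) (r : nat) : 4 <= n -> 0 <= s ->
  #|containers T bn s r|%:R <= expR (r%:R * (2 * s * l + 2 * n * l + 3)).
Proof.
move=> n4 s0; have n0 : 0 < n by apply: lt_le_trans n4.
have expl : expR l = n by rewrite lnK.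
have l0 : 0 <= l by rewrite ln_ge0 //; apply: le_trans n4; lra.
have hd : #|descriptions T s|%:R <= expR (2 * s * l + 2 * n * l + 2).
  pose Sm := [set S in powerset (vpairs T) | #|S|%:R <= s].
  have sub : descriptions T s \subset setX (setX Sm [set: {ffun T -> option T}]) [set: bool].
    by apply/subsetP => -[[S f] b]; rewrite inE !in_setX !in_setT !andbT inE powersetE.
  have := subset_leq_card sub; rewrite !cardsX !cardsT card_bool card_ffun card_option.
  rewrite -(ler_nat R) !natrM => hh; apply: le_trans hh _.
  have -> : 2 * s * l + 2 * n * l + 2 = (2 * s * l + 1) + 2 * n * l + 1 by ring.
  rewrite !expRD ler_pM ?mulr_ge0 ?two_le_expR1 //.
  have hS : #|Sm|%:R <= expR (2 * s * l) * expR 1 by rewrite -expRD; exact: card_small_sets.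
  rewrite ler_pM ?hS //.
  rewrite natrX (_ : 2 * n * l = 2 * l * n); last by ring.
  rewrite expRM_natr; apply: lerXn2r; rewrite ?nnegrE ?expR_ge0 //.
  have -> : expR (2 * l) = n * n by rewrite mulr_natl mulr2n expRD expl.
  by rewrite -natr1; nra.
have hd1 : (#|descriptions T s|.+1)%:R <= expR (2 * s * l + 2 * n * l + 3).
  have -> : 2 * s * l + 2 * n * l + 3 = (2 * s * l + 2 * n * l + 2) + 1 by ring.
  rewrite expRD; set E := expR (_ + 2) in hd *.
  have E1 : 1 <= E.
    by rewrite -[leLHS]expR0 ler_expR !addr_ge0 ?mulr_ge0.
  have : E * 2 <= E * expR 1 by rewrite ler_pM2l ?two_le_expR1 ?expR_gt0.
  by rewrite -natr1; lra.
apply: le_trans (_ : ((#|descriptions T s|.+1) ^ r)%:R <= _).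
  by rewrite ler_nat card_containers.
by rewrite natrX mulrC expRM_natr; apply: lerXn2r; rewrite ?nnegrE ?expR_ge0.
Qed.

Hypotheses (p0 : 0 < p) (p1 : p <= 1) (n4 : 4 <= n).
Let p01 : 0 <= p <= 1. Proof. by rewrite ltW. Qed.

(** The Chernoff exponent (e^2 / 4) p n^2 outweighs the logarithm of the number of containers, n for
    the 2^n cuts, and a spare log n. *)
Lemma container_density_failure (bn s e : R) (r : nat) : 0 <= s -> 0 < e -> e <= 2^-1 ->
  r%:R * (2 * s * l + 2 * n * l + 3) + n + l <= e ^+ 2 / 4 * (n * (n * p)) ->
  pr (fun G => `[< exists W A, W \in containers T bn s r /\
     p * #|W :\: cut A|%:R + e * (n * (n * p)) <= #|G :&: (W :\: cut A)|%:R >]) <= h.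
Proof.
move=> s0 e0 e2 hr; have n0 : 0 < n by apply: lt_le_trans n4.
apply: le_trans (prob_union (P := fun z : {set {set T}} * {set T} => z.1 \in containers T bn s r)
   (B := fun z G => p * #|z.1 :\: cut z.2|%:R + e * (n * (n * p)) <= #|G :&: (z.1 :\: cut z.2)|%:R) p01 _) _.
  by move=> G _ /asboolP[W [A [h1 h2]]]; exists (W, A).
set E := expR (- (e ^+ 2 / 4 * (n * (n * p)))).
apply: le_trans (_ : \sum_(z : {set {set T}} * {set T} | z.1 \in containers T bn s r) E <= _).
  apply: ler_sum => -[W A] /= WC.
  have WV : W :\: cut A \subset vpairs T.
    by rewrite (subset_trans (subsetDl _ _)) // (containers_subset WC).
  have e3 : 0 <= e / 2 <= 3^-1 by apply/andP; split; lra.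
  apply: le_trans (card_upper_tail p01 _ WV e3) _; rewrite ler_expR.
  have h1 : #|W :\: cut A|%:R <= n ^+ 2.
    apply: le_trans card_vpairs_le; apply: le_trans (_ : #|vpairs T|%:R <= _).
      by rewrite ler_nat subset_leq_card.
    by have : 0 <= #|vpairs T|%:R :> R by []; lra.
  have : p * (e / 2) ^+ 2 * #|W :\: cut A|%:R <= p * (e / 2) ^+ 2 * n ^+ 2.
    by rewrite ler_wpM2l // mulr_ge0 ?(ltW p0) ?sqr_ge0.
  by rewrite !expr2; lra.
rewrite sumr_const.
have -> : #|[pred z : {set {set T}} * {set T} | z.1 \in containers T bn s r]| =
    (#|containers T bn s r| * 2 ^ #|T|)%N.
  have -> : (2 ^ #|T| = #|{set T}|)%N.
    by rewrite -(cardsT {set T}) -powersetT card_powerset cardsT.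
  rewrite -[#|{set T}|]cardsT -cardsX; apply: eq_card => -[W A].
  by rewrite in_setX in_setT andbT.
rewrite -[leLHS]mulr_natl natrM natrX.
apply: le_trans (_ : expR (r%:R * (2 * s * l + 2 * n * l + 3)) * expR n * E <= _).
  rewrite ler_wpM2r ?expR_ge0 // ler_pM ?card_containers_le ?exprn_ge0 //.
  rewrite -[n in expR n]mul1r expRM_natr; apply: lerXn2r; rewrite ?nnegrE ?expR_ge0 //.
  exact: two_le_expR1.
by rewrite -!expRD ler_expR; lra.
Qed.

(** The - 1 is needed for odd |T|, when the two halves differ by one vertex. *)
Lemma half_card_cut : exists A, n ^+ 2 - 1 <= 4 * #|cut A|%:R.
Proof.
have [A _ hA] := subset_of_card [set: T] (#|T|./2).
exists A; have cA : #|A| = #|T|./2 by rewrite hA cardsT; apply/minn_idPr; rewrite -divn2 leq_div.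
have : (#|setX A (~: A)| <= #|cut A|)%N.
  rewrite -(card_in_imset (f := fun z : T * T => [set z.1; z.2])).
    apply/subset_leq_card/subsetP => e /imsetP[[u v]]; rewrite in_setX inE /= => /andP[uA vA] ->.
    by rewrite in_cut uA (negPf vA).
  move=> [u v] [u' v']; rewrite !in_setX !inE /= => /andP[uA vA] /andP[u'A v'A] E.
  have uv' : u != v' by apply: contraNneq v'A => <-.
  by have [-> ->] := edge_eq2 E uv'.
rewrite cardsX; have := cardsC A; rewrite cA => hC hX.
have : (#|T| * #|T| <= 4 * #|cut A| + 1)%N.
  move: (odd_double_half #|T|) hC hX; move: #|~: A| #|cut A| #|T|; clear.
  move=> j m t; move: (odd t) (t./2) => b i; rewrite -addnn => <- hC hX; have E : j = (b + i)%N by move: hC; clear; lia.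
  by move: hX; rewrite E; clear; case: b => /=; nia.
by rewrite -(ler_nat R) natrD !natrM expr2 lerBlDr.
Qed.

Lemma half_cut_failure (e : R) : 0 < e -> e <= 1 -> 1 <= e * n -> l <= e ^+ 2 / 16 * (n * (n * p)) ->
  pr (fun G => (maxcut G)%:R < n * (n * p) / 4 - e * (n * (n * p))) <= h.
Proof.
move=> e0 e1 en hl; have n0 : 0 < n by apply: lt_le_trans n4.
have [A hA] := half_card_cut.
have l4 : 0 <= e / 4 <= 3^-1 by apply/andP; split; lra.
apply: le_trans (le_trans (card_lower_tail p01 (e / 2 * (n * (n * p))) (cut_vpairs A) l4) _); last first.
  rewrite ler_expR.
  have h1 : #|cut A|%:R <= n ^+ 2.
    apply: le_trans card_vpairs_le; apply: le_trans (_ : #|vpairs T|%:R <= _).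
      by rewrite ler_nat subset_leq_card // cut_vpairs.
    by have : 0 <= #|vpairs T|%:R :> R by []; lra.
  have : p * (e / 4) ^+ 2 * #|cut A|%:R <= p * (e / 4) ^+ 2 * n ^+ 2.
    by rewrite ler_wpM2l // mulr_ge0 ?(ltW p0) ?sqr_ge0.
  by move: hl; rewrite !expr2; lra.
apply: (le_prob p01) => G _ /ltW hG.
apply: le_trans (_ : (maxcut G)%:R <= _); first by rewrite ler_nat maxcut_ge.
apply: le_trans hG _.
have : p * (n ^+ 2 - 1) <= p * (4 * #|cut A|%:R) by rewrite ler_wpM2l // ltW.
have : p * 1 <= p * (e * n * n).
  have n1 : 1 <= n by apply: le_trans n4; rewrite ler1n.
  have en0 : 0 <= e * n by rewrite mulr_ge0 // ltW.
  by rewrite ler_wpM2l ?(ltW p0) // (le_trans en) // ler_peMr.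
by move: (ltW p0); rewrite !expr2; lra.
Qed.

End StabilityEvents.

(** * The bound on the failure probability *)

Section Assembly.
Variables (R : realType) (T : finType).
Implicit Types (G F H W : {set {set T}}) (A C D L S : {set T}) (x y u v : T).
Notation n := (#|T|%:R : R).
Notation l := (ln n).

Lemma cut_setT : cut [set: T] = set0.
Proof.
apply/setP => e; rewrite inE [RHS]inE setIT; apply/negP => /andP[].
by rewrite inE => /eqP ->.
Qed.

(** [F] has about p n^2 / 4 edges, nearly all in [W], so [W] has about n^2 / 4 pairs and
    [dense_stability] applies. The 9 e is e for F \ W, e for the deviation of [G] on W \ cut A, and
    7 e for the pairs of W \ cut A. *)
Lemma triangle_free_stability G F (p e : R) (r : nat) :
  (0 < #|T|)%N -> 0 < p -> p <= 1 -> 0 < e -> e <= 1 ->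
  G \subset vpairs T -> F \subset G -> triangle_free F ->
  (forall x, #|nb G x|%:R <= 10 * (n * p)) ->
  (forall x y, x != y -> #|nb G x :&: nb G y|%:R <= 10 * (n * p ^+ 2)) ->
  20 < r%:R * (e ^+ 3 / 16) ^+ 2 ->
  (forall W A, W \in containers T (e * n / 4) (20 * n / p) r ->
     #|G :&: (W :\: cut A)|%:R <= p * #|W :\: cut A|%:R + e * (n * (n * p))) ->
  n * (n * p) / 4 - e * (n * (n * p)) <= #|F|%:R ->
  exists A, #|F :\: cut A|%:R <= 9 * e * (n * (n * p)).
Proof.
move=> T0 p0 p1 e0 e1 GV FG tF deg cod hr hW hF.
have n0 : 0 < n by rewrite ltr0n.
(* The container process runs with bn = e n / 4, rr = r1 n p and at most 2 / p^2 greedy vertices,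
   whose stars have at most 20 n / p edges. This [r1] makes a refinement lose at most 2 e p edges of
   [F] per deleted pair. *)
pose r1 := e ^+ 3 / 16.
have r10 : 0 < r1 by rewrite divr_gt0 ?exprn_gt0.
have r1e : r1 <= e.
  rewrite ler_pdivrMr // exprSr mulrC ler_pM2l // expr2.
  by apply: le_trans (_ : 1 * 1 <= _); [apply: ler_pM => //; exact: ltW|lra].
have p2 : 0 < p ^- 2 by rewrite invr_gt0 exprn_gt0.
have p21 : 1 <= p ^- 2 by rewrite -[leLHS]invr1 lef_pV2 ?posrE ?exprn_gt0 // exprn_ile1 // ltW.
have [k hk1 hk2] : exists2 k : nat, p ^- 2 <= k%:R & k%:R <= 2 * p ^- 2 :> R.
  have /andP[t1 /ltW t2] := truncn_itv (ltW p2); exists (Num.truncn (p ^- 2)).+1 => //.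
  by rewrite -natr1 mulr_natl mulr2n lerD.
have pk : 1 <= p ^+ 2 * k%:R.
  by rewrite -[leLHS](mulfV (lt0r_neq0 (exprn_gt0 2 p0))) ler_pM2l ?exprn_gt0.
have VT := card_vpairs_le R T.
have a0 : 0 < n * p by rewrite mulr_gt0.
have H0 : 0 <= 10 * (n * p ^+ 2) by rewrite mulr_ge0 // mulr_ge0 // exprn_ge0 // ltW.
have H1 : 0 < r1 ^+ 2 * n * (n * p) ^+ 2 / 2 by rewrite divr_gt0 ?mulr_gt0 ?exprn_gt0.
have H2 : 2 * (r1 ^+ 2 * n ^+ 2 / 40) * (10 * (n * p ^+ 2)) <= r1 ^+ 2 * n * (n * p) ^+ 2 / 2.
  by rewrite le_eqVlt; apply/orP; left; apply/eqP; field.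
have H3 : 2 * (r1 ^+ 2 * n ^+ 2 / 40) * n <= k%:R * (r1 ^+ 2 * n * (n * p) ^+ 2 / 2).
  have e3 : 0 <= r1 ^+ 2 * n ^+ 3 by rewrite mulr_ge0 ?sqr_ge0 ?exprn_ge0 // ltW.
  have : r1 ^+ 2 * n ^+ 3 * 1 <= r1 ^+ 2 * n ^+ 3 * (p ^+ 2 * k%:R) by rewrite ler_wpM2l.
  by move: e3; rewrite !exprS !expr0; lra.
have H4 : k%:R * (10 * (n * p)) <= 20 * n / p.
  have -> : 20 * n / p = 2 * p ^- 2 * (10 * (n * p)) by field; rewrite lt0r_neq0.
  by rewrite ler_wpM2r // mulr_ge0 // ltW.
have H5 : 0 < r1 * (n * p) by rewrite mulr_gt0.
have H6 : 0 <= e * n / 4 by rewrite divr_ge0 // mulr_ge0 // ltW.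
have H7 : r1 ^+ 2 * n ^+ 2 / 40 <= e ^+ 2 * n ^+ 2 / 16.
  have : r1 ^+ 2 * n ^+ 2 <= e ^+ 2 * n ^+ 2.
    by rewrite ler_wpM2r ?sqr_ge0 //; apply: lerXn2r; rewrite ?nnegrE // ltW.
  have : 0 <= r1 ^+ 2 * n ^+ 2 by rewrite mulr_ge0 ?sqr_ge0.
  lra.
have H8 : 2 * n ^+ 2 * (e ^+ 2 * n ^+ 2 / 16) <= (e * n ^+ 3 - 2 * (e * n / 4) * n ^+ 2) * (e * n / 4).
  by rewrite le_eqVlt; apply/orP; left; apply/eqP; field.
have H9 : n * (r1 * (n * p)) ^+ 2 + 2 * (r1 ^+ 2 * n * (n * p) ^+ 2 / 2) <=
    r1 * (n * p) * (e ^+ 3 * n * (n * p) / 8).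
  by rewrite le_eqVlt; apply/orP; left; apply/eqP; rewrite /r1; field.
have H10 : e ^+ 3 * n * (n * p) / 8 <= 2 * e * p * (e ^+ 2 * n ^+ 2 / 16).
  by rewrite le_eqVlt; apply/orP; left; apply/eqP; field.
have H11 : 0 <= 20 * n / p by rewrite divr_ge0 ?mulr_ge0 // ltW.
have H12 : 0 <= 2 * e * p by rewrite mulr_ge0 // ?mulr_ge0 // ltW.
have H13 : #|vpairs T|%:R < r%:R * (r1 ^+ 2 * n ^+ 2 / 40).
  have : 20 * n ^+ 2 < r%:R * r1 ^+ 2 * n ^+ 2 by rewrite ltr_pM2r ?exprn_gt0.
  by move: VT; lra.
have [W WC [tW FW]] := container_of_triangle_free T0 GV FG tF cod H0 deg H1 H2 H3 H4 H5 H6 H7 H8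
  H9 H10 H11 H12 H13.
have WV := containers_subset WC.
have [A hA] := dense_stability R T0 WV.
have FGW (B : {set T}) : #|F :\: cut B|%:R <= #|F :\: W|%:R + #|G :&: (W :\: cut B)|%:R :> R.
  rewrite -natrD ler_nat; apply: leq_trans (leq_card_setU _ _).
  apply/subset_leq_card/subsetP => d; rewrite in_setU !(in_setI, in_setD) => /andP[dB dF].
  by rewrite dB dF (subsetP FG) //=; case: (d \in W).
have FW' : #|F :\: W|%:R <= e * (n * (n * p)).
  apply: le_trans FW _; have : e * p * (2 * #|vpairs T|%:R) <= e * p * n ^+ 2.
    by rewrite ler_wpM2l // mulr_ge0 // ltW.
  by rewrite expr2; lra.
(* The trivial cut, crossed by no pair, turns the density bound into one on |W| itself. *)
have hw : n * (n * p) / 4 <= p * #|W|%:R + 3 * e * (n * (n * p)).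
  have := FGW [set: T]; have := hW W [set: T] WC; rewrite cut_setT !setD0.
  by move: FW' hF; lra.
have w2 : 2 * #|W|%:R <= n ^+ 2.
  by apply: le_trans VT; rewrite ler_pM2l // ler_nat subset_leq_card.
exists A; apply: le_trans (FGW A) _; have := hW W A WC.
suff : p * #|W :\: cut A|%:R <= 7 * e * (n * (n * p)) by move: FW'; lra.
rewrite -(ler_pM2l (exprn_gt0 2 n0)).
have w0 : 0 <= #|W|%:R :> R by [].
have q1 : p * (n ^+ 2 * #|W :\: cut A|%:R) <=
    p * (n * (triangles W)%:R + (n ^+ 2 - 4 * #|W|%:R) * #|W|%:R) by rewrite ler_pM2l.
have q2 : p * n * (triangles W)%:R <= p * n * (e * n ^+ 3) by rewrite ler_pM2l ?mulr_gt0 // ltW.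
have q3 : (p * (n ^+ 2 - 4 * #|W|%:R)) * #|W|%:R <= (12 * e * (n * (n * p))) * #|W|%:R.
  by rewrite ler_wpM2r //; move: hw; rewrite expr2; lra.
have q4 : 6 * e * (n * (n * p)) * (2 * #|W|%:R) <= 6 * e * (n * (n * p)) * n ^+ 2.
  by rewrite ler_wpM2l // !mulr_ge0 // ltW.
by move: q1 q2 q3 q4; rewrite !exprS !expr0; lra.
Qed.

(** The support of a largest matching of pairs with high codegree meets every such pair, since a
    pair avoiding it could be added. *)
Lemma matching_cover G L (tau rho : R) :
  (forall P : {set T * T}, matching P ->
     (forall w, w \in P -> (w.1 \notin L) && (w.2 \notin L)) ->
     (forall w, w \in P -> tau <= #|nb G w.1 :&: nb G w.2 :&: L|%:R) ->
     2 * #|P|%:R <= rho * #|L|%:R) ->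
  exists2 C : {set T}, #|C|%:R <= rho * #|L|%:R &
    forall u v, u != v -> u \notin L -> v \notin L -> u \notin C -> v \notin C ->
     #|nb G u :&: nb G v :&: L|%:R <= tau.
Proof.
move=> hP.
pose M (P : {set T * T}) := [&& matching P, [forall w in P, (w.1 \notin L) && (w.2 \notin L)] &
  [forall w in P, tau <= #|nb G w.1 :&: nb G w.2 :&: L|%:R]].
have M0 : M set0 by rewrite /M; apply/and3P; split; apply/forall_inP => w; rewrite inE.
have [P /and3P[mP /forall_inP PL /forall_inP Pt] Pmax] := arg_maxnP (fun P : {set T * T} => #|P|) M0.
exists ((fst @: P) :|: (snd @: P)).
  apply: le_trans (hP P mP PL Pt); rewrite -natrM ler_nat.
  apply: leq_trans (leq_card_setU _ _) _.
  by rewrite mul2n -addnn leq_add // leq_imset_card.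
move=> u v uv uL vL; rewrite !in_setU !negb_or => /andP[u1 u2] /andP[v1 v2].
rewrite leNgt; apply/negP => ht.
have nP z w : w \in P -> z \notin fst @: P -> z \notin snd @: P -> z \notin [set w.1; w.2].
  move=> wP z1 z2; rewrite !inE negb_or; apply/andP; split.
    by apply: contraNneq z1 => ->; exact: imset_f.
  by apply: contraNneq z2 => ->; exact: imset_f.
have uvP : (u, v) \notin P.
  by apply: contra u1 => uvP; apply/imsetP; exists (u, v).
have dis w : w \in P -> [disjoint [set u; v] & [set w.1; w.2]].
  move=> wP; rewrite disjoints_subset; apply/subsetP => z; rewrite in_setC !inE.
  by move=> /orP[]/eqP ->; have := nP _ w wP; [move/(_ u u1 u2)|move/(_ v v1 v2)]; rewrite !inE.
have MuP : M ((u, v) |: P).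
  apply/and3P; split; apply/forall_inP => w; rewrite in_setU1 => /predU1P[->|wP] /=.
  - rewrite uv; apply/forall_inP => w'; rewrite in_setU1 => /predU1P[->|w'P]; first by rewrite eqxx.
    by rewrite dis // implybT.
  - have /andP[-> /forall_inP hw] := forall_inP mP w wP.
    apply/forall_inP => w'; rewrite in_setU1 => /predU1P[->|w'P] /=; last exact: hw.
    by rewrite disjoint_sym dis // implybT.
  - by rewrite uL vL.
  - exact: PL.
  - exact: ltW.
  - exact: Pt.
by have := Pmax _ MuP; rewrite /= cardsU1 uvP add1n ltnn.
Qed.

End Assembly.

(** * The failure probability for given constants *)

Section Failure.
Variables (R : realType) (T : finType).
Notation n := (#|T|%:R : R).
Notation l := (ln n).

(** Five bad events have probability at most 1 / n and five at most 4 / n, which makes 25 / n. *)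
Lemma failure_prob_of_constants (p k th t0 rho lamc e b : R) (r : nat) :
  4 <= n -> 1 <= l -> 1 <= e * n -> 0 < p -> p <= 1 -> k * l <= n * p ^+ 2 ->
  0 < th -> th <= (480 * 800)^-1 -> 36 * th <= b -> b = (80 * 100)^-1 ->
  400 * t0 = th ^+ 2 -> 800 * rho = th ^+ 2 -> 0 < t0 -> 0 < rho -> rho <= 1 ->
  9 * lamc = t0 -> 18 * lamc <= th -> 9 * e = lamc * th -> 0 < e -> e <= 2^-1 ->
  20 < r%:R * (e ^+ 3 / 16) ^+ 2 ->
  128 <= k -> 1 <= k / 800 -> 6 <= k * b ^+ 2 -> 96 <= k * th -> 9 <= k * (t0 * rho) ->
  3 <= k * (10 * (20 * 100)^-1 ^+ 2) -> 45 * r%:R + 2 <= k * (e ^+ 2 / 4) ->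
  1 <= k * (e ^+ 2 / 16) ->
  prob (vpairs T) p (fun G => ~~ all_max_triangle_free_bipartite G) <= 25 * expR (- l).
Proof.
move=> n4 l1 en p0 p1 kl th0 th1 thb bE t0E rhoE t00 rho0 rho1 lamE lamth eE e0 e2 hr.
move=> k128 k800 kb kth kt kd kr ke.
have p01 : 0 <= p <= 1 by rewrite ltW.
have n0 : 0 < n by apply: lt_le_trans n4.
have T0 : (0 < #|T|)%N by rewrite -(ltr0n R).
have l0 : 0 < l by apply: lt_le_trans l1.
have c0 : 0 < n * p ^+ 2 by rewrite mulr_gt0 ?exprn_gt0.
have a0 : 0 < n * p by rewrite mulr_gt0.
have ca : n * p ^+ 2 <= n * p by rewrite ler_pM2l // expr2 ler_piMr // ltW.
have k0 : 0 < k by apply: lt_le_trans k128.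
have k1 : 1 <= k by apply: le_trans k128; rewrite ler1n.
have e1 : e <= 1 by move: e2; clear; lra.
have n1 : 1 <= n by apply: le_trans n4; rewrite ler1n.
pose a := n * p; pose c := n * p ^+ 2; pose q := th * a; pose tau := t0 * c.
pose lam := lamc * n; pose s := 20 * n / p.
have kl' : k * l <= a by apply: le_trans ca.
have aN : a <= n * a by rewrite ler_peMl // ltW.
have q0 : 0 < q by rewrite mulr_gt0.
have E1 := max_degree_failure p0 p1 n4 l1 kl k1.
have E2 := min_degree_failure p0 p1 n4 l1 kl k128.
have E3 := max_codegree_failure p0 p1 n4 l1 kl k1.
have b0 : 0 < b by rewrite bE invr_gt0 -natrM ltr0n.
have b1 : b <= 1 by rewrite bE -[leRHS]invr1 lef_pV2 ?posrE -?natrM ?ltr0n // ler1n.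
have H4 : 9 * (4 * q) * p <= c * b.
  have -> : 9 * (4 * q) * p = c * (36 * th) by rewrite /q /a /c; ring.
  by rewrite ler_pM2l.
have pq : p * q = c * th by rewrite /q /a /c; ring.
have thc : 96 * l <= c * th.
  have : 96 * l <= k * th * l by rewrite ler_pM2r.
  have : k * l * th <= c * th by rewrite ler_pM2r.
  by clear; lra.
have H5 : 96 * l <= p * q by rewrite pq.
have cq : c * th <= q by rewrite /q mulrC ler_pM2l.
have H6 : 12 * l <= q by apply: le_trans cq; apply: le_trans thc; rewrite ler_pM2r // ler_nat.
have H6' : 18 * lam * p <= q.
  have -> : 18 * lam * p = 18 * lamc * a by rewrite /lam /a; ring.
  by rewrite ler_pM2r.
have H7 : 9 * l <= rho * tau.
  have : 9 * l <= k * (t0 * rho) * l by rewrite ler_pM2r.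
  have : k * l * (t0 * rho) <= c * (t0 * rho) by rewrite ler_pM2r ?mulr_gt0.
  by rewrite /tau; clear; lra.
have H7' : 9 * lam * p ^+ 2 <= tau by rewrite /tau -lamE /lam /c le_eqVlt; apply/orP; left; apply/eqP; ring.
have s0 : 0 <= s by rewrite divr_ge0 ?mulr_ge0 // ltW.
have H9 : r%:R * (2 * s * l + 2 * n * l + 3) + n + l <= e ^+ 2 / 4 * (n * a).
  rewrite -(ler_pM2l k0).
  (* As k l <= n p^2, the cost s l = (20 n / p) l of describing the container is at most 20 p n^2 /
     k. *)
  have w1 : k * (s * l) <= 20 * (n * a).
    have -> : k * (s * l) = 20 * n / p * (k * l) by rewrite /s; ring.
    have -> : 20 * (n * a) = 20 * n / p * (n * p ^+ 2) by rewrite /a; field; rewrite lt0r_neq0.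
    by rewrite ler_wpM2l.
  have w2 : k * (n * l) <= n * a by rewrite mulrCA ler_pM2l.
  have w3 : k * 1 <= k * (n * l).
    by rewrite ler_pM2l // -[leLHS]mulr1; apply: ler_pM.
  have w4 : k * n <= k * (n * l) by rewrite ler_pM2l // ler_peMr // ltW.
  have w5 : k * l <= k * (n * l) by rewrite ler_pM2l // ler_peMl // ltW.
  have w6 : r%:R * (k * (2 * s * l + 2 * n * l + 3)) <= r%:R * (45 * (n * a)).
    by rewrite ler_wpM2l //; move: w1 w2 w3; clear; lra.
  have w7 : (45 * r%:R + 2) * (n * a) <= k * (e ^+ 2 / 4) * (n * a) by rewrite ler_pM2r // mulr_gt0.
  by move: w2 w4 w5 w6 w7; clear; lra.
have H10 : l <= e ^+ 2 / 16 * (n * a).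
  have w1 : k * l <= n * a by apply: le_trans kl' aN.
  have w2 : 1 * l <= k * (e ^+ 2 / 16) * l by rewrite ler_pM2r.
  have w3 : e ^+ 2 / 16 * (k * l) <= e ^+ 2 / 16 * (n * a).
    by rewrite ler_wpM2l // divr_ge0 ?sqr_ge0.
  by move: w2 w3; clear; lra.
have E4 := dominated_set_failure p0 p1 n4 l1 kl b0 b1 kb H4.
have E5 := bipartite_density_failure p0 p1 n4 (ltW q0) H5.
have E6 := small_set_density_failure p0 p1 n4 H6 H6'.
have E7 := codegree_matching_failure p0 p1 n4 l1 rho0 rho1 H7 H7'.
have E8 := deficient_failure p0 p1 n4 l1 kl kd.
have E9 := container_density_failure p0 p1 n4 (e * n / 4) s0 e0 e2 H9.
have E10 := half_cut_failure p0 p1 n4 e0 e1 en H10.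
have or2 (B C : pred {set {set T}}) (x y : R) : prob (vpairs T) p B <= x ->
    prob (vpairs T) p C <= y -> prob (vpairs T) p (fun G => B G || C G) <= x + y.
  by move=> hB hC; apply: le_trans (prob_union2 p01 _) (lerD hB hC).
have E := or2 _ _ _ _ E1 (or2 _ _ _ _ E2 (or2 _ _ _ _ E3 (or2 _ _ _ _ E4 (or2 _ _ _ _ E5
  (or2 _ _ _ _ E6 (or2 _ _ _ _ E7 (or2 _ _ _ _ E8 (or2 _ _ _ _ E9 E10)))))))).
apply: le_trans (le_trans (le_prob p01 _) E) _; last first.
  by move: (expR _) => i; clear; lra.
have nas (P : Prop) : ~~ `[< P >] -> ~ P by move=> /negP h hP; apply: h; apply/asboolP.
move=> G GV; apply: contraNT.
move=> /norP[/nas B1 /norP[/nas B2 /norP[/nas B3 /norP[/nas B4 /norP[/nas B5]]]]].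
move=> /norP[/nas B6 /norP[/nas B7 /norP[/nas B8 /norP[/nas B9 B10]]]].
have degu x : #|nb G x|%:R <= 10 * a by rewrite leNgt; apply/negP => h; apply: B1; exists x.
have degl x : a / 2 <= #|nb G x|%:R by rewrite leNgt; apply/negP => h; apply: B2; exists x.
have cod x y : x != y -> #|nb G x :&: nb G y|%:R <= 10 * c.
  by move=> xy; rewrite leNgt; apply/negP => h; apply: B3; exists x, y.
apply/forallP => F; apply/implyP => Fmax.
have /and3P[FG tF _] := Fmax.
apply: (@bipartite_of_regular R T G F p a c q lam tau rho (9 * e * (n * a))) => //.
- by rewrite /c /a; ring.
- by rewrite /q mulrC ler_pM2l.
- apply: le_trans k800 _; rewrite ler_wpM2r ?invr_ge0 ?ler0n //.
  by apply: le_trans (_ : k * l <= _) => //; apply: ler_peMr => //; exact: ltW.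
- exact: mulr_gt0.
- have -> : 400 * a * tau = 400 * t0 * (a * c) by rewrite /tau; ring.
  by rewrite t0E le_eqVlt; apply/orP; left; apply/eqP; rewrite /q /a /c; ring.
- exact: ltW.
- by rewrite rhoE -(exprMn _ th).
- by rewrite eE /lam /q le_eqVlt; apply/orP; left; apply/eqP; ring.
- move=> D S h1 h2 h3; rewrite -bE leNgt; apply/negP => h; apply: B4; exists D, S; split=> //.
  by rewrite bE.
- move=> S S' h1 h2 h3; rewrite leNgt; apply/negP => h; apply: B5; exists S, S'; split=> //.
- by move=> L h; rewrite leNgt; apply/negP => h'; apply: B6; exists L.
- move=> L h; apply: matching_cover => P mP PL Pt.
  by rewrite leNgt; apply/negP => h'; apply: B7; exists L, P; split.
- move=> P A h1 h2; apply/negP => h3; apply: B8; exists P, A; split=> //.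
- apply: (@triangle_free_stability R T G F p e r) => //.
  + move=> W A WC; rewrite leNgt; apply/negP => h; apply: B9; exists W, A; split=> //.
    exact: ltW.
  + apply: le_trans (_ : (maxcut G)%:R <= _); first by rewrite leNgt.
    by rewrite ler_nat max_triangle_free_ge_maxcut.
Qed.

End Failure.

(** * Choice of the constants and the limit *)

Section Main.
Variable R : realType.

Lemma common_upper_bound (s : seq R) : exists k, forall x, x \in s -> x <= k.
Proof.
elim: s => [|y s [k hk]]; first by exists 0.
exists (Num.max y k) => x; rewrite inE le_max => /orP[/eqP ->|/hk ->]; rewrite ?lexx ?orbT //.
Qed.

Lemma failure_prob : exists k n0 : R, 1 <= k /\ forall (T : finType) (p : R),
  n0 <= #|T|%:R -> 0 < p -> p <= 1 -> k * ln #|T|%:R <= #|T|%:R * p ^+ 2 ->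
  prob (vpairs T) p (fun G => ~~ all_max_triangle_free_bipartite G)
    <= 25 * expR (- ln #|T|%:R).
Proof.
(* Constants are fixed in the order b, th, then t0, rho, lamc, e, then r, and k last of all. The 48
   makes [th] exactly 1 / (480 * 800). *)
pose b : R := (80 * 100)^-1; pose th := b / 48.
have b0 : 0 < b by rewrite invr_gt0 -natrM ltr0n.
have b1 : b <= 1 by rewrite -[leRHS]invr1 lef_pV2 ?posrE -?natrM ?ltr0n // ler1n.
have thE : th <= (480 * 800)^-1.
  rewrite /th /b -invfM le_eqVlt; apply/orP; left; apply/eqP; congr (_^-1); ring.
have th0 : 0 < th by rewrite divr_gt0.
have thb : 36 * th <= b by rewrite /th; move: b0; generalize b => x; clear; lra.
have th1 : th <= 48^-1 by rewrite /th; move: b1; generalize b => x; clear; lra.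
have bE : b = (80 * 100)^-1 by [].
clearbody th; clearbody b.
pose t0 := th ^+ 2 / 400; pose rho := t0 / 2; pose lamc := t0 / 9; pose e := lamc * th / 9.
have t00 : 0 < t0 by rewrite divr_gt0 ?ltr0n ?exprn_gt0.
have rho0 : 0 < rho by rewrite divr_gt0.
have lam0 : 0 < lamc by rewrite divr_gt0.
have e0 : 0 < e by rewrite divr_gt0 // mulr_gt0.
have th2 : th ^+ 2 <= th by rewrite expr2 ler_piMr ?(ltW th0) //; move: th1; clear; lra.
have t0E : 400 * t0 = th ^+ 2 by rewrite mulrC divfK ?pnatr_eq0.
have rhoE : 800 * rho = th ^+ 2 by rewrite -t0E /rho; field.
have t01 : t0 <= th.
  by move: t0E th2 t00; clear; lra.
have rho1 : rho <= 1 by move: rhoE th2 rho0 th1; clear; lra.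
have lamE : 9 * lamc = t0 by rewrite mulrC divfK.
have eE : 9 * e = lamc * th by rewrite mulrC divfK.
have lamth : 18 * lamc <= th by move: lamE t0E th2 t00; clear; lra.
have lamc1 : lamc <= 1 by move: lamth th1 lam0; clear; lra.
have e2 : e <= 2^-1.
  have : lamc * th <= 1 * th by rewrite ler_pM2r.
  by move: eE th1; clear; lra.
clearbody t0 rho lamc e.
pose d : R := (20 * 100)^-1.
have d0 : 0 < d by rewrite invr_gt0 mulr_gt0.
have [r hr] : exists r : nat, 20 < r%:R * (e ^+ 3 / 16) ^+ 2.
  have x0 : 0 < (e ^+ 3 / 16) ^+ 2 by rewrite exprn_gt0 // divr_gt0 // exprn_gt0.
  by exists (Num.truncn (20 / (e ^+ 3 / 16) ^+ 2)).+1; rewrite -ltr_pdivrMr // truncnS_gt.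
have [k hk] := common_upper_bound [:: 1; 128; 800; 6 / b ^+ 2; 96 / th; 9 / (t0 * rho);
  3 / (10 * d ^+ 2); (45 * r%:R + 2) / (e ^+ 2 / 4); 1 / (e ^+ 2 / 16)].
have {}hk i h := hk _ (mem_nth 0 (n := i) h).
(* The three summands ensure |T| >= 4, ln |T| >= 1 and e |T| >= 1. *)
exists k, (4 + expR 1 + e^-1); split; first exact: (hk 0%N isT).
move=> T p hn p0 p1 kl.
have ei : 0 < e^-1 by rewrite invr_gt0.
have E1 := expR_gt0 (1 : R).
have n4 : 4 <= #|T|%:R :> R by apply: le_trans hn; rewrite -addrA lerDl addr_ge0 // ltW.
have n0 : 0 < #|T|%:R :> R by apply: lt_le_trans n4.
have l1 : 1 <= ln (#|T|%:R : R).
  rewrite -[leLHS]expRK ler_ln ?posrE //; apply: le_trans hn.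
  by rewrite addrAC lerDr addr_ge0 // ltW.
have en : 1 <= e * #|T|%:R.
  by rewrite mulrC -ler_pdivrMr // div1r; apply: le_trans hn; rewrite lerDr addr_ge0 // ltW.
have z : 0 < 800 :> R by rewrite ltr0n.
have k800 : 1 <= k / 800 by rewrite (ler_pdivlMr _ _ z) mul1r; exact: (hk 2%N isT).
have kb : 6 <= k * b ^+ 2 by rewrite -ler_pdivrMr ?exprn_gt0 //; exact: (hk 3%N isT).
have kth : 96 <= k * th by rewrite -ler_pdivrMr //; exact: (hk 4%N isT).
have kt : 9 <= k * (t0 * rho) by rewrite -ler_pdivrMr ?mulr_gt0 //; exact: (hk 5%N isT).
have kd : 3 <= k * (10 * d ^+ 2).
  by rewrite -ler_pdivrMr ?mulr_gt0 ?exprn_gt0 //; exact: (hk 6%N isT).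
have kr : 45 * r%:R + 2 <= k * (e ^+ 2 / 4).
  by rewrite -ler_pdivrMr ?divr_gt0 ?exprn_gt0 //; exact: (hk 7%N isT).
have ke : 1 <= k * (e ^+ 2 / 16).
  by rewrite -ler_pdivrMr ?divr_gt0 ?exprn_gt0 //; exact: (hk 8%N isT).
exact: (failure_prob_of_constants n4 l1 en p0 p1 kl th0 thE thb bE t0E rhoE t00 rho0 rho1 lamE
  lamth eE e0 e2 hr (hk 1%N isT) k800 kb kth kt kd kr ke).
Qed.

Lemma gnp_probE (n : nat) (p : R) (A : pred {set {set 'I_n}}) :
  gnp_prob p A = prob (vpairs 'I_n) p A.
Proof.
rewrite /gnp_prob /prob /expect big_mkcondr; apply: eq_bigr => G _.
by case: (A G); rewrite ?mulr1 ?mulr0.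
Qed.

(** Squaring gives n p^2 >= k^2 log n, and k >= 1 allows weakening k^2 to k. *)
Lemma sqr_threshold (k p : R) (n : nat) : 1 <= k -> (1 < n)%N ->
  k * n%:R `^ (- 2^-1) * ln n%:R `^ 2^-1 < p -> 0 < p /\ k * ln n%:R <= n%:R * p ^+ 2.
Proof.
move=> k1 n1; set x := _ `^ _; set y := _ `^ _ => kp.
have n0 : 0 < n%:R :> R by rewrite ltr0n ltnW.
have l0 : 0 < ln (n%:R : R) by rewrite ln_gt0 // ltr1n.
have k0 : 0 < k by apply: lt_le_trans k1.
have x0 : 0 < x by rewrite powR_gt0.
have y0 : 0 < y by rewrite powR_gt0.
have z0 : 0 < k * x * y by rewrite !mulr_gt0.
have p0 := lt_trans z0 kp; split=> //.
have y2 : y ^+ 2 = ln n%:R.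
  by rewrite -powR_mulrn ?powR_ge0 // -powRrM mulVf // powRr1 // ltW.
have x2 : n%:R * x ^+ 2 = 1.
  rewrite -powR_mulrn ?powR_ge0 // -powRrM mulNr mulVf // powRN powRr1 ?(ltW n0) //.
  by rewrite divff // lt0r_neq0.
have : n%:R * (k * x * y) ^+ 2 <= n%:R * p ^+ 2.
  by rewrite ler_pM2l // ler_sqr ?nnegrE ltW.
apply: le_trans; rewrite !exprMn y2.
have -> : n%:R * (k ^+ 2 * x ^+ 2 * ln n%:R) = k ^+ 2 * ln n%:R * (n%:R * x ^+ 2) by ring.
by rewrite x2 mulr1 ler_pM2r // expr2 ler_peMl // ltW.
Qed.

End Main.

Local Open Scope classical_set_scope.
Local Open Scope ring_scope.

Theorem theorem1p1 (R : realType) :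
  exists C : R, forall p : nat -> R,
    (forall n : nat, 0 <= p n <= 1) ->
    (\forall n \near \oo,
      C * n%:R `^ (- 2^-1) * (ln n%:R) `^ 2^-1 < p n) ->
    gnp_prob (p n) (@all_max_triangle_free_bipartite 'I_n) @[n --> \oo] --> (1 : R).
Proof.
have [k [n0 [k1 hk]]] := failure_prob R.
exists k => p p01 hp.
apply: (@squeeze_cvgr _ _ _ _ (fun n => 1 - 25 * n%:R^-1) (fun=> 1)); last exact: cvg_cst.
  near=> n.
  have n1 : (1 < n)%N by near: n; exact: nbhs_infty_gt.
  have kp : k * n%:R `^ (- 2^-1) * ln n%:R `^ 2^-1 < p n by near: n.
  have [q0 q1] := sqr_threshold k1 n1 kp.
  rewrite gnp_probE probC; apply/andP; split; last by rewrite gerBl prob_ge0.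
  have := hk 'I_n (p n); rewrite card_ord => h.
  rewrite lerD2l lerN2; apply: le_trans (h _ _ _ _) _ => //.
  - by near: n; exact: nbhs_infty_ger.
  - by case/andP: (p01 n).
  - by rewrite expRN lnK // posrE ltr0n ltnW.
rewrite -[X in _ --> X]subr0; apply: cvgB; first exact: cvg_cst.
rewrite -(mulr0 25); apply: cvgM; first exact: cvg_cst.
apply/gtr0_cvgV0; last exact: cvgr_idn.
by near=> n; rewrite ltr0n; near: n; exact: nbhs_infty_gt.
Unshelve. all: by end_near.
Qed.
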